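(* Let $N\ge1$ and let $c(t,x)=a_0\langle x\rangle^{-\alpha}(1+t)^{-\beta}$ with some $a_0>0$, where either ($\alpha<0$ and $\beta=0$) or ($\alpha<0$ and $\beta=1$). Assume that $$1<p\le 1+\frac{2}{N-\alpha},$$ and that, for some $R_0>0$, the functions $u_0\in H^1(\mathbb{R}^N)$, $u_1\in L^2(\mathbb{R}^N)$ satisfy $\mathrm{supp}\,(u_0,u_1)\subset\{x\in\mathbb{R}^N:|x|\le R_0\}$ and $$\int_{\mathbb{R}^N}\left(u_1(x)+(a_0\langle x\rangle^{-\alpha}-\beta)u_0(x)\right)dx>0.$$ Then there exist constants $\varepsilon_1>0$ and $C>0$ depending on $N,p,a_0,\alpha,u_0,u_1,R_0$ such that for any $\varepsilon\in(0,\varepsilon_1]$ the lifespan $T(\varepsilon)$ of the local solution of $$u_{tt}-\Delta u+c(t,x)u_t=|u|^p,\quad t>0,\ x\in\mathbb{R}^N,\qquad u(0,x)=\varepsilon u_0(x),\quad u_t(0,x)=\varepsilon u_1(x),$$ is estimated as $$T(\varepsilon)\le\begin{cases}C\,\varepsilon^{-\frac{2-\alpha}{2(1+\beta)}\left(\frac1{p-1}-\frac{N-\alpha}{2}\right)^{-1}} & \text{if } 1<p<1+\frac{2}{N-\alpha},\\[4pt] \exp\left(C\varepsilon^{-(p-1)}\right) & \text{if } p=1+\frac{2}{N-\alpha}.\end{cases}$$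
   Context: Here $\langle x\rangle:=\sqrt{1+|x|^2}$, and all functions are real-valued. A solution on $[0,T)$ is a function $u\in C([0,T);H^1(\mathbb{R}^N))\cap C^1([0,T);L^2(\mathbb{R}^N))$ that satisfies the equation (in the usual weak/distributional sense) and the initial conditions. For every $\varepsilon>0$ there is a unique local solution, and it satisfies $\mathrm{supp}\,u(t,\cdot)\subset\{x:|x|\le R_0+t\}$. The lifespan is $T(\varepsilon):=\sup\{T\in(0,\infty]:\text{there exists a unique solution } u\in C([0,T);H^1(\mathbb{R}^N))\cap C^1([0,T);L^2(\mathbb{R}^N))\}$. *)

(* Defs.v *)
From HB Require Import structures.
From mathcomp Require Import all_boot all_order all_algebra.
From mathcomp Require Import all_classical all_reals all_analysis.

Set Implicit Arguments.
Unset Strict Implicit.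
Unset Printing Implicit Defensive.

Import Order.TTheory GRing.Theory Num.Theory.
Import numFieldNormedType.Exports.

Local Open Scope classical_set_scope.
Local Open Scope ring_scope.

(* Points of R^N are row vectors. MathComp-Analysis gives 'rV[R]_N its topology
   and derivatives, with the sup norm as `|x|; the Euclidean length is [enorm]. *)

Section measurable_rV.
Context {R : realType} (n : nat).

Definition coord_rV (i : 'I_n) (x : 'rV[R]_n) : measurableTypeR R := x ord0 i.

Let rV_set0 : g_sigma_preimage coord_rV set0.
Proof. exact: sigma_algebra0. Qed.

Let rV_setC A : g_sigma_preimage coord_rV A -> g_sigma_preimage coord_rV (~` A).
Proof. exact: sigma_algebraC. Qed.

Let rV_bigcup (F : _^nat) : (forall i, g_sigma_preimage coord_rV (F i)) ->
  g_sigma_preimage coord_rV (\bigcup_i (F i)).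
Proof. exact: sigma_algebra_bigcup. Qed.

(* The Borel sigma-algebra of R^n, generated by the coordinates. *)
HB.instance Definition _ := @isMeasurable.Build
  (measure_tuple_display (measure_tuple_display default_measure_display))
  'rV[R]_n (g_sigma_preimage coord_rV) rV_set0 rV_setC rV_bigcup.

End measurable_rV.

Section lebesgue_rV.
Context {R : realType}.

Definition cons_rV n (z : 'rV[R]_n * measurableTypeR R) : 'rV[R]_n.+1 :=
  \row_(i < n.+1) (if unlift ord0 i is Some j then z.1 ord0 j else z.2).

Lemma measurable_coord_rV n (i : 'I_n) :
  measurable_fun [set: 'rV[R]_n] (coord_rV i).
Proof.
move=> _ Y mY; rewrite setTI; apply: sub_sigma_algebra => /=.
rewrite -bigcup_seq/=; exists i => /=; first by rewrite mem_index_enum.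
by exists Y => //; rewrite setTI.
Qed.

Lemma measurable_cons_rV n : measurable_fun setT (@cons_rV n).
Proof.
have coord (i : 'I_n.+1) :
    measurable_fun setT (coord_rV i \o @cons_rV n).
  case: (unliftP ord0 i) => [j ->|->].
    have -> : coord_rV (lift ord0 j) \o @cons_rV n = coord_rV j \o fst.
      by apply/funext => -[x t]; rewrite /coord_rV /= mxE liftK.
    by apply: (measurableT_comp (measurable_coord_rV j)).
  have -> : coord_rV ord0 \o @cons_rV n = snd.
    by apply/funext => -[x t]; rewrite /coord_rV /= mxE unlift_none.
  exact: measurable_snd.
move=> _ Y mY; rewrite setTI.
suff : (@g_sigma_preimage _ _ _ _ (@coord_rV R n.+1))
    `<=` [set B | measurable (@cons_rV n @^-1` B)].
  exact.
apply: smallest_sub.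
  split => /=.
  - by rewrite preimage_set0.
  - by move=> A mA; rewrite setTD -preimage_setC; apply: measurableC.
  - move=> F mF; rewrite /= preimage_bigcup.
    by apply: bigcup_measurable => k _; exact: mF.
rewrite -bigcup_mkord_ord; apply: bigcup_sub => i Ii.
move=> A [B mB <-] /=; rewrite setTI -comp_preimage -[X in measurable X]setTI.
exact: coord.
Qed.

Section step.
Context (n : nat) (m : {measure set 'rV[R]_n -> \bar R}).

Definition lebesgue_rV_step : set 'rV[R]_n.+1 -> \bar R :=
  pushforward (product_measure1 m (@lebesgue_measure R)) (@cons_rV n).

Let step0 : lebesgue_rV_step set0 = 0%E.
Proof. by rewrite /lebesgue_rV_step /pushforward preimage_set0 measure0. Qed.

Let step_ge0 A : (0 <= lebesgue_rV_step A)%E.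
Proof. by rewrite /lebesgue_rV_step /pushforward; apply: measure_ge0. Qed.

Let step_sigma_additive : semi_sigma_additive lebesgue_rV_step.
Proof.
move=> F mF tF mUF; rewrite /lebesgue_rV_step /pushforward preimage_bigcup.
have mpre i : measurable (@cons_rV n @^-1` F i).
  by rewrite -[X in measurable X]setTI; exact: measurable_cons_rV.
apply: measure_semi_sigma_additive => //.
- apply/trivIsetP => /= i j _ _ ij; rewrite -preimage_setI.
  by move/trivIsetP : tF => /(_ _ _ _ _ ij) ->//; rewrite preimage_set0.
- by apply: bigcup_measurable => k _; exact: mpre.
Qed.

HB.instance Definition _ := isMeasure.Build _ _ _ lebesgue_rV_step
  step0 step_ge0 step_sigma_additive.

End step.

(* Lebesgue measure on R^n: Dirac mass on R^0, then the product of the measure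
   on R^n with the Lebesgue measure of the line, carried to R^n.+1. *)
Fixpoint lebesgue_rV (n : nat) : {measure set 'rV[R]_n -> \bar R} :=
  match n with
  | 0 => dirac (0 : 'rV[R]_0)
  | m.+1 => lebesgue_rV_step (lebesgue_rV m)
  end.

End lebesgue_rV.

Section euclidean.
Context {R : realType} {N : nat}.
Implicit Types x : 'rV[R]_N.

Definition enorm x : R := Num.sqrt (\sum_(i < N) x ord0 i ^+ 2).

Definition jbracket x : R := Num.sqrt (1 + enorm x ^+ 2).

Definition basis_rV (i : 'I_N) : 'rV[R]_N := delta_mx ord0 i.

End euclidean.

Section test_functions.
Context {R : realType} {V : normedModType R}.

(* C^infinity: all iterated directional derivatives exist and are
   differentiable (V is meant to be finite dimensional). *)
Definition smooth (f : V -> R) : Prop :=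
  forall (s : seq V) (x : V),
    differentiable (foldr (fun v (g : V -> R) => 'D_v g) f s) x.

Definition test_function (U : set V) (f : V -> R) : Prop :=
  [/\ smooth f,
      compact (closure [set x | f x != 0]) &
      closure [set x | f x != 0] `<=` U].

End test_functions.

(* Elements of L^2 and H^1 are represented by Borel functions; equalities
   between them are meant almost everywhere. *)
Section sobolev.
Context {R : realType} {N : nat}.
Local Notation mu := (@lebesgue_rV R N).
Implicit Types f g : 'rV[R]_N -> R.

Definition L2 : {pred 'rV[R]_N -> R} := Lfun mu 2%:E.

Definition L2norm f : \bar R := Lnorm mu 2%:E (EFin \o f).

Definition weak_derivative (i : 'I_N) f g : Prop :=
  forall phi : 'rV[R]_N -> R, test_function setT phi ->
    \int[mu]_x (f x * 'D_(basis_rV i) phi x) = - \int[mu]_x (g x * phi x).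

Definition H1 f : Prop :=
  f \in L2 /\ forall i, exists2 g, g \in L2 & weak_derivative i f g.

(* The L^2 weak derivative, a.e. unique; irrelevant value when f is not in
   H^1. *)
Definition weak_partial (i : 'I_N) f : 'rV[R]_N -> R :=
  get [set g | g \in L2 /\ weak_derivative i f g].

Definition H1norm f : \bar R :=
  ((L2norm f `^ 2 + \sum_(i < N) L2norm (weak_partial i f) `^ 2) `^ 2^-1)%E.

End sobolev.

Section damped_wave.
Context {R : realType} {N : nat}.
Local Notation mu := (@lebesgue_rV R N).
Local Notation leb := (@lebesgue_measure R).
Implicit Types (T : \bar R) (c : R -> 'rV[R]_N -> R) (p : R).
Implicit Types (f g : 'rV[R]_N -> R) (u v : R -> 'rV[R]_N -> R).

Definition time T : set R := [set t | 0 <= t /\ (t%:E < T)%E].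

Definition continuous_H1 T u : Prop :=
  forall t, time T t -> H1 (u t) /\
    H1norm (u s \- u t) @[s --> within (time T) (nbhs t)] --> 0%E.

Definition continuous_L2 T u : Prop :=
  forall t, time T t -> u t \in L2 /\
    L2norm (u s \- u t) @[s --> within (time T) (nbhs t)] --> 0%E.

(* v is the time derivative of u on [0, T) in L^2, one-sided at t = 0. *)
Definition derivative_L2 T u v : Prop :=
  forall t, time T t ->
    L2norm (fun x => (s - t)^-1 * (u s x - u t x) - v t x)
      @[s --> within (time T) t^'] --> 0%E.

Definition spacetime T : set (R * 'rV[R]_N) :=
  [set z | 0 < z.1 /\ (z.1%:E < T)%E].

Definition Dt (psi : R * 'rV[R]_N -> R) : R * 'rV[R]_N -> R :=
  'D_((1, 0) : R * 'rV[R]_N) psi.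

Definition Dx (i : 'I_N) (psi : R * 'rV[R]_N -> R) : R * 'rV[R]_N -> R :=
  'D_((0, basis_rV i) : R * 'rV[R]_N) psi.

(* Formal adjoint of u_tt - Delta u + c u_t. *)
Definition wave_adjoint c (psi : R * 'rV[R]_N -> R) : R * 'rV[R]_N -> R :=
  fun z => Dt (Dt psi) z - \sum_(i < N) Dx i (Dx i psi) z
           - Dt (fun y => c y.1 y.2 * psi y) z.

(* u_tt - Delta u + c u_t = |u|^p in the sense of distributions on
   (0, T) x R^N. The integrals are extended-real valued: for psi >= 0 the
   right-hand side would be +oo if |u|^p psi were not integrable, so that the
   equation cannot hold by a junk value. *)
Definition weak_equation T c p u : Prop :=
  forall psi : R * 'rV[R]_N -> R, test_function (spacetime T) psi ->
    (\int[leb]_(t in [set t : R | (0 < t)%R /\ t%:E < T])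
        \int[mu]_x (u t x * wave_adjoint c psi (t, x))%:E =
     \int[leb]_(t in [set t : R | (0 < t)%R /\ t%:E < T])
        \int[mu]_x (`|u t x| `^ p * psi (t, x))%:E)%E.

(* Solution on [0, T) of
     u_tt - Delta u + c u_t = |u|^p,  u(0) = f,  u_t(0) = g. *)
Definition solution T c p f g u : Prop :=
  exists v, [/\ continuous_H1 T u, continuous_L2 T v, derivative_L2 T u v,
    weak_equation T c p u &
    {ae mu, forall x, u 0 x = f x} /\ {ae mu, forall x, v 0 x = g x}].

Definition unique_solution T c p f g : Prop :=
  exists2 u, solution T c p f g u &
    forall u', solution T c p f g u' ->
      forall t, time T t -> {ae mu, forall x, u' t x = u t x}.

Definition lifespan c p f g : \bar R :=
  ereal_sup [set T | (0 < T)%E /\ unique_solution T c p f g].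

Definition damping (a0 alpha beta : R) : R -> 'rV[R]_N -> R :=
  fun t x => a0 * jbracket x `^ (- alpha) * (1 + t) `^ (- beta).

End damped_wave.

(* Main.v *)
Require Import Defs.
From mathcomp Require Import all_boot all_order all_algebra.
From mathcomp Require Import all_classical all_reals all_analysis.
From mathcomp Require Import measurable_realfun.
From mathcomp Require Import ring lra.

Set Implicit Arguments.
Unset Strict Implicit.
Unset Printing Implicit Defensive.

Import Order.TTheory GRing.Theory Num.Theory.
Import numFieldNormedType.Exports.

Local Open Scope classical_set_scope.
Local Open Scope ring_scope.

(** The proof is the test function method, run at a large length [rho] and at
    the matching diffusive time [tau rho = rho `^ ((2 - alpha) / (1 + beta))].

    The equation is tested against
      psi(t, x) = (1 + beta t) chi(t / tau) chi(|x|^2 / rho^2),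
    where chi is a smooth cutoff, equal to 1 on [-1, 1] and to 0 outside
    [-2, 2].  The factor [1 + beta t] cancels the decay [(1 + t) `^ (- beta)] of
    the damping, for both values of [beta], so that the adjoint operator maps
    psi to a function that vanishes where both cutoffs are constant: everything
    that is not an initial value comes from [t >= tau] or [|x| >= rho].  The
    initial values combine into [eps] times the integral of
    [u1 + (a0 <x>^(-alpha) - beta) u0], which is positive by hypothesis; call
    it I.

    The cutoff is a high power of a bump, hence its first two derivatives are
    bounded by a power [1 / p] of itself ([smooth_cutoff]).  With the choice of
    [tau] this bounds the adjoint of psi by [rho^-2 (1 + beta t) psi^(1/p)],
    up to a constant ([test_error_bound]), and Young's inequality absorbs
    [|u|] into [|u|^p].  Let M(rho) be the integral of [|u|^p psi].  Since the
    error lives outside the support of the test function at scale [rho / 2],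
    for every [lam > 0] (lemma [energy_inequality])
      M(rho) + eps I + lam M(rho/2)
        <= lam M(rho) + K lam^(-1/(p-1)) rho^(N - alpha - 2/(p-1)).
    The last exponent is the volume [rho^N * rho^(2 - alpha)] of the support of
    psi, weighted by [1 + beta t], against [rho^(-2 p/(p-1))]; it is negative
    when [p < 1 + 2/(N - alpha)], and zero in the case of equality.

    When it is negative, [lam = 1] gives [eps I <= K rho^(N-alpha-2/(p-1))],
    which fails at some [rho] of the order of a negative power of [eps]; the
    solution cannot reach the time [2 tau rho] ([subcritical_lifespan]).  When it
    is zero, a value of [lam] that depends on [M(rho)] turns the inequality into
    a superlinear growth of [M(2^j rho) + eps I] in [j], which can last for at
    most [O(eps^(-(p-1)))] doublings of [rho] ([superlinear_growth],
    [critical_lifespan]).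

    Weak solutions are only tested away from [t = 0].  The initial values are
    therefore recovered by multiplying psi by a function of [t / d] that
    switches on between [d] and [2 d], and by letting [d] tend to 0
    ([weak_ode_initial_data]): the pairings of u and of its time derivative
    with a fixed L^2 function are continuous up to [t = 0]. *)

(** * Smooth functions built by elementary operations *)
Section smooth_closure.
Context {R : realType} {V : normedModType R}.
Implicit Types (f g : V -> R) (x v : V).

(** A syntactic sufficient condition for smoothness.  Smoothness asks for all
    iterated directional derivatives, so a product or a composition of smooth
    functions needs a class that is stable under a single derivative; this one
    is ([elementary_derive]).  A function of one variable enters through the
    whole sequence of its derivatives. *)
Inductive elementary : (V -> R) -> Prop :=
| elementary_affine f : (forall x, differentiable f x) ->
    (forall v, exists k : R, forall x, 'D_v f x = k) -> elementary f
| elementaryD f g : elementary f -> elementary g ->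
    elementary (fun x => f x + g x)
| elementaryM f g : elementary f -> elementary g ->
    elementary (fun x => f x * g x)
| elementaryV f : (forall x, f x != 0) -> elementary f ->
    elementary (fun x => (f x)^-1)
| elementary_comp (F : nat -> R -> R) n f :
    (forall k (y : R), is_derive y 1 (F k) (F k.+1 y)) -> elementary f ->
    elementary (fun x => F n (f x)).

Lemma elementary_cst k : elementary (fun=> k).
Proof.
apply: elementary_affine => [x|v]; first exact: differentiable_cst.
by exists 0 => x; rewrite derive_cst.
Qed.

Lemma elementary_differentiable f x : elementary f -> differentiable f x.
Proof.
move=> ef; elim: ef x => {f} [f df _ x|f g _ df _ dg x|f g _ df _ dg x|f f0 _ df x|F n f dF _ df x].
- exact: df.
- exact: differentiableD.
- exact: differentiableM.
- exact: differentiableV.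
- apply: (@differentiable_comp _ _ _ _ f (F n)) => //.
  by apply/derivable1_diffP; apply: ex_derive.
Qed.

Lemma derive_comp1 (F F' : R -> R) f x v :
  is_derive (f x) 1 F (F' (f x)) -> differentiable f x ->
  'D_v (fun y => F (f y)) x = F' (f x) * 'D_v f x.
Proof.
move=> dF df.
have dF' : differentiable F (f x) by apply/derivable1_diffP; apply: ex_derive.
rewrite deriveE; last exact: (@differentiable_comp _ _ _ _ f F).
rewrite diff_comp //= deriveE//.
rewrite diff1E// derive1E derive_val.
by rewrite /= mulrC.
Qed.

Lemma elementary_derive f v : elementary f -> elementary ('D_v f).
Proof.
move=> ef; elim: ef v => {f} [f df kf v|f g ef df eg dg v|f g ef df eg dg v|f f0 ef df v|F n f dF ef df v].
- have [k kfv] := kf v.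
  have -> : 'D_v f = fun=> k by apply/funext.
  exact: elementary_cst.
- have -> : 'D_v (fun x => f x + g x) = fun x => 'D_v f x + 'D_v g x.
    by apply/funext => x; rewrite deriveD//; apply: diff_derivable; exact: elementary_differentiable.
  exact: elementaryD.
- have -> : 'D_v (fun x => f x * g x) = fun x => f x * 'D_v g x + g x * 'D_v f x.
    by apply/funext => x; rewrite deriveM//; apply: diff_derivable; exact: elementary_differentiable.
  by apply: elementaryD; apply: elementaryM.
- have -> : 'D_v (fun x => (f x)^-1) = fun x => ((-1) * ((f x)^-1 * (f x)^-1)) * 'D_v f x.
    apply/funext => x; rewrite deriveV//; last by apply: diff_derivable; exact: elementary_differentiable.
    by rewrite mulN1r -invfM -expr2.
  apply: elementaryM => //; apply: elementaryM; first exact: elementary_cst.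
  by apply: elementaryM; exact: elementaryV.
- have -> : 'D_v (fun x => F n (f x)) = fun x => F n.+1 (f x) * 'D_v f x.
    by apply/funext => x; apply: derive_comp1; exact: elementary_differentiable.
  by apply: elementaryM => //; exact: elementary_comp.
Qed.

Lemma elementary_smooth f : elementary f -> smooth f.
Proof.
move=> ef s x; apply: elementary_differentiable.
by elim: s => //= v s; exact: elementary_derive.
Qed.

End smooth_closure.

(** * The flat function exp(-1/x) *)
Section flat.
Context {R : realType}.
Implicit Types (q : {poly R}) (x y : R).

(** The polynomial factor makes the family stable under derivation. *)
Definition flat q x : R := if 0 < x then q.[x^-1] * expR (- x^-1) else 0.

Definition flat_step q : {poly R} := 'X^2 * (q - q^`()).

Lemma monomial_expRN_bounded n y : 0 <= y -> y ^+ n * expR (- y) <= n`!%:R.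
Proof.
move=> y0; rewrite expRN ler_pdivrMr ?expR_gt0//.
case: n => [|n].
  by rewrite expr0 fact0 mul1r -expR0 ler_expR.
rewrite mulrC -ler_pdivrMr ?ltr0n ?fact_gt0//.
by apply: le_trans (expR_ge1Dxn n y0); rewrite lerDr.
Qed.

Lemma poly_expRN_bounded q :
  exists2 C : R, 0 <= C & forall y, 0 <= y -> `|q.[y]| * expR (- y) <= C.
Proof.
exists (\sum_(i < size q) `|q`_i| * (i`!)%:R).
  by apply: sumr_ge0 => i _; rewrite mulr_ge0.
move=> y y0; rewrite horner_coef.
apply: (@le_trans _ _ (\sum_(i < size q) `|q`_i| * (y ^+ i * expR (- y)))).
  under [leRHS]eq_bigr do rewrite mulrA.
  rewrite -mulr_suml ler_wpM2r ?expR_ge0//.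
  apply: le_trans (ler_norm_sum _ _ _) _.
  apply: ler_sum => i _.
  by rewrite normrM [X in _ * X]ger0_norm// exprn_ge0.
by apply: ler_sum => i _; rewrite ler_wpM2l// monomial_expRN_bounded.
Qed.

(** Exponential decay at infinity beats every polynomial; one power of [x] more
    than linear is what makes the derivative at 0 vanish. *)
Lemma flat_small q : exists2 C : R, 0 <= C & forall x, `|flat q x| <= C * x ^+ 2.
Proof.
have [C C0 HC] := poly_expRN_bounded ('X^2 * q); exists C => // x.
rewrite /flat; case: ifPn => [x0|_]; last first.
  by rewrite normr0 mulr_ge0// sqr_ge0.
have := HC x^-1; rewrite invr_ge0 => /(_ (ltW x0)).
rewrite hornerM hornerXn.
rewrite [X in _ -> X <= _]normrM (@ger0_norm _ (expR _)) ?expR_ge0//.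
rewrite normrM (@ger0_norm _ (x^-1 ^+ 2)) ?sqr_ge0//.
by rewrite -mulrA exprVn mulrC ler_pdivrMr// exprn_gt0.
Qed.

Lemma is_derive_flat q x : is_derive x 1 (flat q) (flat (flat_step q) x).
Proof.
have [x0|x0|->] := ltgtP x 0.
- rewrite {2}/flat ltNge (ltW x0)/=.
  apply: (@near_eq_is_derive _ _ _ (cst 0)).
  near=> y; rewrite /flat ifF//; apply/negbTE; rewrite -leNgt ltW//.
  by near: y; exact: lt_nbhsl.
- rewrite {2}/flat x0.
  apply: (@near_eq_is_derive _ _ _ (fun y => q.[y^-1] * expR (- y^-1))).
    near=> y; rewrite /flat ifT//.
    by near: y; exact: lt_nbhsr.
  have xn0 : x != 0 by rewrite gt_eqF.
  have dV : is_derive x 1 (fun y : R => y^-1) (- x ^- 2).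
    apply: DeriveDef; first exact: derivableV.
    by rewrite deriveV// derive_id /GRing.scale/= mulr1.
  have dq : is_derive x 1 (fun y : R => q.[y^-1]) (q^`().[x^-1] * - x ^- 2).
    by apply: (@is_derive1_comp _ (horner q) (fun y => y^-1)).
  have dN : is_derive x 1 (fun y : R => - y^-1) (x ^- 2).
    by apply: is_derive_eq; rewrite opprK.
  have de : is_derive x 1 (fun y : R => expR (- y^-1)) (expR (- x^-1) * x ^- 2).
    by apply: (@is_derive1_comp _ expR (fun y => - y^-1)).
  apply: is_derive_eq.
  rewrite /flat_step !hornerE /GRing.scale/= exprVn.
  ring.
- rewrite {2}/flat ltxx.
  have [C C0 HC] := flat_small q.
  have d0 : (fun h => h^-1 *: ((flat q \o shift 0) (h *: 1) - flat q 0)) @ 0^' --> (0:R).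
    apply/cvgrPdist_le => e e0; near=> h.
    have h0 : h != 0 by near: h; exact: nbhs_dnbhs_neq.
    rewrite {2}/flat ltxx subr0 sub0r normrN /= addr0 /GRing.scale/= mulr1.
    rewrite normrM normfV mulrC ler_pdivrMr ?normr_gt0//.
    apply: (le_trans (HC h)).
    rewrite -(ger0_norm (sqr_ge0 h)) normrX expr2 mulrA ler_pM2r ?normr_gt0//.
    apply: (@le_trans _ _ ((C + 1) * `|h|)).
      by rewrite ler_wpM2r// lerDl.
    rewrite mulrC -ler_pdivlMr ?ltr_wpDl//.
    by near: h; apply: dnbhs0_le; rewrite divr_gt0// ltr_wpDl.
  apply: DeriveDef; first by apply/cvg_ex; exists 0.
  exact: cvg_lim d0.
Unshelve. all: by end_near. Qed.
End flat.

(** * Smooth cutoffs *)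
Section cutoff.
Context {R : realType}.
Implicit Types (f : R -> R).

Lemma elementary_linear {V : normedModType R} (f : {linear V -> R}) : continuous f -> elementary f.
Proof.
move=> cf; apply: elementary_affine => [x|v]; first exact: linear_differentiable.
by exists (f v) => x; rewrite deriveE ?diff_lin//; exact: linear_differentiable.
Qed.

Lemma elementary_idfun : elementary (fun x : R => x).
Proof. by apply: (@elementary_linear _ idfun) => x; exact: cvg_id. Qed.

Lemma elementaryN {V : normedModType R} (f : V -> R) :
  elementary f -> elementary (fun z => - f z).
Proof.
move=> ef; have -> : (fun z => - f z) = (fun z => -1 * f z).
  by apply/funext => z; rewrite mulN1r.
by apply: elementaryM => //; exact: elementary_cst.
Qed.

Lemma derive_near_cst (f : R -> R) (c s : R) :
  (\forall y \near s, f y = c) -> 'D_(1 : R) f s = 0.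
Proof. by move=> fc; rewrite (@near_eq_derive _ _ _ f (cst c))// derive_cst. Qed.

Lemma elementary_derives f : elementary f ->
  forall k (x : R), is_derive x 1 (iter k (fun g : R -> R => 'D_(1 : R) g) f)
    (iter k.+1 (fun g : R -> R => 'D_(1 : R) g) f x).
Proof.
move=> ef k x; apply: derivableP; apply: diff_derivable.
apply: elementary_differentiable.
by elim: k => //= k; exact: elementary_derive.
Qed.

Lemma elementary_flat (q : {poly R}) {V : normedModType R} (f : V -> R) :
  elementary f -> elementary (fun x => flat q (f x)).
Proof.
pose F k := flat (iter k (@flat_step R) q).
by move=> ef; apply: (@elementary_comp _ _ F 0) => // k y; exact: is_derive_flat.
Qed.

Definition smooth_step (x : R) : R := flat 1 x / (flat 1 x + flat 1 (1 - x)).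

Let flat1_ge0 (x : R) : 0 <= flat 1 x.
Proof.
by rewrite /flat; case: ifP => // _; rewrite hornerC mul1r expR_ge0.
Qed.

Let flat1_gt0 (x : R) : 0 < x -> 0 < flat 1 x.
Proof. by rewrite /flat => ->; rewrite hornerC mul1r expR_gt0. Qed.

Let flat1_eq0 (x : R) : x <= 0 -> flat 1 x = 0.
Proof. by rewrite /flat leNgt; case: ifP. Qed.

Let den_gt0 (x : R) : 0 < flat 1 x + flat 1 (1 - x).
Proof.
have [x0|x0] := ltP 0 x; first by rewrite ltr_wpDr// flat1_gt0.
by rewrite ltr_wpDl// flat1_gt0// subr_gt0 (le_lt_trans x0).
Qed.

Lemma elementary_step {V : normedModType R} (f : V -> R) :
  elementary f -> elementary (fun x => smooth_step (f x)).
Proof.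
move=> ef; apply: elementaryM; first exact: elementary_flat.
apply: elementaryV => [x|]; first by rewrite gt_eqF.
apply: elementaryD; apply: elementary_flat => //.
apply: elementaryD; first exact: elementary_cst.
exact: elementaryN.
Qed.

Lemma smooth_step_ge0 (x : R) : 0 <= smooth_step x.
Proof. by rewrite /smooth_step divr_ge0// ltW. Qed.

Lemma smooth_step_le1 (x : R) : smooth_step x <= 1.
Proof. by rewrite /smooth_step ler_pdivrMr// mul1r lerDl. Qed.

Lemma smooth_step_eq0 (x : R) : x <= 0 -> smooth_step x = 0.
Proof. by move=> x0; rewrite /smooth_step flat1_eq0// mul0r. Qed.

Lemma smooth_step_eq1 (x : R) : 1 <= x -> smooth_step x = 1.
Proof.
move=> x1; rewrite /smooth_step (@flat1_eq0 (1 - x)) ?subr_le0// addr0 divff//.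
by rewrite gt_eqF// flat1_gt0// (lt_le_trans ltr01).
Qed.

Lemma elementaryX {V : normedModType R} (f : V -> R) n :
  elementary f -> elementary (fun x => f x ^+ n).
Proof.
move=> ef; elim: n => [|n IH].
  have -> : (fun x => f x ^+ 0) = (fun=> 1) by apply/funext => x; rewrite expr0.
  exact: elementary_cst.
have -> : (fun x => f x ^+ n.+1) = (fun x => f x * f x ^+ n) by apply/funext => x; rewrite exprS.
exact: elementaryM.
Qed.

Lemma elementary_bounded f (a b : R) : a <= b -> elementary f ->
  exists2 C : R, 0 < C & forall s : R, a <= s <= b -> `|f s| <= C.
Proof.
move=> ab ef.
have cf : {within `[a, b], continuous (fun s => `|f s|)}.
  apply: continuous_subspaceT => x.
  apply: (@continuous_comp _ _ _ f Num.norm); last exact: norm_continuous.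
  by apply: differentiable_continuous; exact: elementary_differentiable.
have [c _ Hc] := EVT_max ab cf.
exists (`|f c| + 1) => [|s sab]; first by rewrite ltr_wpDl.
by apply: (le_trans (Hc s _)); rewrite ?lerDl// in_itv.
Qed.

Lemma is_derive_exp (f : R -> R) (df s : R) n : is_derive s 1 f df ->
  is_derive s 1 (fun y => f y ^+ n.+1) (n.+1%:R * f s ^+ n * df).
Proof.
move=> h; have -> : (fun y => f y ^+ n.+1) = f ^+ n.+1.
  by apply/funext => y; elim: (n.+1) => [|k IH]; rewrite ?expr0// !exprS IH.
exact: (is_deriveX n.+1 h).
Qed.

Lemma derive_valE (f : R -> R) (df s : R) : is_derive s 1 f df -> 'D_(1:R) f s = df.
Proof. by move=> h; rewrite derive_val. Qed.

Lemma near_norm_lt (s a : R) : `|s| < a -> \forall y \near s, `|y| < a.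
Proof. by move=> h; exact: (cvgr_lt _ (@norm_continuous _ _ s) a h). Qed.

Lemma near_norm_gt (s a : R) : a < `|s| -> \forall y \near s, a < `|y|.
Proof. by move=> h; exact: (cvgr_gt _ (@norm_continuous _ _ s) a h). Qed.

(** The bounds on the first two derivatives of [b ^+ n.+2], with
    [x = b s ^+ n], [y = b s ^+ n.+1], and [z], [w] the derivatives of [b]. *)
Let cutoff_bounds (a c x y z w C1 C2 : R) : 1 <= a -> 1 <= c ->
  0 <= y -> y <= x -> 0 <= z -> z <= C1 -> 0 <= w -> w <= C2 ->
  a * y * z <= a * c * (C1 + C1 ^+ 2 + C2) * x /\
  a * c * x * z ^+ 2 + a * y * w <= a * c * (C1 + C1 ^+ 2 + C2) * x.
Proof.
move=> a1 c1 y0 yx z0 zC w0 wC.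
have h1 : y * z <= x * C1 by rewrite ler_pM.
have h2 : y * w <= x * C2 by rewrite ler_pM.
have h3 : x * z ^+ 2 <= x * C1 ^+ 2.
  by rewrite ler_wpM2l ?(le_trans y0)// lerXn2r// nnegrE// (le_trans z0).
have a0 : 0 <= a by lra.
have ac : a <= a * c by rewrite ler_peMr.
have x0 : 0 <= x by lra.
have xC1 : 0 <= x * C1 by rewrite mulr_ge0//; lra.
have xC2 : 0 <= x * C2 by rewrite mulr_ge0//; lra.
have xC12 : 0 <= x * C1 ^+ 2 by rewrite mulr_ge0// sqr_ge0.
have k1 : a * (x * C1) <= a * c * (x * C1) by rewrite ler_wpM2r.
have k2 : a * (x * C2) <= a * c * (x * C2) by rewrite ler_wpM2r.
have k3 : a * (y * z) <= a * (x * C1) by rewrite ler_wpM2l.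
have k4 : a * (y * w) <= a * (x * C2) by rewrite ler_wpM2l.
have ac0 : 0 <= a * c by rewrite mulr_ge0//; lra.
have k5 : a * c * (x * z ^+ 2) <= a * c * (x * C1 ^+ 2) by rewrite ler_wpM2l.
have k6 : 0 <= a * c * (x * C1) by rewrite mulr_ge0.
have k7 : 0 <= a * c * (x * C2) by rewrite mulr_ge0.
have k8 : 0 <= a * c * (x * C1 ^+ 2) by rewrite mulr_ge0.
have -> : a * c * (C1 + C1 ^+ 2 + C2) * x =
  a * c * (x * C1) + a * c * (x * C1 ^+ 2) + a * c * (x * C2) by ring.
rewrite -!(mulrA a y) -!(mulrA (a * c) x); split; lra.
Qed.

(** [F n] is the [n]-th derivative of the cutoff.  The last field is what Young's
    inequality requires, with [r] the inverse of the exponent of the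
    nonlinearity: an error term must be controlled by a power of the test
    function, even where that function is small. *)
Record cutoff (r : R) (F : nat -> R -> R) (C : R) : Prop := Cutoff {
  cutoff_const_gt0 : 0 < C;
  cutoff_derive : forall n (s : R), is_derive s 1 (F n) (F n.+1 s);
  cutoff_01 : forall s : R, 0 <= F 0 s <= 1;
  cutoff_eq1 : forall s : R, `|s| <= 1 -> F 0 s = 1;
  cutoff_eq0 : forall s : R, 2 <= `|s| -> F 0 s = 0;
  cutoff_flat : forall n (s : R), (0 < n)%N -> `|s| < 1 -> F n s = 0;
  cutoff_bound : forall n (s : R), (0 < n <= 2)%N -> `|F n s| <= C * F 0 s `^ r }.

(** Take the power [n + 2] of a bump [b].  Two derivatives of [b ^+ n.+2] keep a
    factor [b ^+ n], and [b ^+ n <= (b ^+ n.+2) `^ r] as soon as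
    [(n + 2) r <= n], which holds for large [n] because [r < 1]. *)
Lemma smooth_cutoff (r : R) : 0 < r < 1 ->
  exists (F : nat -> R -> R) (C : R), cutoff r F C.
Proof.
move=> /andP[r0 r1].
pose b s := smooth_step (2 - s) * smooth_step (2 + s).
have eb : elementary b.
  apply: elementaryM; apply: elementary_step; apply: elementaryD; try exact: elementary_cst.
    by apply: elementaryN; exact: elementary_idfun.
  exact: elementary_idfun.
have b0 (s : R) : 0 <= b s by rewrite mulr_ge0// smooth_step_ge0.
have b1 (s : R) : b s <= 1 by rewrite mulr_ile1// ?smooth_step_ge0// smooth_step_le1.
have b2 (s : R) : `|s| <= 1 -> b s = 1.
  by rewrite ler_norml => /andP[s1 s2]; rewrite /b !smooth_step_eq1 ?mulr1//; lra.
have b3 (s : R) : 2 <= `|s| -> b s = 0.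
  rewrite /b ler_normr => /orP[] s2.
    by rewrite (@smooth_step_eq0 (2 - s)) ?mul0r//; lra.
  by rewrite (@smooth_step_eq0 (2 + s)) ?mulr0//; lra.
pose D (g : R -> R) := 'D_(1 : R) g.
have eb1 : elementary (D b) by exact: elementary_derive.
have eb2 : elementary (D (D b)) by exact: elementary_derive.
have m22 : -2 <= 2 :> R by lra.
have [C1 C10 HC1] := elementary_bounded m22 eb1.
have [C2 C20 HC2] := elementary_bounded m22 eb2.
have db (s : R) : is_derive s 1 b (D b s) by exact: (elementary_derives eb 0).
have ddb (s : R) : is_derive s 1 (D b) (D (D b) s) by exact: (elementary_derives eb 1).
pose n := Num.bound (2 * r / (1 - r)).
have hn : (n.+2)%:R * r <= n%:R.
  have : 2 * r / (1 - r) < n%:R by apply: archi_boundP; rewrite divr_ge0//; lra.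
  rewrite ltr_pdivrMr; last lra.
  by rewrite -addn2 natrD; lra.
pose F k := iter k D (fun s => b s ^+ n.+2).
have eB : elementary (fun s => b s ^+ n.+2) by exact: elementaryX.
have dF k (s : R) : is_derive s 1 (F k) (F k.+1 s) by exact: (elementary_derives eB k).
have F1E : F 1%N = fun s => n.+2%:R * b s ^+ n.+1 * D b s.
  apply/funext => s; rewrite /F /= /D.
  exact: derive_valE (is_derive_exp n.+1 (db s)).
have F2E : F 2%N = fun s => n.+2%:R * n.+1%:R * b s ^+ n * D b s ^+ 2 + n.+2%:R * b s ^+ n.+1 * D (D b) s.
  apply/funext => s; rewrite -[F 2%N]/(D (F 1%N)) F1E /D.
  have h := is_deriveM (is_deriveM (is_derive_cst (n.+2%:R : R) s (1 : R)) (is_derive_exp n (db s))) (ddb s).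
  apply: etrans (derive_valE h) _.
  change (n.+2%:R * b s ^+ n.+1 * D (D b) s +
    D b s * (n.+2%:R * (n.+1%:R * b s ^+ n * D b s) + b s ^+ n.+1 * 0) =
    n.+2%:R * n.+1%:R * b s ^+ n * D b s ^+ 2 + n.+2%:R * b s ^+ n.+1 * D (D b) s).
  ring.
have Fz k (s : R) : (0 < k)%N -> `|s| < 1 -> F k s = 0.
  case: k => // k _; elim: k s => [|k IH] s s1.
    apply: (@derive_near_cst _ 1); near=> y.
    rewrite /F /= b2 ?expr1n//; apply/ltW; near: y.
    exact: near_norm_lt.
  apply: (@derive_near_cst _ 0); near=> y.
  apply: IH; near: y.
  exact: near_norm_lt.
have Fo k (s : R) : (0 < k)%N -> 2 < `|s| -> F k s = 0.
  case: k => // k _; elim: k s => [|k IH] s s1.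
    apply: (@derive_near_cst _ 0); near=> y.
    rewrite /F /= b3 ?expr0n//; apply/ltW; near: y.
    exact: near_norm_gt.
  apply: (@derive_near_cst _ 0); near=> y.
  apply: IH; near: y.
  exact: near_norm_gt.
exists F, (n.+2%:R * n.+1%:R * (C1 + C1 ^+ 2 + C2)); split => //.
- by rewrite !mulr_gt0 ?ltr0n// !addr_gt0// exprn_gt0.
- by move=> s; rewrite /F /= exprn_ge0//= exprn_ile1.
- by move=> s s1; rewrite /F /= b2// expr1n.
- by move=> s s1; rewrite /F /= b3// expr0n.
have n_gt0 : (0 < n)%N.
  rewrite lt0n; apply/negP => /eqP n0; move: hn; rewrite n0; nra.
have bn (s : R) : b s ^+ n <= F 0%N s `^ r.
  have [->|bs0] := eqVneq (b s) 0; first by rewrite expr0n eqn0Ngt n_gt0/= powR_ge0.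
  have {}bs0 : 0 < b s by rewrite lt_neqAle eq_sym bs0 b0.
  rewrite /F/= -!powR_mulrn// -powRrM.
  by apply: ger_powR => //; rewrite bs0 b1.
move=> k s k12.
case: (ltP 2 `|s|) => s2.
  rewrite Fo//; last by case/andP: k12.
  by rewrite normr0 mulr_ge0// ?powR_ge0// !mulr_ge0// !addr_ge0 ?sqr_ge0// ltW.
have {}s2 : -2 <= s <= 2 by rewrite -ler_norml.
suff : `|F k s| <= n.+2%:R * n.+1%:R * (C1 + C1 ^+ 2 + C2) * b s ^+ n.
  move=> h; apply: (le_trans h); rewrite ler_wpM2l//.
  by rewrite !mulr_ge0// !addr_ge0 ?sqr_ge0// ltW.
have bb : b s ^+ n.+1 <= b s ^+ n by rewrite exprS ler_piMl// exprn_ge0.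
have H1 := HC1 s s2; have H2 := HC2 s s2.
have nn0 : 0 <= b s ^+ n by rewrite exprn_ge0.
have nn1 : 0 <= b s ^+ n.+1 by rewrite exprn_ge0.
have n2 : 1 <= n.+2%:R :> R by rewrite ler1n.
have n1 : 1 <= n.+1%:R :> R by rewrite ler1n.
have [B1 B2] := cutoff_bounds n2 n1 nn1 bb (normr_ge0 _) H1 (normr_ge0 _) H2.
case: k k12 => [|[|[|]]]// _.
- by rewrite F1E 2!normrM normr_nat (ger0_norm nn1).
- rewrite F2E; apply: le_trans (ler_normD _ _) _.
  by rewrite (normrM _ (D b s ^+ 2)) (normrM _ (b s ^+ n)) (normrM _ n.+1%:R)
    (normrM _ (D (D b) s)) (normrM _ (b s ^+ n.+1)) (normrX 2) !normr_nat
    (ger0_norm nn1) (ger0_norm nn0).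
Unshelve. all: by end_near. Qed.
End cutoff.

(** * Separated test functions *)
Section separated_test_function.
Context {R : realType} {N : nat}.
Implicit Types (x : 'rV[R]_N).

Definition sqnorm x : R := \sum_(i < N) x ord0 i ^+ 2.

Lemma sqnorm_ge0 x : 0 <= sqnorm x.
Proof. by apply: sumr_ge0 => i _; rewrite sqr_ge0. Qed.

Lemma sqr_coord_le x i : x ord0 i ^+ 2 <= sqnorm x.
Proof. by rewrite /sqnorm (bigD1 i)//= lerDl sumr_ge0// => j _; rewrite sqr_ge0. Qed.

Lemma coord_le_of_sqnorm (k : R) x i : 0 < k -> k * sqnorm x < 2 ->
  `|x ord0 i| <= 2 / k + 1.
Proof.
move=> k0 h1; have h2 := sqr_coord_le x i.
have h3 : x ord0 i ^+ 2 < 2 / k by rewrite ltr_pdivlMr// mulrC (le_lt_trans _ h1)// ler_pM2l.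
rewrite leNgt; apply/negP => h4; pose M := 2 / k + 1.
have M1 : 1 <= M by rewrite lerDr divr_ge0// ltW.
have : M ^+ 2 < x ord0 i ^+ 2.
  by rewrite -(real_normK (num_real (x ord0 i))) ltrXn2r// (le_trans ler01).
have : 2 / k <= M by rewrite lerDl.
nra.
Qed.

Lemma enormE x : enorm x ^+ 2 = sqnorm x.
Proof. by rewrite /enorm sqr_sqrtr// sqnorm_ge0. Qed.

(** A directional derivative only sees one line. *)
Lemma derive_lineE {V : normedModType R} (f : V -> R) (z v : V) (d : R) :
  is_derive (0 : R) 1 (fun h : R => f (h *: v + z)) d -> 'D_v f z = d.
Proof.
move=> h; rewrite -(@derive_val _ _ _ _ _ _ _ h) /derive.
apply: (f_equal (fun g : R -> R => lim (g @ 0^'))); apply/funext => k /=.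
by rewrite addr0 scale0r add0r [k *: 1]mulr1.
Qed.

Lemma sqnorm_line x i h :
  sqnorm (h *: basis_rV i + x) = sqnorm x + 2 * x ord0 i * h + h ^+ 2.
Proof.
rewrite /sqnorm (bigD1 i)//= [in RHS](bigD1 i)//= !mxE !eqxx/=.
rewrite (eq_bigr (fun j => x ord0 j ^+ 2)) => [|j ji].
  by rewrite mulr1; ring.
by rewrite !mxE (negbTE ji) andbF mulr0 add0r.
Qed.

Lemma line_coord x i (h : R) : (h *: basis_rV i + x) ord0 i = h + x ord0 i.
Proof. by rewrite !mxE !eqxx/= mulr1. Qed.

(** With [F] a sequence of derivatives, this is the [n]-th derivative of the
    profile, and not of the function of [x]. *)
Definition radial (F : nat -> R -> R) (k : R) n x := F n (k * sqnorm x).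

(** The Laplacian of [x |-> F 0 (k |x|^2)]; see [laplace_separated]. *)
Definition laplace_radial (F : nat -> R -> R) (k : R) x : R :=
  4 * k ^+ 2 * sqnorm x * radial F k 2 x + 2 * k * N%:R * radial F k 1 x.

Context (F : nat -> R -> R) (k : R)
  (dF : forall n (s : R), is_derive s 1 (F n) (F n.+1 s)).

Lemma is_derive_radial_line n x i (h : R) :
  is_derive h 1 (fun h : R => radial F k n (h *: basis_rV i + x))
   (radial F k n.+1 (h *: basis_rV i + x) * (2 * k * (h *: basis_rV i + x) ord0 i)).
Proof.
have -> : (fun h : R => radial F k n (h *: basis_rV i + x)) =
   (fun h => F n (k * (sqnorm x + 2 * x ord0 i * h + h ^+ 2))).
  by apply/funext => z; rewrite /radial sqnorm_line.
have d1 : is_derive h 1 (fun h : R => k * (sqnorm x + 2 * x ord0 i * h + h ^+ 2))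
    (k * (2 * x ord0 i + 2 * h)).
  have d0 : is_derive h 1 (fun h : R => h ^+ 2) (2 * h).
    by apply: (is_derive_eq (is_derive_exp 1 (is_derive_id h (1 : R)))); rewrite expr1 mulr1.
  have d2 : is_derive h 1 (fun h : R => 2 * x ord0 i * h) (2 * x ord0 i).
    by apply: is_derive_eq; rewrite /GRing.scale/= !(mulr1, mulr0, addr0).
  apply: is_derive_eq.
  by rewrite /GRing.scale/= !(mulr0, addr0, add0r, mul1r).
apply: (is_derive_eq (@is_derive1_comp _ (F n) _ h _ _ (dF n _) d1)).
by rewrite /radial sqnorm_line line_coord; ring.
Qed.

Context (w : nat -> R -> R)
  (dw : forall n (s : R), is_derive s 1 (w n) (w n.+1 s)).

Definition separated (z : R * 'rV[R]_N) := w 0 z.1 * radial F k 0 z.2.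

Lemma derive_time (g : R -> R) (g' : R) (c : 'rV[R]_N -> R) (t : R) x :
  is_derive t 1 g g' ->
  Dt (fun z => g z.1 * c z.2) (t, x) = g' * c x.
Proof.
move=> dg; apply: derive_lineE.
have -> : (fun h : R => g (h *: (1, 0) + (t, x)).1 * c (h *: (1, 0) + (t, x)).2)
  = (fun h : R => (c x) *: g (h + t)).
  by apply/funext => h /=; rewrite scaler0 add0r [h *: 1]mulr1 mulrC.
have h1 : is_derive (0:R) 1 (fun h : R => h + t) 1.
  by apply: is_derive_eq; rewrite addr0.
have h2 : is_derive (0:R) 1 (fun h : R => g (h + t)) g'.
  have h0 : is_derive (0 + t) 1 g g' by rewrite add0r.
  by apply: (is_derive_eq (@is_derive1_comp _ g _ 0 _ _ h0 h1)); rewrite mulr1.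
apply: is_derive_eq.
by rewrite mulrC.
Qed.

Lemma Dtt_separated t x : Dt (Dt separated) (t, x) = w 2 t * radial F k 0 x.
Proof.
have -> : Dt separated = fun z => w 1 z.1 * radial F k 0 z.2.
  by apply/funext => -[s y]; apply: derive_time.
exact: derive_time.
Qed.

Lemma Dx_space (g : R -> R) n i t x :
  Dx i (fun z => g z.1 * radial F k n z.2) (t, x) =
  g t * (radial F k n.+1 x * (2 * k * x ord0 i)).
Proof.
apply: derive_lineE.
have -> : (fun h : R => g (h *: (0, basis_rV i) + (t, x)).1 *
     radial F k n (h *: (0, basis_rV i) + (t, x)).2)
  = (fun h : R => g t *: radial F k n (h *: basis_rV i + x)).
  by apply/funext => h /=; rewrite scaler0 add0r.
have h := is_derive_radial_line n x i 0.
apply: is_derive_eq.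
by rewrite scale0r add0r.
Qed.

Lemma laplace_separated t x :
  \sum_(i < N) Dx i (Dx i separated) (t, x) = w 0 t * laplace_radial F k x.
Proof.
transitivity (\sum_(i < N) w 0 t * (radial F k 2 x * (4 * k ^+ 2 * x ord0 i ^+ 2) + radial F k 1 x * (2 * k))).
  apply: eq_bigr => i _.
  have -> : Dx i separated = fun z => w 0 z.1 * (radial F k 1 z.2 * (2 * k * z.2 ord0 i)).
    by apply/funext => -[s y]; rewrite Dx_space.
  apply: derive_lineE.
  have -> : (fun h : R => w 0 (h *: (0, basis_rV i) + (t, x)).1 *
     (radial F k 1 (h *: (0, basis_rV i) + (t, x)).2 *
       (2 * k * (h *: (0, basis_rV i) + (t, x)).2 ord0 i)))
   = (fun h : R => w 0 t *: (radial F k 1 (h *: basis_rV i + x) * (2 * k * (x ord0 i + h)))).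
    apply/funext => h /=; rewrite scaler0 add0r.
    by rewrite line_coord [h + _]addrC.
  have h1 := is_derive_radial_line 1 x i 0.
  have h2 : is_derive (0:R) 1 (fun h : R => 2 * k * (x ord0 i + h)) (2 * k).
    apply: is_derive_eq.
    by rewrite /GRing.scale/= !(scaler0,addr0,add0r,mulr1).
  apply: (is_derive_eq (is_deriveZ (w 0 t) (is_deriveM h1 h2))).
  rewrite scale0r !add0r addr0 /GRing.scale/=; ring.
rewrite -mulr_sumr big_split/= -mulr_sumr -mulr_sumr sumr_const card_ord /laplace_radial -/(sqnorm x).
rewrite -[_ *+ N]mulr_natr; ring.
Qed.

End separated_test_function.

Lemma differentiable_fst {R : realType} {V W : normedModType R} (z : V * W) :
  differentiable (fst : V * W -> V) z.
Proof. by apply: linear_differentiable => x; exact: cvg_fst. Qed.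

Lemma differentiable_snd {R : realType} {V W : normedModType R} (z : V * W) :
  differentiable (snd : V * W -> W) z.
Proof. by apply: linear_differentiable => x; exact: cvg_snd. Qed.

Section separated_test_function_support.
Context {R : realType} {N : nat}.
Implicit Types (x : 'rV[R]_N).

Lemma elementary_time : elementary (fun z : R * 'rV[R]_N => z.1).
Proof.
apply: elementary_affine => [z|v]; first exact: differentiable_fst.
exists v.1 => z; apply: derive_lineE.
have -> : (fun h : R => (h *: v + z).1) = (fun h => v.1 *: h + z.1).
  by apply/funext => h; rewrite /= [h *: _]mulrC.
apply: is_derive_eq.
by rewrite addr0 [_ *: _]mulr1.
Qed.

Lemma elementary_coord i : elementary (fun z : R * 'rV[R]_N => z.2 ord0 i).
Proof.
apply: elementary_affine => [z|v].
  apply: (@differentiable_comp _ _ _ _ snd (fun x : 'rV[R]_N => x ord0 i)).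
    exact: differentiable_snd.
  exact: differentiable_coord.
exists (v.2 ord0 i) => z; apply: derive_lineE.
have -> : (fun h : R => (h *: v + z).2 ord0 i) = (fun h => v.2 ord0 i *: h + z.2 ord0 i).
  by apply/funext => h; rewrite /= !mxE [h * _]mulrC.
apply: is_derive_eq.
by rewrite addr0 [_ *: _]mulr1.
Qed.

Lemma elementary_sum {V : normedModType R} (I : Type) (s : seq I) (f : I -> V -> R) :
  (forall i, elementary (f i)) -> elementary (fun z => \sum_(i <- s) f i z).
Proof.
move=> ef; elim: s => [|i s IH].
  have -> : (fun z => \sum_(i <- [::]) f i z) = (fun=> 0) by apply/funext => z; rewrite big_nil.
  exact: elementary_cst.
have -> : (fun z => \sum_(j <- i :: s) f j z) = (fun z => f i z + \sum_(j <- s) f j z).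
  by apply/funext => z; rewrite big_cons.
exact: elementaryD.
Qed.

Context (F : nat -> R -> R) (k : R) (w : nat -> R -> R)
  (dF : forall n (s : R), is_derive s 1 (F n) (F n.+1 s))
  (dw : forall n (s : R), is_derive s 1 (w n) (w n.+1 s)).

Lemma smooth_separated : smooth (@separated R N F k w).
Proof.
apply: elementary_smooth; apply: elementaryM.
  by apply: (elementary_comp 0 dw); exact: elementary_time.
apply: (elementary_comp 0 dF); apply: elementaryM; first exact: elementary_cst.
apply: elementary_sum => i; apply: elementaryX; exact: elementary_coord.
Qed.

Lemma test_function_separated (T : \bar R) (a b : R) :
  0 < a -> (b%:E < T)%E -> 0 < k ->
  (forall t, w 0 t != 0 -> a <= t <= b) ->
  (forall s, 2 <= `|s| -> F 0 s = 0) ->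
  test_function (spacetime T) (@separated R N F k w).
Proof.
move=> a0 bT k0 wab F2; pose M := 2 / k + 1.
pose K : set (R * 'rV[R]_N) := `[a, b]%classic `*`
  [set x : 'rV[R]_N | forall i, `[- M, M]%classic (x ord0 i)].
have cK : compact K.
  apply: compact_setX; first exact: segment_compact.
  by apply: (@rV_compact R N (fun=> `[- M, M]%classic)) => i; exact: segment_compact.
have cl : closed K by apply: compact_closed => //; exact: norm_hausdorff.
have sK : closure [set z | separated F k w z != 0] `<=` K.
  rewrite [X in _ `<=` X](closure_id K).1//.
  apply: closureS => -[t x] /=; rewrite /separated mulf_eq0 negb_or => /andP[/= wt Fx].
  split => /=; first by rewrite in_itv/=; exact: wab.
  move=> i; rewrite in_itv/= -ler_norml.
  have h1 : k * sqnorm x < 2.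
    rewrite ltNge; apply/negP => h; move/eqP: Fx; apply; apply: F2.
    exact: (le_trans h (ler_norm _)).
  exact: coord_le_of_sqnorm.
split; first exact: smooth_separated.
- by apply: (subclosed_compact _ cK sK); exact: closed_closure.
- apply: (subset_trans sK) => -[t x] [/= + _]; rewrite in_itv/= => /andP[at_ tb].
  split => /=; first exact: lt_le_trans at_.
  by apply: le_lt_trans bT; rewrite lee_fin.
Qed.

(** The damping depends on [t] only through [(1 + t) `^ (- beta)], so its
    contribution is governed by the product [e] of this factor with the time
    profile. *)
Lemma wave_adjoint_separated (a0 alpha beta : R) (e : R -> R) (e' t : R) x :
  -1 < t -> (forall s, -1 < s -> (1 + s) `^ (- beta) * w 0 s = e s) ->
  is_derive t 1 e e' ->
  wave_adjoint (damping a0 alpha beta) (separated F k w) (t, x) =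
  w 2 t * radial F k 0 x - w 0 t * laplace_radial F k x
   - e' * (a0 * jbracket x `^ (- alpha) * radial F k 0 x).
Proof.
move=> t1 eE de; rewrite /wave_adjoint Dtt_separated// laplace_separated//; congr (_ - _).
apply: derive_lineE => /=.
pose c := a0 * jbracket x `^ (- alpha) * radial F k 0 x.
apply: (@near_eq_is_derive _ _ _ (fun h : R => c *: e (h + t))).
  near=> h; rewrite /damping /separated /= !scaler0 !add0r.
  have -> : h *: (1 : R) = h by rewrite [LHS]mulr1.
  rewrite -eE; first by rewrite /c /GRing.scale/=; ring.
  rewrite -ltrBlDr; near: h; apply: lt_nbhsr; by rewrite ltrBlDr add0r.
have h1 : is_derive (0:R) 1 (fun h : R => h + t) 1.
  by apply: is_derive_eq; rewrite addr0.
have h2 : is_derive (0:R) 1 (fun h : R => e (h + t)) e'.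
  have h0 : is_derive (0 + t) 1 e e' by rewrite add0r.
  by apply: (is_derive_eq (@is_derive1_comp _ e _ 0 _ _ h0 h1)); rewrite mulr1.
apply: is_derive_eq.
by rewrite mulrC.
Unshelve. all: by end_near. Qed.

End separated_test_function_support.

(** * Pairings in L^2 *)
Section pairing.
Context {d} {T : measurableType d} {R : realType} (mu : {measure set T -> \bar R}).
Implicit Types f g : T -> R.

Lemma L2_measurable f : f \in Lfun mu 2%:E -> measurable_fun setT f.
Proof. by rewrite inE => /andP[]; rewrite inE. Qed.

Lemma L2_norm_fin f : f \in Lfun mu 2%:E -> (Lnorm mu 2%:E (EFin \o f) < +oo)%E.
Proof. by rewrite inE => /andP[_]; rewrite inE. Qed.

Lemma L2_mul_integrable f g : f \in Lfun mu 2%:E -> g \in Lfun mu 2%:E ->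
  mu.-integrable setT (EFin \o (fun x => f x * g x)).
Proof. by move=> f2 g2; apply/Lfun1_integrable; exact: Lfun2_mul_Lfun1. Qed.

Lemma L2_linear a f g : f \in Lfun mu 2%:E -> g \in Lfun mu 2%:E ->
  (a *: f + g) \in Lfun mu 2%:E.
Proof.
have p1 : (1 <= 2%:E :> \bar R)%E by rewrite lee_fin ler1n.
by have [_ h] := Lfun_submod_closed mu p1; exact: h.
Qed.

Lemma L2_sub f g : f \in Lfun mu 2%:E -> g \in Lfun mu 2%:E ->
  (f - g) \in Lfun mu 2%:E.
Proof.
move=> f2 g2; have -> : f - g = (-1) *: g + f by rewrite scaleN1r addrC.
exact: L2_linear.
Qed.

Lemma L2_cauchy_schwarz f g : f \in Lfun mu 2%:E -> g \in Lfun mu 2%:E ->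
  (`|\int[mu]_x (f x * g x)|%:E <=
    Lnorm mu 2%:E (EFin \o f) * Lnorm mu 2%:E (EFin \o g))%E.
Proof.
move=> f2 g2; rewrite EFin_normr_Rintegral//; last exact: L2_mul_integrable.
apply: (le_trans (le_abse_integral _ _ _)) => //.
  by apply: measurable_int; exact: L2_mul_integrable.
rewrite -(Lnorm1 mu (EFin \o (fun x => f x * g x))).
apply: (hoelder mu (L2_measurable f2) (L2_measurable g2)) => //.
by rewrite [RHS]splitr !div1r.
Qed.

Lemma L2_pairing_cvg (I : Type) (F : set_system I) {FF : Filter F} (U : I -> T -> R) f g :
  (\forall s \near F, U s \in Lfun mu 2%:E) -> f \in Lfun mu 2%:E ->
  g \in Lfun mu 2%:E ->
  Lnorm mu 2%:E (EFin \o (U s \- f)%R) @[s --> F] --> 0%E ->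
  \int[mu]_x (U s x * g x) @[s --> F] --> \int[mu]_x (f x * g x).
Proof.
move=> U2 f2 g2 Uf; apply/cvgrPdist_le => e e0.
pose G := fine (Lnorm mu 2%:E (EFin \o g)).
have GE : Lnorm mu 2%:E (EFin \o g) = G%:E.
  by rewrite /G fineK// ge0_fin_numE ?L2_norm_fin// Lnorm_ge0.
have G0 : 0 <= G by rewrite fine_ge0// Lnorm_ge0.
have d0 : 0 < e / (G + 1) by rewrite divr_gt0// ltr_wpDl.
have near1 : \forall s \near F, (Lnorm mu 2%:E (EFin \o (U s \- f)%R) < (e / (G + 1))%:E)%E.
  have [Ufin Ulim] := (fine_cvgP _ _).1 Uf.
  near=> s.
  have sfin : Lnorm mu 2%:E (EFin \o (U s \- f)%R) \is a fin_num by near: s.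
  rewrite -(fineK sfin) lte_fin; near: s.
  exact: (cvgr_lt _ Ulim).
near=> s.
have Us : U s \in Lfun mu 2%:E by near: s.
have Usf : (U s \- f) \in Lfun mu 2%:E.
  have -> : U s \- f = U s - f by [].
  exact: L2_sub.
rewrite distrC -RintegralB//; [|exact: L2_mul_integrable..].
under eq_Rintegral do rewrite -mulrBl.
rewrite -lee_fin; apply: (le_trans (L2_cauchy_schwarz Usf g2)).
rewrite GE.
apply: (@le_trans _ _ ((e / (G + 1))%:E * G%:E)%E).
  rewrite lee_wpmul2r ?lee_fin//; apply: ltW; near: s; exact: near1.
rewrite -EFinM lee_fin -mulrA ler_piMr// ?(ltW e0)// mulrC ler_pdivrMr ?mul1r ?lerDl//.
by rewrite ltr_wpDl.
Unshelve. all: by end_near. Qed.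
End pairing.

(** * Lebesgue measure of boxes, and weights supported in a ball *)
Section lebesgue_rV_box.
Context {R : realType}.

Definition box N (M : R) : set 'rV[R]_N := [set x | forall i, `|x ord0 i| <= M].

Lemma measurable_coord N (i : 'I_N) : measurable_fun setT (fun x : 'rV[R]_N => x ord0 i : R).
Proof. exact: measurable_coord_rV. Qed.

Lemma measurable_sqnorm N : measurable_fun setT (@sqnorm R N).
Proof.
by apply: measurable_sum => i; apply: measurable_funX; exact: measurable_coord.
Qed.

Lemma measurable_box N M : measurable (@box N M).
Proof.
have -> : @box N M = \bigcap_(i in [set: 'I_N]) ((fun x : 'rV[R]_N => x ord0 i) @^-1` `[- M, M]%classic).
  apply/seteqP; split => x /= h i; last first.
    by have := h i I; rewrite /= in_itv/= ler_norml.
  by move=> _ /=; rewrite in_itv/= -ler_norml.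
apply: fin_bigcap_measurable => //.
by move=> i _; rewrite -[X in measurable X]setTI; apply: measurable_coord.
Qed.

Lemma lebesgue_box N M : 0 <= M -> lebesgue_rV N (@box N M) = ((2 * M) ^+ N)%:E.
Proof.
move=> M0; elim: N => [|N IH].
  rewrite expr0 /= /dirac indicE mem_set// => -[m i]; by [].
rewrite [LHS](_ : _ = (product_measure1 (lebesgue_rV N) (@lebesgue_measure R)) (@box N M `*` `[- M, M]%classic)).
  rewrite product_measure1E//; last exact: measurable_box.
  have lM : lebesgue_measure `[- M, M]%classic = (M - - M)%:E.
    rewrite lebesgue_measure_itv/= lte_fin.
    have [//|Mlt] := ltP (- M) M.
    by have -> : M = 0 by [lra]; rewrite oppr0 subrr.
  transitivity (((2 * M) ^+ N)%:E * (M - - M)%:E)%E; first by congr (_ * _)%E.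
  by rewrite -EFinM exprSr; congr (EFin (_ * _)); lra.
rewrite /= /lebesgue_rV_step /pushforward; congr (product_measure1 _ _ _).
apply/seteqP; split => -[z t] /=.
  move=> h; split.
    by move=> i; have := h (lift ord0 i); rewrite mxE liftK.
  by have := h ord0; rewrite mxE unlift_none in_itv/= ler_norml.
move=> [h1 h2] i; rewrite mxE; case: unliftP => [j _|_]; first exact: h1.
by move: h2; rewrite in_itv/= ler_norml.
Qed.
End lebesgue_rV_box.

Section cutoff_weights.
Context {R : realType} {N : nat}.
Local Notation mu := (@lebesgue_rV R N).

Lemma L2_bounded_box (g : 'rV[R]_N -> R) (C M : R) : measurable_fun setT g -> 0 <= M ->
  (forall x, `|g x| <= C) -> (forall x, g x != 0 -> box M x) -> g \in L2.
Proof.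
move=> mg M0 gC gM; rewrite inE; apply/andP; split; rewrite inE//=.
rewrite /finite_norm unlock poweR_lty//.
apply: (@le_lt_trans _ _ (\int[mu]_(x in box M) (cst (C `^ 2)%:E x))%E).
  rewrite [leRHS]integral_mkcond; apply: ge0_le_integral => //.
  - by move=> x _; exact: poweR_ge0.
  - apply/measurable_EFinP.
    apply: (@measurableT_comp _ _ _ _ _ _ (fun x : R => x `^ 2)) => //.
    exact: measurableT_comp.
  - by apply: (measurable_restrictT _ (measurable_box _)).1 => //; exact: measurable_cst.
  - move=> x _; rewrite patchE; case: ifPn => [_|].
      by rewrite lee_fin ge0_ler_powR// nnegrE// (le_trans _ (gC x)).
    rewrite notin_setE => xM; have [gx0|/gM//] := eqVneq (g x) 0.
    by rewrite /= gx0 normr0 powR0.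
rewrite integral_cst; last exact: measurable_box.
by rewrite [X in (_ * X)%E]lebesgue_box// -EFinM ltry.
Qed.

Context (r : R) (F : nat -> R -> R) (C : R) (r0 : 0 < r) (cF : cutoff r F C).
Context (k : R) (k0 : 0 < k).

Lemma cutoff_measurable n : measurable_fun setT (F n).
Proof.
apply: continuous_measurable_fun => s.
apply: differentiable_continuous; apply/derivable1_diffP.
by have [] := cutoff_derive cF n s.
Qed.

(** The derivatives vanish up to the boundary because they are bounded by a
    power of the cutoff. *)
Lemma cutoff_outside n s : (n <= 2)%N -> 2 <= `|s| -> F n s = 0.
Proof.
case: n => [_|n n2 s2]; first exact: (cutoff_eq0 cF).
have := @cutoff_bound _ _ _ _ cF n.+1 s n2.
rewrite (cutoff_eq0 cF)// powR0 ?gt_eqF// mulr0 normr_le0 => /eqP//.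
Qed.

Lemma cutoff_le n s : (n <= 2)%N -> `|F n s| <= 1 + C.
Proof.
have C0 := cutoff_const_gt0 cF.
case: n => [_|n n2]; have /andP[F0 F1] := cutoff_01 cF s.
  by rewrite ger0_norm//; lra.
apply: (le_trans (@cutoff_bound _ _ _ _ cF n.+1 s n2)).
have : F 0 s `^ r <= 1.
  have -> : 1 = 1 `^ r :> R by rewrite powR1.
  by apply: ge0_ler_powR; rewrite ?nnegrE// ltW.
have := powR_ge0 (F 0 s) r; nra.
Qed.

Lemma radial_measurable n : measurable_fun setT (@radial R N F k n).
Proof.
apply: (measurableT_comp (cutoff_measurable n)).
by apply: measurable_funM => //; exact: measurable_sqnorm.
Qed.

Lemma radial_support n x : (n <= 2)%N -> @radial R N F k n x != 0 -> k * sqnorm x < 2.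
Proof.
move=> n2; apply: contraNT; rewrite -leNgt => h; apply/eqP.
by apply: cutoff_outside => //; exact: le_trans (ler_norm _).
Qed.

Lemma sqnorm_box x : k * sqnorm x < 2 -> @box R N (2 / k + 1) x.
Proof. by move=> h i; exact: coord_le_of_sqnorm. Qed.

Lemma L2_weight (h : 'rV[R]_N -> R) (n : nat) (D : R) : (n <= 2)%N -> measurable_fun setT h ->
  (forall x, k * sqnorm x < 2 -> `|h x| <= D) -> 0 <= D ->
  (fun x => h x * @radial R N F k n x) \in L2.
Proof.
move=> n2 mh hD D0; apply: (@L2_bounded_box _ (D * (1 + C)) (2 / k + 1)).
- by apply: measurable_funM => //; exact: radial_measurable.
- by rewrite addr_ge0// divr_ge0// ltW.
- move=> x; have [->|/(radial_support n2) h1] := eqVneq (@radial R N F k n x) 0.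
    by rewrite mulr0 normr0 mulr_ge0// addr_ge0// ltW// (cutoff_const_gt0 cF).
  by rewrite normrM ler_pM// ?hD// cutoff_le.
- move=> x; rewrite mulf_eq0 negb_or => /andP[_ /(radial_support n2)].
  exact: sqnorm_box.
Qed.

Lemma L2_radial : @radial R N F k 0 \in L2.
Proof.
have -> : @radial R N F k 0 = (fun x => cst 1 x * radial F k 0 x).
  by apply/funext => x; rewrite /= mul1r.
by apply: (@L2_weight _ _ 1) => // x _; rewrite normr1.
Qed.

Lemma L2_laplace_radial : @laplace_radial R N F k \in L2.
Proof.
have -> : @laplace_radial R N F k = (fun x => (4 * k ^+ 2 * sqnorm x) * radial F k 2 x) -
   (fun x => (- (2 * k * N%:R)) * radial F k 1 x).
  by apply/funext => x; rewrite /laplace_radial !fctE; ring.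
apply: L2_sub.
  apply: (@L2_weight _ _ (8 * k)) => //.
  - by apply: measurable_funM => //; exact: measurable_sqnorm.
  - move=> x h; have s0 := sqnorm_ge0 x; have k2 : 0 <= k ^+ 2 by exact: sqr_ge0.
    rewrite ger0_norm; last by rewrite mulr_ge0// mulr_ge0.
    rewrite (_ : 4 * k ^+ 2 * sqnorm x = 4 * k * (k * sqnorm x)); last by ring.
    by rewrite (_ : 8 * k = 4 * k * 2) ?ler_wpM2l ?mulr_ge0 ?(ltW k0) ?(ltW h)//; ring.
  - by rewrite mulr_ge0// ltW.
by apply: (@L2_weight _ _ `|- (2 * k * N%:R)|) => //; exact: measurable_cst.
Qed.

Lemma jbracketE (x : 'rV[R]_N) (a : R) : jbracket x `^ a = (1 + sqnorm x) `^ (a / 2).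
Proof.
rewrite /jbracket enormE -powR12_sqrt; last by rewrite addr_ge0// sqnorm_ge0.
by rewrite -powRrM mulrC.
Qed.

Lemma L2_damped_radial (a0 a : R) : 0 <= a -> (fun x => a0 * jbracket x `^ a * @radial R N F k 0 x) \in L2.
Proof.
move=> a_ge0; apply: (@L2_weight _ _ (`|a0| * (1 + 2 / k) `^ (a / 2))) => //.
- apply: measurable_funM => //; under eq_fun do rewrite jbracketE.
  apply: (measurableT_comp (measurable_powR _)).
  by apply: measurable_funD => //; exact: measurable_sqnorm.
- move=> x h; rewrite normrM ler_wpM2l// ger0_norm ?powR_ge0// jbracketE.
  have s0 := sqnorm_ge0 x.
  rewrite ge0_ler_powR ?nnegrE ?divr_ge0// ?addr_ge0// ?divr_ge0// ?(ltW k0)//.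
  by rewrite lerD2l ler_pdivlMr// mulrC ltW.
- by rewrite mulr_ge0// powR_ge0.
Qed.
End cutoff_weights.

(** * Integrals over a time interval *)
Section within_itv.
Context {R : realType}.
Local Notation leb := (@lebesgue_measure R).
Implicit Types (f g : R -> R) (b : R).

Lemma within_continuousD b f g : {within `[0, b], continuous f} ->
  {within `[0, b], continuous g} -> {within `[0, b], continuous (fun t => f t + g t)}.
Proof. by move=> cf cg x; exact: (cvgD (cf x) (cg x)). Qed.

Lemma within_continuousB b f g : {within `[0, b], continuous f} ->
  {within `[0, b], continuous g} -> {within `[0, b], continuous (fun t => f t - g t)}.
Proof. by move=> cf cg x; exact: (cvgB (cf x) (cg x)). Qed.

Lemma within_continuousM b f g : {within `[0, b], continuous f} ->
  {within `[0, b], continuous g} -> {within `[0, b], continuous (fun t => f t * g t)}.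
Proof. by move=> cf cg x; exact: (cvgM (cf x) (cg x)). Qed.

Lemma within_continuous_derive b f f' : (forall s : R, is_derive s 1 f (f' s)) ->
  {within `[0, b], continuous f}.
Proof.
move=> df; apply: continuous_subspaceT => s.
apply: differentiable_continuous; apply/derivable1_diffP.
by have [] := df s.
Qed.

Lemma within_integrable b f : {within `[0, b], continuous f} ->
  leb.-integrable `]0, b[ (EFin \o f).
Proof.
move=> cf; apply: (@integrableS _ _ _ leb `[0, b]%classic) => //.
  exact: subset_itv_oo_cc.
apply: continuous_compact_integrable => //; exact: segment_compact.
Qed.

Lemma within_FTC b f f' : 0 < b -> {within `[0, b], continuous f} ->
  {within `[0, b], continuous f'} ->
  (forall t : R, 0 < t < b -> is_derive t 1 f (f' t)) ->
  \int[leb]_(t in `]0, b[) f' t = f b - f 0.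
Proof.
move=> b0 cf cf' df.
rewrite -[RHS]/(fine ((f b)%:E - (f 0)%:E)%E) -(@continuous_FTC2 _ f' f)//.
- have h := within_integrable cf'.
  have h2 : leb.-integrable `[0, b[ (EFin \o f').
    apply: (@integrableS _ _ _ leb `[0, b]%classic) => //.
      by apply: subset_itvl; rewrite bnd_simp.
    apply: continuous_compact_integrable => //; exact: segment_compact.
  rewrite -/(Rintegral _ _ _) -/(Rintegral _ _ _).
  by rewrite (Rintegral_itv_obnd_cbnd (b := BLeft b))// Rintegral_itv_bndo_bndc.
- have [_ cl cr] := (continuous_within_itvP f b0).1 cf.
  split => // t; rewrite in_itv/= => tb.
  by have [] := df _ tb.
- move=> t; rewrite in_itv/= => tb.
  by rewrite derive1E (@derive_val _ _ _ _ _ _ _ (df _ tb)).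
Qed.
End within_itv.

(** * Recovering the initial data of a weak equation *)

(** A function of time that switches on between 1 and 2. *)
Record onset {R : realType} (th : nat -> R -> R) (C : R) : Prop := Onset {
  onset_const_ge0 : 0 <= C;
  onset_derive : forall n (s : R), is_derive s 1 (th n) (th n.+1 s);
  onset_01 : forall s : R, 0 <= th 0 s <= 1;
  onset_eq0 : forall s : R, s <= 1 -> th 0 s = 0;
  onset_eq1 : forall s : R, 2 <= s -> th 0 s = 1;
  onset_bound : forall s : R, `|th 1 s| <= C;
  onset_flat : forall s : R, 2 < s -> th 1 s = 0;
  onset_flat0 : forall s : R, s < 1 -> th 1 s = 0 }.

Lemma smooth_onset {R : realType} : exists (th : nat -> R -> R) (C : R), onset th C.
Proof.
pose f (s : R) := smooth_step (s + (-1)).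
have ef : elementary f.
  apply: elementary_step; apply: elementaryD; first exact: elementary_idfun.
  exact: elementary_cst.
pose th k := iter k (fun g : R -> R => 'D_(1 : R) g) f.
have e1 : elementary (th 1) by exact: elementary_derive.
have le02 : 0 <= 2 :> R by [].
have [C C0 HC] := elementary_bounded le02 e1.
have hi (s : R) : 2 < s -> th 1 s = 0.
  move=> s2; apply: (@derive_near_cst _ _ 1); near=> y.
  rewrite /f smooth_step_eq1//.
  have : 2 < y by near: y; exact: lt_nbhsr.
  lra.
have lo (s : R) : s < 1 -> th 1 s = 0.
  move=> s2; apply: (@derive_near_cst _ _ 0); near=> y.
  rewrite /f smooth_step_eq0//.
  have : y < 1 by near: y; exact: lt_nbhsl.
  lra.
exists th, C; split => //.
- exact: ltW.
- exact: elementary_derives.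
- by move=> s; rewrite smooth_step_ge0 smooth_step_le1.
- by move=> s s1; rewrite /th/= /f smooth_step_eq0//; lra.
- by move=> s s1; rewrite /th/= /f smooth_step_eq1//; lra.
- move=> s; case: (ltP s 1) => [/lo ->|s0]; first by rewrite normr0 ltW.
  case: (ltP 2 s) => [/hi ->|s2]; first by rewrite normr0 ltW.
  by apply: HC; rewrite (le_trans _ s0).
Unshelve. all: by end_near. Qed.

(** The [n]-th derivative of [t |-> F 0 (t / d)]. *)
Definition dilate {R : realType} (F : nat -> R -> R) (d : R) n (t : R) :=
  d^-1 ^+ n * F n (d^-1 * t).

Lemma is_derive_dilate {R : realType} (F : nat -> R -> R) :
  (forall n (s : R), is_derive s 1 (F n) (F n.+1 s)) ->
  forall (d : R) n (t : R), is_derive t 1 (dilate F d n) (dilate F d n.+1 t).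
Proof.
move=> dF d n t.
have h1 : is_derive t 1 (fun t : R => d^-1 * t) d^-1.
  by apply: is_derive_eq; rewrite /GRing.scale/= mulr1.
have h2 := @is_derive1_comp _ (F n) (fun t : R => d^-1 * t) t _ _ (dF n _) h1.
apply: (is_derive_eq (is_deriveZ (d^-1 ^+ n) h2)).
by rewrite /dilate exprSr /GRing.scale/=; ring.
Qed.

Section initial_layer.
Context {R : realType} (th : nat -> R -> R) (C : R) (oth : onset th C).
Local Notation leb := (@lebesgue_measure R).

(** The derivative of the dilated onset is an approximate identity at 0. *)
Lemma initial_layer_cvg (b : R) (A : R -> R) : 0 < b ->
  {within `[0, b], continuous A} ->
  \int[leb]_(t in `]0, b[) (dilate th d 1 t * A t) @[d --> 0^'+] --> A 0.
Proof.
move=> b0 cA; apply/cvgrPdist_le => e e0.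
have C1 : 0 < 2 * C + 1 by have := onset_const_ge0 oth; lra.
have [_ A0 _] := (continuous_within_itvP A b0).1 cA.
have : \forall d \near 0^'+, `|A 0 - A d| <= e / (2 * C + 1).
  by move/cvgrPdist_le : A0; apply; rewrite divr_gt0.
rewrite near_withinE => -[/= del del0 Hdel].
near=> d.
have d0 : 0 < d by [].
have d1 : d < del / 2 by near: d; apply: nbhs_right_lt; rewrite divr_gt0.
have d2 : d < b / 2 by near: d; apply: nbhs_right_lt; rewrite divr_gt0.
have cth n : {within `[0, b], continuous (dilate th d n)}.
  by apply: within_continuous_derive => s; exact: is_derive_dilate (onset_derive oth) _ _ _.
have I1 : \int[leb]_(t in `]0, b[) dilate th d 1 t = 1.
  rewrite (within_FTC b0 (cth 0) (cth 1) (fun t _ => is_derive_dilate (onset_derive oth) d 0 t)).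
  rewrite /dilate !expr0 !mul1r mulr0.
  have -> : th 0 0 = 0 by apply: (onset_eq0 oth).
  have -> : th 0 (d^-1 * b) = 1.
    by apply: (onset_eq1 oth); rewrite mulrC ler_pdivlMr//; lra.
  by rewrite subr0.
have cAth : {within `[0, b], continuous (fun t => dilate th d 1 t * A t)}.
  exact: within_continuousM.
have cA0 : {within `[0, b], continuous (fun t => dilate th d 1 t * A 0)}.
  apply: within_continuousM => //.
  apply: continuous_subspaceT; exact: cst_continuous.
rewrite -[X in `|X - _|]mul1r -I1 -RintegralZr//; last exact: within_integrable.
rewrite -RintegralB//; [|exact: within_integrable..].
have ci : leb.-integrable `]0, b[ (EFin \o (fun t => dilate th d 1 t * A 0 - dilate th d 1 t * A t)).
  by apply: within_integrable; exact: within_continuousB.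
apply: (le_trans (le_normr_Rintegral _ ci)) => //.
pose B := `]0, 2 * d]%classic : set R.
pose k := C / d * (e / (2 * C + 1)).
have k0 : 0 <= k.
  by rewrite /k !mulr_ge0// ?invr_ge0 ?(ltW d0) ?(ltW e0) ?(ltW C1) ?(onset_const_ge0 oth).
have BD : B `&` `]0, b[ = B.
  apply/seteqP; split => t /=; first by case.
  move=> tB; split => //; move: tB; rewrite /B /= !in_itv/= => /andP[-> ht]/=; lra.
have iB : leb.-integrable `]0, b[ (EFin \o (\1_B : R -> R)).
  apply: (@integrableS _ _ _ leb setT) => //.
  exact: integrable_indic_itv.
have mB : measurable B by exact: measurable_itv.
apply: (@le_trans _ _ (\int[leb]_(t in `]0, b[) (k * \1_B t))).
  apply: le_Rintegral => //.
  - exact: (integrable_norm ci).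
  - have -> : EFin \o (fun t => k * \1_B t) = (fun t => k%:E * (EFin \o (\1_B : R -> R)) t)%E by [].
    exact: integrableZl.
  - move=> t /=; rewrite in_itv/= => /andP[t0 tb].
    rewrite -mulrBr normrM indicE; case: (leP t (2 * d)) => td.
      rewrite mem_set/=; last by rewrite /B/= in_itv/= t0.
      rewrite mulr1 /k ler_pM//.
        rewrite /dilate expr1 normrM ger0_norm ?invr_ge0 ?(ltW d0)// mulrC.
        by rewrite ler_wpM2r ?invr_ge0 ?(ltW d0)// (onset_bound oth).
      by apply: Hdel => //=; rewrite sub0r normrN gtr0_norm//; lra.
    have -> : dilate th d 1 t = 0.
      rewrite /dilate (onset_flat oth) ?mulr0//.
      by rewrite mulrC ltr_pdivlMr.
    by rewrite normr0 mul0r mulr_ge0.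
have -> : \int[leb]_(t in `]0, b[) (k * \1_B t) = k * (2 * d).
  rewrite RintegralZl//; congr (_ * _).
  have lB : leb B = (2 * d)%:E.
    by rewrite /B lebesgue_measure_itv/= lte_fin mulr_gt0//= oppr0 adde0.
  by rewrite /Rintegral integral_indic// BD [X in fine X]lB.
rewrite /k (_ : C / d * (e / (2 * C + 1)) * (2 * d) = e * (2 * C) / (2 * C + 1)).
  by rewrite ler_pdivrMr// ler_wpM2l ?(ltW e0)// lerDl.
by field; rewrite !gt_eqF.
Unshelve. all: by end_near. Qed.
End initial_layer.

Section weak_ode.
Context {R : realType} (th : nat -> R -> R) (C : R) (oth : onset th C).
Local Notation leb := (@lebesgue_measure R).

(** This is the equation [F'' - H + a K' = G], tested against the product of
    [h] with the onset at time [d], where [eta] stands for the product [a h].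
    One integration by parts removes the second derivative of the onset, and as
    [d] tends to 0 its first derivative concentrates at [t = 0].  Since
    nothing is known about the integrability of [G], the right-hand side passes
    to the limit by Fatou's lemma in one direction and by monotonicity in the
    other. *)
Lemma weak_ode_initial_data (b : R) (F F' H K : R -> R) (G : R -> \bar R)
    (h : nat -> R -> R) (eta eta' : R -> R) :
  0 < b ->
  {within `[0, b], continuous F} -> {within `[0, b], continuous F'} ->
  {within `[0, b], continuous H} -> {within `[0, b], continuous K} ->
  (forall t : R, 0 < t < b -> is_derive t 1 F (F' t)) ->
  (forall n (t : R), is_derive t 1 (h n) (h n.+1 t)) ->
  (forall t : R, is_derive t 1 eta (eta' t)) ->
  {within `[0, b], continuous eta'} ->
  (forall t, 0 < t < b -> 0 <= h 0 t) -> h 0 b = 0 ->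
  measurable_fun `]0, b[ G -> (forall t, 0 < t < b -> (0 <= G t)%E) ->
  (forall d : R, 0 < d ->
    (\int[leb]_(t in `]0%R, b[)
      ((dilate th d 2 t * h 0 t + 2 * dilate th d 1 t * h 1 t +
        dilate th d 0 t * h 2 t) * F t - (dilate th d 0 t * h 0 t) * H t
       - (dilate th d 1 t * eta t + dilate th d 0 t * eta' t) * K t)%R%:E =
    \int[leb]_(t in `]0%R, b[) ((dilate th d 0 t * h 0 t)%R%:E * G t))%E) ->
  (\int[leb]_(t in `]0%R, b[) ((h 0 t)%:E * G t))%E =
  (\int[leb]_(t in `]0, b[) (h 2 t * F t - h 0 t * H t - eta' t * K t)
    - (h 0 0 * F' 0 - h 1 0 * F 0 + eta 0 * K 0))%:E.
Proof.
move=> b0 cF cF' cH cK dF dh de ce' h0 hb mG G0 weak.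
have ch n : {within `[0, b], continuous (h n)}.
  exact: within_continuous_derive (dh n).
have ce : {within `[0, b], continuous eta} by exact: within_continuous_derive de.
have cth d n : {within `[0, b], continuous (dilate th d n)}.
  exact: within_continuous_derive (is_derive_dilate (onset_derive oth) d n).
pose M t := h 2 t * F t - h 0 t * H t - eta' t * K t.
pose A t := h 1 t * F t - h 0 t * F' t - eta t * K t.
have cM : {within `[0, b], continuous M}.
  exact (within_continuousB (within_continuousB (within_continuousM (ch 2) cF)
    (within_continuousM (ch 0) cH)) (within_continuousM ce' cK)).
have cA : {within `[0, b], continuous A}.
  exact (within_continuousB (within_continuousB (within_continuousM (ch 1) cF)
    (within_continuousM (ch 0) cF')) (within_continuousM ce cK)).
(* The derivative of P collects all the terms in the second derivative of the
   onset, and its integral is zero. *)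
pose P d t := dilate th d 1 t * h 0 t * F t.
pose P' d t := (dilate th d 2 t * h 0 t + dilate th d 1 t * h 1 t) * F t + dilate th d 1 t * h 0 t * F' t.
have cP d : {within `[0, b], continuous (P d)} by exact (within_continuousM (within_continuousM (cth d 1) (ch 0)) cF).
have cP' d : {within `[0, b], continuous (P' d)}.
  exact (within_continuousD (within_continuousM (within_continuousD
    (within_continuousM (cth d 2) (ch 0)) (within_continuousM (cth d 1) (ch 1))) cF)
    (within_continuousM (within_continuousM (cth d 1) (ch 0)) cF')).
have dP d t : 0 < t < b -> is_derive t 1 (P d) (P' d t).
  move=> tb.
  apply: (is_derive_eq (is_deriveM (is_deriveM (is_derive_dilate (onset_derive oth) d 1 t) (dh 0 t)) (dF t tb))).
  rewrite /P' /GRing.scale/=.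
  change (dilate th d 1 t * h 0 t * F' t + F t * (dilate th d 1 t * h 1 t + h 0 t * dilate th d 2 t) = (dilate th d 2 t * h 0 t + dilate th d 1 t * h 1 t) * F t + dilate th d 1 t * h 0 t * F' t).
  ring.
have IP d : 0 < d -> \int[leb]_(t in `]0, b[) P' d t = 0.
  move=> d0; rewrite (within_FTC b0 (cP d) (cP' d) (dP d)).
  rewrite /P hb /dilate expr1 mulr0 mul0r mulr0 (onset_flat0 oth)//.
  by rewrite mulr0 !mul0r subr0.
pose L := \int[leb]_(t in `]0, b[) M t + A 0.
have Aint (d : R) : {within `[0, b], continuous (fun t => dilate th d 1 t * A t)}.
  exact: within_continuousM.
have Mint (d : R) : {within `[0, b], continuous (fun t => dilate th d 0 t * M t)}.
  exact: within_continuousM.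
pose J d := \int[leb]_(t in `]0, b[) (dilate th d 0 t * M t) + \int[leb]_(t in `]0, b[) (dilate th d 1 t * A t).
have weakJ d : 0 < d -> (\int[leb]_(t in `]0%R, b[) ((dilate th d 0 t * h 0 t)%R%:E * G t) = (J d)%:E)%E.
  move=> d0; rewrite -weak//.
  have -> : J d = \int[leb]_(t in `]0, b[) (dilate th d 0 t * M t + dilate th d 1 t * A t + P' d t).
    rewrite RintegralD//; [|apply: within_integrable; exact: within_continuousD|exact: within_integrable].
    by rewrite IP// addr0 RintegralD//; exact: within_integrable.
  rewrite /Rintegral fineK.
    by apply: eq_integral => t _; congr EFin; rewrite /M /A /P'; ring.
  apply: integrable_fin_num => //; apply: within_integrable.
  by apply: within_continuousD => //; exact: within_continuousD.
pose u n : R := n.+1%:R^-1.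
have u0 n : 0 < u n by rewrite invr_gt0.
have uc : u n @[n --> \oo] --> (0 : R) by exact: cvg_harmonic.
have thev t : 0 < t -> \forall n \near \oo, dilate th (u n) 0 t = 1.
  move=> t0; near=> n.
  rewrite /dilate expr0 mul1r (onset_eq1 oth)// mulrC ler_pdivlMr//.
  have : u n < t / 2 by near: n; apply: (cvgr_lt _ uc); rewrite divr_gt0.
  lra.
have thlim t : 0 < t -> dilate th (u n) 0 t @[n --> \oo] --> (1 : R).
  by move=> t0; apply: cvg_near_cst; exact: thev.
have th01 d t : 0 <= dilate th d 0 t <= 1 by rewrite /dilate expr0 mul1r (onset_01 oth).
have Jlim : J (u n) @[n --> \oo] --> L.
  apply: cvgD; last first.
    have := initial_layer_cvg oth b0 cA.
    by move/cvg_at_rightP => /(_ u); apply.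
  have iM := within_integrable cM.
  have DC := @dominated_convergence _ _ _ leb `]0, b[%classic (measurable_itv _)
     (fun n t => (dilate th (u n) 0 t * M t)%:E) (EFin \o M) (abse \o (EFin \o M))
     (fun n => measurable_int _ (within_integrable (Mint (u n)))) (measurable_int _ iM).
  have [||//|_ _ Dc] := DC.
  - apply: aeW => t /=; rewrite in_itv/= => /andP[t0 _].
    apply: cvg_EFin; first by apply: nearW.
    by rewrite -[X in _ --> X]mul1r; apply: cvgMl; exact: thlim.
  - exact: integrable_abse.
  - apply: aeW => t n _; rewrite /= lee_fin normrM ler_piMl//.
    by have /andP[h1 h2] := th01 (u n) t; rewrite ger0_norm.
  by apply: fine_cvg; rewrite fineK; last exact: integrable_fin_num.
have hG0 t : 0 < t < b -> (0 <= (h 0 t)%:E * G t)%E.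
  by move=> tb; rewrite mule_ge0// ?G0// lee_fin h0.
have mhG : measurable_fun `]0, b[ (fun t => (h 0 t)%:E * G t)%E.
  by apply: emeasurable_funM => //; apply: (measurable_int leb); exact: within_integrable.
have mthG n : measurable_fun `]0, b[ (fun t => (dilate th (u n) 0 t * h 0 t)%R%:E * G t)%E.
  apply: emeasurable_funM => //; apply: (measurable_int leb); apply: within_integrable.
  exact: within_continuousM.
have thG0 n t : 0 < t < b -> (0 <= (dilate th (u n) 0 t * h 0 t)%R%:E * G t)%E.
  move=> tb; rewrite mule_ge0// ?G0// lee_fin mulr_ge0 ?h0//.
  by have /andP[] := th01 (u n) t.
have JlimE : (J (u n))%:E @[n --> \oo] --> L%:E.
  by apply: cvg_EFin => //; exact: nearW.
suff : (\int[leb]_(t in `]0%R, b[) ((h 0 t)%:E * G t) = L%:E)%E.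
  by move=> ->; rewrite /L /A; congr EFin; ring.
apply/eqP; rewrite eq_le; apply/andP; split.
  have := @fatou _ _ _ leb `]0, b[%classic (measurable_itv _)
     (fun n t => (dilate th (u n) 0 t * h 0 t)%R%:E * G t)%E mthG.
  have -> : limn_einf (fun n => (\int[leb]_(t in `]0%R, b[) ((dilate th (u n) 0 t * h 0 t)%R%:E * G t))%E) = L%:E.
    under eq_fun do rewrite weakJ//.
    by rewrite (cvg_limn_einf_sup JlimE).
  move=> fat; apply: le_trans (fat _); last first.
    by move=> n t /=; rewrite in_itv/=; exact: thG0.
  rewrite le_eqVlt; apply/orP; left; apply/eqP; apply: eq_integral => t.
  rewrite inE/= in_itv/= => /andP[t0 _].
  apply/esym; apply: (cvg_limn_einf_sup _).1; apply: cvg_near_cst; near=> n.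
  by rewrite (near (thev t t0) n)// mul1r.
rewrite -(cvg_lim _ JlimE)//; apply: lime_le; first by apply/cvg_ex; exists L%:E.
apply: nearW => n; rewrite -weakJ//; apply: ge0_le_integral => //.
- by move=> t /=; rewrite in_itv/=; exact: thG0.
- exact: mthG.
- move=> t /=; rewrite in_itv/= => tb; rewrite EFinM -muleA.
  rewrite -[leRHS]mul1e lee_wpmul2r// ?hG0// lee_fin.
  by have /andP[] := th01 (u n) t.
Unshelve. all: by end_near. Qed.
End weak_ode.

(** * Solutions paired with a fixed function *)
Section solution_pairing.
Context {R : realType} {N : nat}.
Local Notation mu := (@lebesgue_rV R N).

Lemma L2norm_le_H1norm (f : 'rV[R]_N -> R) : (L2norm f <= H1norm f)%E.
Proof.
have L0 : (0 <= L2norm f)%E by exact: Lnorm_ge0.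
have -> : L2norm f = ((L2norm f `^ 2) `^ 2^-1)%E.
  by rewrite -poweRrM mulfV// poweRe1.
have S0 : (0 <= \sum_(i < N) L2norm (weak_partial i f) `^ 2)%E.
  by apply: sume_ge0 => i _; exact: poweR_ge0.
apply: gt0_ler_poweR; rewrite ?invr_ge0//.
- by rewrite in_itv/= leey poweR_ge0.
- by rewrite in_itv/= leey adde_ge0// poweR_ge0.
- by rewrite leeDl.
Qed.

Context (T : \bar R) (b : R).
Hypothesis bT : (b%:E < T)%E.

Lemma itv_time t : t \in `[0, b] -> time T t.
Proof.
rewrite in_itv/= => /andP[t0 tb]; split => //.
by apply: le_lt_trans bT; rewrite lee_fin.
Qed.

Lemma L2_continuous_pairing (u : R -> 'rV[R]_N -> R) (g : 'rV[R]_N -> R) :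
  continuous_L2 T u -> g \in L2 ->
  {within `[0, b], continuous (fun t => \int[mu]_x (u t x * g x))}.
Proof.
move=> cu g2; apply/subspace_continuousP => t tb.
have [ut2 utlim] := cu t (itv_time tb).
apply: (@L2_pairing_cvg _ _ _ mu _ _ _ u (u t) g) => //.
- by apply: filterS (withinT _ _) => s sb; have [] := cu s (itv_time sb).
- apply: cvg_trans utlim; apply: cvg_app.
  move=> A wA; change (nbhs (t : R) [set s | time T s -> A s]) in wA.
  change (nbhs (t : R) [set s | `[0, b]%classic s -> A s]).
  by apply: filterS wA => s As sb; apply: As; exact: itv_time.
Qed.

Lemma continuous_H1_L2 (u : R -> 'rV[R]_N -> R) : continuous_H1 T u -> continuous_L2 T u.
Proof.
move=> cu t tT; have [[ut2 _] utlim] := cu t tT; split => //.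
apply: (squeeze_cvge _ _ utlim); last exact: cvg_cst.
by apply: nearW => s; rewrite L2norm_le_H1norm Lnorm_ge0.
Qed.

Lemma cvg_shift_dnbhs (t : R) : (fun h : R => h + t) h @[h --> 0^'] --> t^'.
Proof.
move=> A [e /= e0 HA]; exists e => //= h he h0; apply: HA.
  by move: he; rewrite /ball_/= sub0r normrN opprD addrCA subrr addr0 normrN.
by rewrite -subr_eq0 addrK.
Qed.

(** The time derivative exists in the norm of L^2, hence weakly. *)
Lemma L2_derivative_pairing (u v : R -> 'rV[R]_N -> R) (g : 'rV[R]_N -> R) (t : R) :
  continuous_L2 T u -> continuous_L2 T v -> derivative_L2 T u v -> g \in L2 ->
  0 < t < b ->
  is_derive t 1 (fun t => \int[mu]_x (u t x * g x)) (\int[mu]_x (v t x * g x)).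
Proof.
move=> cu cv duv g2 /andP[t0 tb].
have tT s : 0 < s < b -> time T s.
  by move=> /andP[s0 sb]; apply: itv_time; rewrite in_itv/= !ltW.
have tT0 : time T t by apply: tT; rewrite t0.
have [ut2 _] := cu t tT0; have [vt2 _] := cv t tT0.
have near_b : \forall s \near t^', time T s.
  apply: nbhs_dnbhs; near=> s; apply: tT; apply/andP; split; near: s.
    exact: lt_nbhsr.
  exact: lt_nbhsl.
pose U s x := (s - t)^-1 * (u s x - u t x).
have U2 s : time T s -> U s \in L2.
  move=> sT; have -> : U s = (s - t)^-1 *: (u s - u t) + 0.
    by apply/funext => x; rewrite addr0.
  have [us2 _] := cu s sT.
  apply: L2_linear; first exact: L2_sub.
  have -> : (0 : 'rV[R]_N -> R) = u t - u t by rewrite subrr.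
  exact: L2_sub.
have lim : \int[mu]_x (U s x * g x) @[s --> t^'] --> \int[mu]_x (v t x * g x).
  apply: (@L2_pairing_cvg _ _ _ mu _ _ _ U (v t) g) => //.
    by apply: filterS near_b => s; exact: U2.
  apply: cvg_trans (duv t tT0); apply: cvg_app.
  by move=> A; apply: filterS2 near_b => s sT; apply.
have lim2 : (fun h => h^-1 *: (((fun t => \int[mu]_x (u t x * g x)) \o shift t) (h *: 1) - \int[mu]_x (u t x * g x)))
    @ 0^' --> \int[mu]_x (v t x * g x).
  have := @cvg_comp _ _ _ (fun h : R => h + t) (fun s => \int[mu]_x (U s x * g x)) _ _ _
    (@cvg_shift_dnbhs t) lim.
  apply: cvg_trans; apply: near_eq_cvg.
  have : \forall h \near 0^', time T (h + t) by exact: (@cvg_shift_dnbhs t _ near_b).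
  apply: filterS => h hT /=.
  have [us2 _] := cu _ hT.
  have -> : h *: (1 : R) = h by rewrite [LHS]mulr1.
  rewrite -RintegralB//; [|exact: L2_mul_integrable..].
  rewrite -[RHS]RintegralZl//.
    apply: eq_Rintegral => x _; rewrite /U addrK -mulrBl mulrA//.
  have -> : EFin \o (fun x => u (h + t) x * g x - u t x * g x) =
      EFin \o (fun x => (u (h + t) - u t) x * g x).
    by apply/funext => x; rewrite /= -mulrBl.
  by apply: L2_mul_integrable => //; exact: L2_sub.
apply: DeriveDef; first by apply/cvg_ex; eexists; exact: lim2.
exact: cvg_lim lim2.
Unshelve. all: by end_near. Qed.
End solution_pairing.

(** * Measurability in time of the nonlinear term *)

(** Convexity of the power, in the form of Young's inequality between [a] and
    [b `^ (p - 1)]. *)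
Lemma powR_tangent {R : realType} (p a b : R) : 1 < p -> 0 <= a -> 0 <= b ->
  b `^ p - a `^ p <= p * b `^ (p - 1) * (b - a).
Proof.
move=> p1 a0 b0; have p0 : 0 < p by lra.
have pn0 : p != 0 by rewrite gt_eqF.
have p1n0 : p - 1 != 0 by rewrite gt_eqF//; lra.
have q0 : 0 < p / (p - 1) by rewrite divr_gt0//; lra.
have pq : p^-1 + (p / (p - 1))^-1 = 1 by rewrite invf_div; field.
have := @conjugate_powR R a (b `^ (p - 1)) p (p / (p - 1)) a0 (powR_ge0 _ _) p0 q0 pq.
rewrite -powRrM (_ : (p - 1) * (p / (p - 1)) = p); last by field.
rewrite invf_div => Y.
have : p * (a * b `^ (p - 1)) <= p * (a `^ p / p + b `^ p * ((p - 1) / p)) by rewrite ler_pM2l.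
rewrite (_ : p * (a `^ p / p + b `^ p * ((p - 1) / p)) = a `^ p + (p - 1) * b `^ p); last by field.
rewrite mulrBr -!mulrA [_ * b]mulrC (mulr_powRB1 b0 p0) [_ * a]mulrC; lra.
Qed.

(** The power [|y|^p] is not Lipschitz, so it need not map L^2-continuous
    curves to L^2-continuous curves.  Its truncations do, and they increase to it. *)
Definition capped_power {R : realType} (p M y : R) := Num.min `|y| M `^ p.

Section capped_power.
Context {R : realType} (p : R) (p1 : 1 < p).
Implicit Types y z M : R.

Let p0 : 0 <= p. Proof. exact: ltW (lt_trans ltr01 p1). Qed.
Let p10 : 0 <= p - 1. Proof. by rewrite subr_ge0 ltW. Qed.

Lemma capped_power_lipschitz M y z : 0 <= M ->
  `|capped_power p M y - capped_power p M z| <= p * M `^ (p - 1) * `|y - z|.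
Proof.
move=> M0.
wlog yz : y z / `|z| <= `|y| => [H|].
  case/orP: (le_total `|z| `|y|) => h; first exact: H.
  by rewrite distrC (distrC y); exact: H.
rewrite /capped_power; set a := Num.min `|z| M; set b := Num.min `|y| M.
have a0 : 0 <= a by rewrite le_min normr_ge0.
have b0 : 0 <= b by rewrite le_min normr_ge0.
have ab : a <= b by rewrite /a /b le_min !ge_min yz lexx orbT.
rewrite ger0_norm ?subr_ge0 ?ge0_ler_powR ?nnegrE//.
apply: (le_trans (powR_tangent p1 a0 b0)).
have bM : b `^ (p - 1) <= M `^ (p - 1).
  by apply: ge0_ler_powR; rewrite ?nnegrE// ge_min lexx orbT.
have ba : b - a <= `|y - z|.
  apply: (@le_trans _ _ (`|y| - `|z|)); last exact: lerB_dist.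
  rewrite /a /b; move: (normr_ge0 y) (normr_ge0 z) yz.
  rewrite !minEle; case: ifPn; case: ifPn; rewrite -?ltNge; lra.
by rewrite ler_pM ?subr_ge0 ?mulr_ge0 ?powR_ge0// ler_wpM2l.
Qed.

Lemma capped_power0 M : 0 <= M -> capped_power p M 0 = 0.
Proof. by move=> M0; rewrite /capped_power normr0 min_l// powR0// gt_eqF// (lt_trans ltr01 p1). Qed.

Lemma measurable_capped_power M : measurable_fun setT (capped_power p M).
Proof.
apply: (measurableT_comp (measurable_powR _)).
by apply: measurable_minr => //; exact: measurable_normr.
Qed.

Lemma capped_power_nondecreasing y : {homo (fun n : nat => capped_power p n%:R y) : m n / (m <= n)%N >-> m <= n}.
Proof.
move=> m n mn; rewrite /capped_power ge0_ler_powR ?nnegrE ?le_min ?normr_ge0 ?ler0n//=.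
by rewrite !ge_min lexx ler_nat mn orbT.
Qed.

Lemma capped_power_eventually y : \forall n \near \oo, capped_power p n%:R y = `|y| `^ p.
Proof.
near=> n; rewrite /capped_power min_l//.
by apply: ltW; near: n; exact: nbhs_infty_gtr.
Unshelve. all: by end_near. Qed.
End capped_power.

Section L2_lipschitz.
Context {d} {T : measurableType d} {R : realType} (mu : {measure set T -> \bar R}).
Implicit Types f g : T -> R.

Lemma Lnorm2_le f g (L : R) : measurable_fun setT g -> f \in Lfun mu 2%:E -> 0 <= L ->
  (forall x, `|g x| <= L * `|f x|) ->
  (Lnorm mu 2%:E (EFin \o g) <= L%:E * Lnorm mu 2%:E (EFin \o f))%E.
Proof.
move=> mg f2 L0 gf.
have p1 : (1 <= 2%:E :> \bar R)%E by rewrite lee_fin ler1n.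
have := LnormZ (Lfun_Sub p1 f2) L; rewrite ger0_norm// => <-.
rewrite unlock /Lnorm; apply: gt0_ler_poweR; rewrite ?invr_ge0//.
- by rewrite in_itv/= leey integral_ge0// => x _; exact: poweR_ge0.
- by rewrite in_itv/= leey integral_ge0// => x _; exact: poweR_ge0.
apply: ge0_le_integral => //.
- by move=> x _; exact: poweR_ge0.
- apply/measurable_EFinP.
  apply: (@measurableT_comp _ _ _ _ _ _ (fun x : R => x `^ 2)) => //.
  exact: measurableT_comp.
- apply/measurable_EFinP.
  apply: (@measurableT_comp _ _ _ _ _ _ (fun x : R => x `^ 2)) => //.
  by apply: measurableT_comp => //; apply: measurable_funM.
- move=> x _; rewrite lee_fin ge0_ler_powR ?nnegrE//.
  by apply: (le_trans (gf x)); rewrite /= normrM (ger0_norm L0).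
Qed.

Lemma L2_lipschitz (phi : R -> R) f (L : R) : measurable_fun setT phi -> 0 <= L ->
  (forall y z, `|phi y - phi z| <= L * `|y - z|) -> phi 0 = 0 ->
  f \in Lfun mu 2%:E -> (phi \o f) \in Lfun mu 2%:E.
Proof.
move=> mphi L0 phiL phi0 f2.
have mg : measurable_fun setT (phi \o f) by apply: measurableT_comp => //; exact: L2_measurable f2.
rewrite inE; apply/andP; split; rewrite inE//= /finite_norm.
apply: (@le_lt_trans _ _ (L%:E * Lnorm mu 2%:E (EFin \o f))%E).
  by apply: Lnorm2_le => // x; have := phiL (f x) 0; rewrite phi0 !subr0.
by rewrite lte_mul_pinfty ?lee_fin// L2_norm_fin.
Qed.
End L2_lipschitz.

Section nonlinear_term.
Context {R : realType} {N : nat}.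
Local Notation mu := (@lebesgue_rV R N).
Local Notation leb := (@lebesgue_measure R).

Lemma continuous_L2_lipschitz (T : \bar R) (u : R -> 'rV[R]_N -> R) (phi : R -> R) (L : R) :
  measurable_fun setT phi -> 0 <= L ->
  (forall y z, `|phi y - phi z| <= L * `|y - z|) -> phi 0 = 0 ->
  continuous_L2 T u -> continuous_L2 T (fun t => phi \o u t).
Proof.
move=> mphi L0 phiL phi0 cu t tT; have [ut2 utlim] := cu t tT.
have phi2 f : f \in Lfun mu 2%:E -> (phi \o f) \in Lfun mu 2%:E by exact: L2_lipschitz phiL phi0.
split; first exact: phi2.
apply: (@squeeze_cvge _ _ _ _ (fun=> 0%E) _ (fun s => L%:E * L2norm (u s \- u t)%R)%E).
- apply: filterS (withinT _ _) => s sT; have [us2 _] := cu s sT.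
  have mphis := L2_measurable (L2_sub (phi2 _ us2) (phi2 _ ut2)).
  rewrite Lnorm_ge0/=; apply: (Lnorm2_le mphis (L2_sub us2 ut2) L0) => x.
  exact: phiL.
- exact: cvg_cst.
- by rewrite -(mule0 L%:E); apply: cvgeZl.
Qed.

Context (p : R) (p1 : 1 < p) (T : \bar R) (b : R) (bT : (b%:E < T)%E)
  (u : R -> 'rV[R]_N -> R) (cu : continuous_L2 T u)
  (g : 'rV[R]_N -> R) (g2 : g \in L2) (g0 : forall x, 0 <= g x).

Lemma measurable_power_integrand t : time T t ->
  measurable_fun setT (fun x => (`|u t x| `^ p * g x)%:E).
Proof.
move=> tT; have [ut2 _] := cu tT.
apply/measurable_EFinP; apply: measurable_funM; last exact: L2_measurable g2.
apply: (measurableT_comp (measurable_powR _)); apply: measurableT_comp => //.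
exact: L2_measurable ut2.
Qed.

(** Each truncation gives a continuous function of time, and the integral is
    their increasing limit. *)
Lemma measurable_power_integral :
  measurable_fun `]0, b[ (fun t => \int[mu]_x (`|u t x| `^ p * g x)%:E)%E.
Proof.
pose Gn (n : nat) t := \int[mu]_x (capped_power p n%:R (u t x) * g x).
have L0 n : 0 <= p * n%:R `^ (p - 1) by rewrite mulr_ge0 ?powR_ge0// (ltW (lt_trans ltr01 p1)).
have cn (n : nat) : continuous_L2 T (fun t => capped_power p n%:R \o u t).
  apply: (@continuous_L2_lipschitz _ _ _ (p * n%:R `^ (p - 1))) => //.
  - exact: measurable_capped_power.
  - by move=> y z; exact: capped_power_lipschitz.
  - exact: capped_power0.
apply: (@emeasurable_fun_cvg _ _ _ _ (fun n t => (Gn n t)%:E)).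
  move=> n; apply: (measurable_int leb); apply: within_integrable.
  exact: (L2_continuous_pairing bT (cn n) g2).
move=> t /=; rewrite in_itv/= => /andP[t0 tb].
have tT : time T t by apply: (itv_time bT); rewrite in_itv/= !ltW.
have GnE n : (Gn n t)%:E = (\int[mu]_x (capped_power p n%:R (u t x) * g x)%:E)%E.
  rewrite /Gn /Rintegral fineK//; apply: integrable_fin_num => //.
  by have [h _] := cn n t tT; exact: (L2_mul_integrable h g2).
under eq_fun do rewrite GnE.
have := @cvg_monotone_convergence _ _ _ mu setT measurableT (fun n x => (capped_power p n%:R (u t x) * g x)%:E).
have -> : (\int[mu]_x limn ((fun n x => (capped_power p n%:R (u t x) * g x)%:E)^~ x) = \int[mu]_x (`|u t x| `^ p * g x)%:E)%E.
  apply: eq_integral => x _; apply: cvg_lim => //; apply: cvg_near_cst.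
  by apply: filterS (capped_power_eventually p (u t x)) => n /= ->.
apply.
- by move=> n; have [h _] := cn n t tT; apply: (measurable_int mu); exact: (L2_mul_integrable h g2).
- by move=> n x _; rewrite lee_fin mulr_ge0// powR_ge0.
- by move=> x _ m n mn; rewrite lee_fin ler_wpM2r// capped_power_nondecreasing.
Qed.
End nonlinear_term.

(** * The identity satisfied by a solution *)
Section solution_identity.
Context {R : realType} {N : nat}.
Local Notation mu := (@lebesgue_rV R N).
Local Notation leb := (@lebesgue_measure R).

Lemma L2_pairing_linear (f g1 g2 g3 : 'rV[R]_N -> R) (a1 a2 a3 : R) :
  f \in L2 -> g1 \in L2 -> g2 \in L2 -> g3 \in L2 ->
  \int[mu]_x (f x * (a1 * g1 x - a2 * g2 x - a3 * g3 x)) =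
  a1 * \int[mu]_x (f x * g1 x) - a2 * \int[mu]_x (f x * g2 x)
    - a3 * \int[mu]_x (f x * g3 x).
Proof.
move=> f2 L1 L2' L3.
have I1 := L2_mul_integrable f2 L1.
have I2 := L2_mul_integrable f2 L2'.
have I3 := L2_mul_integrable f2 L3.
have Z (a : R) (g : 'rV[R]_N -> R) : mu.-integrable setT (EFin \o (fun x => f x * g x)) ->
    mu.-integrable setT (EFin \o (fun x => a * (f x * g x))).
  move=> Ig; have -> : EFin \o (fun x => a * (f x * g x)) =
    (fun x => a%:E * (EFin \o (fun x => f x * g x)%R) x)%E by [].
  exact: integrableZl.
have I12 : mu.-integrable setT (EFin \o (fun x => a1 * (f x * g1 x) - a2 * (f x * g2 x))).
  have -> : EFin \o (fun x => a1 * (f x * g1 x) - a2 * (f x * g2 x)) =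
    ((EFin \o (fun x => a1 * (f x * g1 x))%R) \- (EFin \o (fun x => a2 * (f x * g2 x))%R))%E by [].
  by apply: integrableB => //; exact: Z.
rewrite -!RintegralZl// -RintegralB//; [|exact: Z..].
rewrite -RintegralB//; last exact: Z.
by apply: eq_Rintegral => x _; ring.
Qed.

Context (p a0 alpha beta : R) (p1 : 1 < p) (alpha0 : alpha <= 0).
Context (T : \bar R) (u v : R -> 'rV[R]_N -> R).
Hypothesis cu : continuous_H1 T u.
Hypothesis cv : continuous_L2 T v.
Hypothesis duv : derivative_L2 T u v.
Hypothesis weq : weak_equation T (damping a0 alpha beta) p u.
Context (r C : R) (F : nat -> R -> R) (r0 : 0 < r) (cF : cutoff r F C).
Context (k b : R) (k0 : 0 < k) (b0 : 0 < b) (bT : (b%:E < T)%E).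
Context (h : nat -> R -> R) (eta eta' : R -> R).
Hypothesis dh : forall n (t : R), is_derive t 1 (h n) (h n.+1 t).
Hypothesis de : forall t : R, is_derive t 1 eta (eta' t).
Hypothesis ce' : {within `[0, b], continuous eta'}.
Hypothesis hb : forall n t, (n <= 2)%N -> b <= t -> h n t = 0.
Hypothesis eb : forall t, b <= t -> eta t = 0.
Hypothesis eb' : forall t, b <= t -> eta' t = 0.
Hypothesis h0 : forall t, 0 <= t -> 0 <= h 0 t.
Hypothesis he : forall t, -1 < t -> (1 + t) `^ (- beta) * h 0 t = eta t.

Let chi : 'rV[R]_N -> R := radial F k 0.
Let kap (x : 'rV[R]_N) := a0 * jbracket x `^ (- alpha) * chi x.

Let chi2 : chi \in L2. Proof. exact: (L2_radial r0 cF k0). Qed.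
Let lap2 : laplace_radial F k \in @L2 R N. Proof. exact: (L2_laplace_radial r0 cF k0). Qed.
Let kap2 : kap \in L2. Proof. by apply: (L2_damped_radial r0 cF k0); rewrite oppr_ge0. Qed.
Let chi_ge0 x : 0 <= chi x. Proof. by have /andP[] := cutoff_01 cF (k * sqnorm x). Qed.

Lemma integral_restrict (f : R -> \bar R) (D : set R) : `]0, b[ `<=` D ->
  (forall t, D t -> 0 < t) -> (forall t, b <= t -> f t = 0%E) ->
  (\int[leb]_(t in D) f t = \int[leb]_(t in `]0%R, b[) f t)%E.
Proof.
move=> bD D0 fb; rewrite integral_mkcond [RHS]integral_mkcond; apply: eq_integral => t _.
rewrite !patchE; case: ifPn => [tD|tD].
  case: ifPn => // tb; apply: fb; move: tb tD; rewrite notin_setE inE/= in_itv/= => tb /D0 t0.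
  by rewrite leNgt; apply/negP => tb'; apply: tb; rewrite t0.
case: ifPn => // tb; move: tb tD; rewrite notin_setE inE => /bD //.
Qed.

Lemma time_itv_subset : `]0, b[ `<=` [set t : R | 0 < t /\ (t%:E < T)%E].
Proof.
move=> t /=; rewrite in_itv/= => /andP[t0 tb]; split => //.
by apply: lt_trans bT; rewrite lte_fin.
Qed.

Let time_in t : 0 < t -> t < b -> time T t.
Proof. by move=> t0 tb; apply: (itv_time bT); rewrite in_itv/= !ltW. Qed.

(** The onset keeps the support of the test function away from [t = 0], as the
    weak equation requires. *)
Lemma tested_equation (th : nat -> R -> R) (D : R) : onset th D -> forall d : R, 0 < d ->
  (\int[leb]_(t in `]0%R, b[)
    ((dilate th d 2 t * h 0 t + 2 * dilate th d 1 t * h 1 t + dilate th d 0 t * h 2 t)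
        * \int[mu]_x (u t x * chi x)
     - (dilate th d 0 t * h 0 t) * \int[mu]_x (u t x * laplace_radial F k x)
     - (dilate th d 1 t * eta t + dilate th d 0 t * eta' t) * \int[mu]_x (u t x * kap x))%R%:E =
   \int[leb]_(t in `]0%R, b[) ((dilate th d 0 t * h 0 t)%R%:E * \int[mu]_x (`|u t x| `^ p * chi x)%:E))%E.
Proof.
move=> oth d d0.
have cuL := continuous_H1_L2 cu.
have dth n (t : R) := is_derive_dilate (onset_derive oth) d n t.
have ew : elementary (fun t : R => dilate th d 0 t * h 0 t).
  apply: elementaryM.
    by apply: (elementary_comp 0 dth); exact: elementary_idfun.
  by apply: (elementary_comp 0 dh); exact: elementary_idfun.
(* All the derivatives of the product are needed for smoothness, but only the
   first two appear in the equation, where Leibniz' rule makes them explicit. *)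
pose w n := iter n (fun g : R -> R => 'D_(1 : R) g) (fun t : R => dilate th d 0 t * h 0 t).
have dw n (t : R) : is_derive t 1 (w n) (w n.+1 t) by exact: (elementary_derives ew n).
have w1 : w 1 = (fun t => dilate th d 0 t * h 1 t + dilate th d 1 t * h 0 t).
  apply/funext => t; rewrite /w/=.
  apply: etrans (derive_valE (is_deriveM (dth 0 t) (dh 0 t))) _.
  by rewrite /GRing.scale/= [X in _ + X]mulrC.
have w2 : w 2 = (fun t => dilate th d 2 t * h 0 t + 2 * dilate th d 1 t * h 1 t + dilate th d 0 t * h 2 t).
  apply/funext => t; rewrite -[w 2]/('D_(1 : R) (w 1)) w1.
  apply: etrans (derive_valE (is_deriveD (is_deriveM (dth 0 t) (dh 1 t)) (is_deriveM (dth 1 t) (dh 0 t)))) _.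
  by rewrite /GRing.scale/=; ring.
have dee (t : R) : is_derive t 1 (fun t => dilate th d 0 t * eta t)
    (dilate th d 1 t * eta t + dilate th d 0 t * eta' t).
  apply: (is_derive_eq (is_deriveM (dth 0 t) (de t))).
  by rewrite /GRing.scale/= addrC [X in X + _]mulrC.
have tpsi : test_function (spacetime T) (@separated R N F k w).
  apply: (@test_function_separated _ _ F k w (cutoff_derive cF) dw T d b) => //.
  - move=> t; rewrite /w/= mulf_eq0 negb_or => /andP[tht ht].
    rewrite leNgt; apply/andP; split.
      apply/negP => td; move/eqP: tht; apply.
      rewrite /dilate expr0 mul1r (onset_eq0 oth)//.
      by rewrite mulrC ler_pdivrMr// mul1r ltW.
    rewrite leNgt; apply/negP => td; move/eqP: ht; apply.
    by apply: hb => //; exact: ltW.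
  - exact: cutoff_eq0 cF.
have wadj t x : 0 < t -> wave_adjoint (damping a0 alpha beta) (separated F k w) (t, x) =
    w 2 t * chi x - w 0 t * laplace_radial F k x
    - (dilate th d 1 t * eta t + dilate th d 0 t * eta' t) * kap x.
  move=> t0; apply: (@wave_adjoint_separated _ _ F k w (cutoff_derive cF) dw a0 alpha beta
    (fun t => dilate th d 0 t * eta t) _ t x) => //.
    by apply: lt_trans t0; rewrite ltrN10.
  by move=> s s1; rewrite mulrCA he.
have := weq tpsi.
rewrite (@integral_restrict _ [set t : R | 0 < t /\ (t%:E < T)%E]); first last.
- move=> t tb; apply: integral0_eq => x _; rewrite wadj ?(lt_le_trans b0)// w2.
  by rewrite /w/= !hb// eb// eb'// !(mulr0, mul0r, addr0, subr0).
- by move=> t [].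
- exact: time_itv_subset.
rewrite (@integral_restrict _ [set t : R | 0 < t /\ (t%:E < T)%E]); first last.
- move=> t tb; apply: integral0_eq => x _.
  by rewrite /separated /w/= hb// mulr0 mul0r mulr0.
- by move=> t [].
- exact: time_itv_subset.
rewrite (_ : (\int[leb]_(t in `]0%R, b[) \int[mu]_x (`|u t x| `^ p * separated F k w (t, x))%:E)%E =
  (\int[leb]_(t in `]0%R, b[) ((dilate th d 0 t * h 0 t)%R%:E * \int[mu]_x (`|u t x| `^ p * chi x)%:E))%E).
  move=> <-; apply: eq_integral => t; rewrite inE/= in_itv/= => /andP[t0 tb].
  have [ut2 _] := cuL t (time_in t0 tb).
  under eq_integral => x _ do rewrite wadj//.
  pose W x := w 2 t * chi x - w 0 t * laplace_radial F k x -
    (dilate th d 1 t * eta t + dilate th d 0 t * eta' t) * kap x.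
  transitivity ((\int[mu]_x (u t x * W x))%:E).
    by rewrite (L2_pairing_linear (w 2 t) (w 0 t) _ ut2 chi2 lap2 kap2) w2.
  rewrite /Rintegral fineK//.
  apply: integrable_fin_num => //; apply: L2_mul_integrable => //.
  have -> : W = w 2 t *: chi + (- w 0 t *: laplace_radial F k +
      (- (dilate th d 1 t * eta t + dilate th d 0 t * eta' t) *: kap + 0)).
    by apply/funext => x; rewrite /W !fctE addr0 /GRing.scale/= !mulNr addrA.
  do 3!apply: L2_linear => //.
  have -> : (0 : 'rV[R]_N -> R) = chi - chi by rewrite subrr.
  exact: L2_sub.
apply: eq_integral => t; rewrite inE/= in_itv/= => /andP[t0 tb].
rewrite -ge0_integralZl//.
- by apply: eq_integral => x _; rewrite -EFinM /separated /w/=; congr EFin; rewrite -/(chi x); ring.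
- exact: (measurable_power_integrand _ cuL chi2 (time_in t0 tb)).
- by move=> x _; rewrite lee_fin mulr_ge0// powR_ge0.
- rewrite lee_fin mulr_ge0 ?h0 ?(ltW t0)// /dilate expr0 mul1r.
  by have /andP[] := onset_01 oth (d^-1 * t).
Qed.

(** The equation tested up to [t = 0]: for a profile [h] that vanishes from time
    [b] on, the initial values appear as boundary terms.  In particular the
    integral of [|u|^p] is finite. *)
Lemma solution_identity :
  (\int[leb]_(t in `]0%R, b[) ((h 0 t)%:E * \int[mu]_x (`|u t x| `^ p * chi x)%:E))%E =
  (\int[leb]_(t in `]0, b[) (\int[mu]_x (u t x *
      (h 2 t * chi x - h 0 t * laplace_radial F k x - eta' t * kap x)))
    - (h 0 0 * \int[mu]_x (v 0 x * chi x) - h 1 0 * \int[mu]_x (u 0 x * chi x)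
       + eta 0 * \int[mu]_x (u 0 x * kap x)))%:E.
Proof.
have cuL := continuous_H1_L2 cu.
have [th [D oth]] := @smooth_onset R.
have cc := L2_continuous_pairing bT cuL.
have hb0 : h 0 b = 0 by exact: hb.
have mG := measurable_power_integral p1 bT cuL chi2 chi_ge0.
apply: (etrans (weak_ode_initial_data oth b0 (cc _ chi2) (L2_continuous_pairing bT cv chi2)
  (cc _ lap2) (cc _ kap2) (fun t tb => L2_derivative_pairing bT cuL cv duv chi2 tb)
  dh de ce' _ hb0 mG _ (tested_equation oth))).
- by move=> t /andP[t0 _]; apply: h0; exact: ltW.
- by move=> t _; apply: integral_ge0 => x _; rewrite lee_fin mulr_ge0// powR_ge0.
congr (EFin (_ - _)); apply: eq_Rintegral => t; rewrite inE/= in_itv/= => /andP[t0 tb].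
rewrite L2_pairing_linear//.
by have [] := cuL t (time_in t0 tb).
Qed.
End solution_identity.

(** * Size of the adjoint operator on the test function *)
Section weight_bound.
Context {R : realType} {N : nat}.
Context (r C : R) (F : nat -> R -> R) (r0 : 0 < r) (r1 : r < 1) (cF : cutoff r F C).
Context (a0 alpha beta : R) (a0_ge0 : 0 <= a0) (alpha0 : alpha <= 0) (beta0 : 0 <= beta).

(** By Leibniz' rule, the [n]-th derivative of [(1 + beta t) F 0 (t / T)]; the
    value [n.-1 = 0] at [n = 0] is harmless, its coefficient being zero. *)
Definition time_weight (T : R) n (t : R) : R :=
  (1 + beta * t) * dilate F T n t + n%:R * beta * dilate F T n.-1 t.

(** The adjoint operator applied to [(1 + beta t) F 0 (t / T) F 0 (|x|^2 / rho^2)].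
    In the damping term the factor [1 + beta t] has been cancelled by
    [(1 + t) `^ (- beta)]. *)
Definition test_error (rho T t : R) (x : 'rV[R]_N) : R :=
  time_weight T 2 t * radial F (rho ^- 2) 0 x
  - time_weight T 0 t * laplace_radial F (rho ^- 2) x
  - dilate F T 1 t * (a0 * jbracket x `^ (- alpha) * radial F (rho ^- 2) 0 x).

Definition test_value (rho T t : R) (x : 'rV[R]_N) : R :=
  dilate F T 0 t * radial F (rho ^- 2) 0 x.

Definition error_const : R :=
  3 * C + (8 + 2 * N%:R) * C + C * (a0 * 3 `^ (- alpha / 2)).

Let C0 : 0 < C := cutoff_const_gt0 cF.

Let F01_le_powr s : F 0 s <= F 0 s `^ r.
Proof.
have /andP[F0 F1] := cutoff_01 cF s.
have [->|Fn0] := eqVneq (F 0 s) 0; first exact: powR_ge0.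
rewrite -[leLHS]powRr1//; apply: ger_powR; last exact: ltW.
by rewrite lt_neqAle eq_sym Fn0 F0.
Qed.

Variables (rho T t : R) (x : 'rV[R]_N).
Hypotheses (rho1 : 1 <= rho) (rhoT : rho <= T) (t0 : 0 <= t).
Hypothesis rate : T <= t -> T^-1 * rho `^ (- alpha) <= (1 + beta * t) * rho ^- 2.

Let rho0 : 0 < rho. Proof. exact: lt_le_trans rho1. Qed.
Let T0 : 0 < T. Proof. exact: lt_le_trans rhoT. Qed.
Let A := F 0 (T^-1 * t) `^ r.
Let B := F 0 (rho ^- 2 * sqnorm x) `^ r.
Let A0 : 0 <= A. Proof. exact: powR_ge0. Qed.
Let B0 : 0 <= B. Proof. exact: powR_ge0. Qed.
Let bt : 1 <= 1 + beta * t. Proof. by rewrite lerDl mulr_ge0. Qed.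
Let bt0 : 0 <= 1 + beta * t. Proof. exact: le_trans bt. Qed.
Let k0 : 0 <= rho ^- 2. Proof. by rewrite invr_ge0 exprn_ge0// ltW. Qed.
Let C_ge0 : 0 <= C. Proof. exact: ltW. Qed.
Let Tm2 : T ^- 2 <= rho ^- 2.
Proof. by rewrite lef_pV2 ?posrE ?exprn_gt0// lerXn2r// nnegrE ltW. Qed.

Let F1_small (s : R) : 0 <= s -> s < 1 -> F 1 s = 0.
Proof. by move=> s0 s1; apply: (cutoff_flat cF) => //; rewrite ger0_norm. Qed.

Let radial_le1 : `|@radial R N F (rho ^- 2) 0 x| <= B.
Proof.
rewrite ger0_norm; first exact: F01_le_powr.
by have /andP[] := cutoff_01 cF (rho ^- 2 * sqnorm x).
Qed.

Let dilate0_le : `|dilate F T 0 t| <= A.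
Proof.
rewrite /dilate expr0 mul1r ger0_norm; first exact: F01_le_powr.
by have /andP[] := cutoff_01 cF (T^-1 * t).
Qed.

Let bound2 : `|time_weight T 2 t| <= 3 * C * A * (rho ^- 2 * (1 + beta * t)).
Proof.
have h2 : `|dilate F T 2 t| <= rho ^- 2 * (C * A).
  rewrite /dilate normrM ger0_norm ?exprn_ge0 ?invr_ge0 ?(ltW T0)// exprVn.
  by apply: ler_pM => //; [rewrite invr_ge0 exprn_ge0// ltW|exact: cutoff_bound cF _ _ _].
have h1 : beta * `|dilate F T 1 t| <= rho ^- 2 * (1 + beta * t) * (C * A).
  rewrite /dilate /= expr1; have [s1|s1] := ltP (T^-1 * t) 1.
    rewrite F1_small ?mulr_ge0 ?invr_ge0 ?(ltW T0)// mulr0 normr0 mulr0.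
    by rewrite !mulr_ge0.
  have Tt : T <= t by move: s1; rewrite mulrC ler_pdivlMr// mul1r.
  rewrite normrM ger0_norm ?invr_ge0 ?(ltW T0)// mulrA.
  apply: ler_pM => //; first by rewrite mulr_ge0// invr_ge0 ltW.
    apply: (@le_trans _ _ (T ^- 2 * (1 + beta * t))).
      rewrite expr2 invfM -mulrA [leLHS]mulrC ler_wpM2l ?invr_ge0 ?(ltW T0)//.
      rewrite mulrC ler_pdivlMr//; apply: (@le_trans _ _ (beta * t)).
        by rewrite ler_wpM2l.
      by rewrite lerDr.
    by rewrite ler_wpM2r.
  exact: cutoff_bound cF _ _ _.
rewrite /time_weight; apply: le_trans (ler_normD _ _) _.
rewrite normrM (ger0_norm bt0).
rewrite (normrM (2%:R * beta)) (@ger0_norm _ (2%:R * beta)) ?mulr_ge0//.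
have k1 : (1 + beta * t) * `|dilate F T 2 t| <= (1 + beta * t) * (rho ^- 2 * (C * A)).
  by rewrite ler_wpM2l.
have k2 : 2%:R * beta * `|dilate F T 1 t| <= 2 * (rho ^- 2 * (1 + beta * t) * (C * A)).
  by rewrite -mulrA ler_wpM2l.
apply: (le_trans (lerD k1 k2)).
by rewrite le_eqVlt; apply/orP; left; apply/eqP; ring.
Qed.

Let bound_lap : `|laplace_radial F (rho ^- 2) x| <= (8 + 2 * N%:R) * C * B * rho ^- 2.
Proof.
have q0 : 0 <= rho ^- 2 * sqnorm x by rewrite mulr_ge0// sqnorm_ge0.
have h2 : `|rho ^- 2 * sqnorm x * radial F (rho ^- 2) 2 x| <= 2 * (C * B).
  rewrite normrM (ger0_norm q0) /radial; have [q2|q2] := leP 2 (rho ^- 2 * sqnorm x).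
    rewrite (cutoff_outside r0 cF)//; last by rewrite ger0_norm.
    by rewrite normr0 mulr0 !mulr_ge0// ltW.
  apply: ler_pM => //; first exact: ltW.
  exact: cutoff_bound cF _ _ _.
have h1 : `|radial F (rho ^- 2) 1 x| <= C * B by exact: cutoff_bound cF _ _ _.
rewrite /laplace_radial (_ : 4 * (rho ^- 2) ^+ 2 * sqnorm x * radial F (rho ^- 2) 2 x =
   4 * rho ^- 2 * (rho ^- 2 * sqnorm x * radial F (rho ^- 2) 2 x)); last by ring.
apply: le_trans (ler_normD _ _) _.
rewrite normrM (@ger0_norm _ (4 * rho ^- 2)) ?mulr_ge0// [X in _ + X <= _]normrM (@ger0_norm _ (2 * rho ^- 2 * N%:R)) ?mulr_ge0//.
have k1 : 4 * rho ^- 2 * `|rho ^- 2 * sqnorm x * radial F (rho ^- 2) 2 x| <= 4 * rho ^- 2 * (2 * (C * B)).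
  by rewrite ler_wpM2l// mulr_ge0.
have k2 : 2 * rho ^- 2 * N%:R * `|radial F (rho ^- 2) 1 x| <= 2 * rho ^- 2 * N%:R * (C * B).
  by rewrite ler_wpM2l// !mulr_ge0.
apply: (le_trans (lerD k1 k2)).
by rewrite le_eqVlt; apply/orP; left; apply/eqP; ring.
Qed.

Let bound_damp : `|dilate F T 1 t * (a0 * jbracket x `^ (- alpha) * radial F (rho ^- 2) 0 x)| <=
  C * (a0 * 3 `^ (- alpha / 2)) * A * B * (rho ^- 2 * (1 + beta * t)).
Proof.
have rhs0 : 0 <= C * (a0 * 3 `^ (- alpha / 2)) * A * B * (rho ^- 2 * (1 + beta * t)).
  by rewrite !mulr_ge0 ?powR_ge0.
have [s1|s1] := ltP (T^-1 * t) 1.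
  rewrite /dilate F1_small ?mulr_ge0 ?invr_ge0 ?(ltW T0)//.
  by rewrite mulr0 mul0r normr0.
have Tt : T <= t by move: s1; rewrite mulrC ler_pdivlMr// mul1r.
have [q2|q2] := leP 2 (rho ^- 2 * sqnorm x).
  rewrite /radial (cutoff_outside r0 cF)//; last by rewrite ger0_norm// (le_trans _ q2).
  by rewrite !mulr0 normr0.
have s0 := sqnorm_ge0 x.
have jb : jbracket x `^ (- alpha) <= 3 `^ (- alpha / 2) * rho `^ (- alpha).
  rewrite jbracketE.
  have -> : rho `^ (- alpha) = (rho ^+ 2) `^ (- alpha / 2).
    by rewrite -powR_mulrn ?(ltW rho0)// -powRrM; congr (_ `^ _); field.
  rewrite -powRM ?exprn_ge0 ?(ltW rho0)//.
  apply: ge0_ler_powR; rewrite ?nnegrE ?mulr_ge0 ?exprn_ge0 ?addr_ge0 ?oppr_ge0 ?(ltW rho0)//.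
  have q3 : sqnorm x < 2 * rho ^+ 2 by rewrite -ltr_pdivrMr ?exprn_gt0// mulrC.
  have : 1 <= rho ^+ 2 by rewrite exprn_ege1.
  lra.
rewrite /dilate /= expr1 !normrM (ger0_norm a0_ge0) (ger0_norm (powR_ge0 _ _)) (@ger0_norm _ T^-1) ?invr_ge0 ?(ltW T0)//.
have h1 : `|F 1 (T^-1 * t)| <= C * A by exact: cutoff_bound cF _ _ _.
rewrite (_ : _ * _ * (_ * _ * _) = `|F 1 (T^-1 * t)| * (a0 * (T^-1 * jbracket x `^ (- alpha))) * `|radial F (rho ^- 2) 0 x|); last by ring.
rewrite (_ : C * (a0 * 3 `^ (- alpha / 2)) * A * B * (rho ^- 2 * (1 + beta * t)) =
   C * A * (a0 * (3 `^ (- alpha / 2) * ((1 + beta * t) * rho ^- 2))) * B); last by ring.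
have iT : 0 <= T^-1 by rewrite invr_ge0 ltW.
apply: ler_pM => //; first by rewrite !mulr_ge0// powR_ge0.
apply: ler_pM => //; first by rewrite !mulr_ge0// powR_ge0.
rewrite ler_wpM2l//; apply: (@le_trans _ _ (T^-1 * (3 `^ (- alpha / 2) * rho `^ (- alpha)))).
  by rewrite ler_wpM2l.
by rewrite mulrCA ler_wpM2l ?powR_ge0// rate.
Qed.

(** The three terms are compared with [rho^-2 (1 + beta t)].  The Laplacian is
    of this size by scaling.  The first derivative of the time cutoff vanishes
    before [T], and this is used twice: for the second time derivative, which
    gives [T^-2 (1 + beta t)] and [beta T^-1 <= T^-2 (beta t)], and for the
    damping, which gives [T^-1 rho^(-alpha)]; hypothesis [rate] is the relation
    between [T] and [rho] that the latter imposes. *)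
Lemma test_error_bound :
  `|test_error rho T t x| <= error_const * rho ^- 2 * (1 + beta * t) * test_value rho T t x `^ r.
Proof.
have valE : test_value rho T t x `^ r = A * B.
  rewrite /test_value /dilate expr0 mul1r powRM//.
    by have /andP[] := cutoff_01 cF (T^-1 * t).
  by have /andP[] := cutoff_01 cF (rho ^- 2 * sqnorm x).
rewrite valE /test_error.
have w0 : `|time_weight T 0 t| <= (1 + beta * t) * A.
  rewrite /time_weight mul0r mul0r addr0 normrM ger0_norm//.
  by rewrite ler_wpM2l.
have k1 : `|time_weight T 2 t * radial F (rho ^- 2) 0 x| <= 3 * C * A * (rho ^- 2 * (1 + beta * t)) * B.
  by rewrite normrM ler_pM.
have k2 : `|time_weight T 0 t * laplace_radial F (rho ^- 2) x| <= (1 + beta * t) * A * ((8 + 2 * N%:R) * C * B * rho ^- 2).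
  by rewrite normrM ler_pM.
apply: le_trans (ler_normB _ _) _.
apply: le_trans (lerD (ler_normB _ _) bound_damp) _.
apply: le_trans (lerD (lerD k1 k2) (lexx _)) _.
by rewrite /error_const le_eqVlt; apply/orP; left; apply/eqP; ring.
Qed.

End weight_bound.

(** Young's inequality for the product of [lam `^ p^-1 * y * v `^ p^-1] and
    [lam `^ (- p^-1) * e]. *)
Lemma young_scaled {R : realType} (p lam y v e : R) : 1 < p -> 0 < lam ->
  0 <= y -> 0 <= v -> 0 <= e ->
  y * (e * v `^ p^-1) <= lam * (y `^ p * v) + lam `^ (- (p - 1)^-1) * e `^ (p / (p - 1)).
Proof.
move=> p1 lam0 y0 v0 e0; have p0 : 0 < p by lra.
have pn0 : p != 0 by rewrite gt_eqF.
have p1n0 : p - 1 != 0 by rewrite gt_eqF//; lra.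
have q0 : 0 < p / (p - 1) by rewrite divr_gt0//; lra.
have pq : p^-1 + (p / (p - 1))^-1 = 1 by rewrite invf_div; field.
pose X := lam `^ p^-1 * (y * v `^ p^-1); pose Y := lam `^ (- p^-1) * e.
have X0 : 0 <= X by rewrite !mulr_ge0 ?powR_ge0.
have Y0 : 0 <= Y by rewrite !mulr_ge0 ?powR_ge0.
have XY : y * (e * v `^ p^-1) = X * Y.
  rewrite /X /Y (_ : _ * _ * (_ * _) = lam `^ p^-1 * lam `^ (- p^-1) * (y * (e * v `^ p^-1))); last by ring.
  by rewrite powRN mulfV ?mul1r// gt_eqF// powR_gt0.
have Xp : X `^ p = lam * (y `^ p * v).
  rewrite /X powRM ?mulr_ge0 ?powR_ge0// (powRM _ y0 (powR_ge0 _ _)) -!powRrM mulVf//.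
  by rewrite !powRr1// ltW.
have Yq : Y `^ (p / (p - 1)) = lam `^ (- (p - 1)^-1) * e `^ (p / (p - 1)).
  rewrite /Y powRM ?powR_ge0// -powRrM; congr (_ `^ _ * _).
  by field; apply/andP.
rewrite XY; apply: (le_trans (@conjugate_powR R X Y p (p / (p - 1)) X0 Y0 p0 q0 pq)).
rewrite Xp Yq; apply: lerD.
  by rewrite ler_pdivrMr// ler_peMr ?(ltW p1)// mulr_ge0 ?(ltW lam0)// mulr_ge0// powR_ge0.
rewrite ler_pdivrMr// ler_peMr//; first by rewrite mulr_ge0 ?powR_ge0.
by rewrite ler_pdivlMr ?mul1r; lra.
Qed.

(** * The energy inequality *)
Section energy.
Context {R : realType} {N : nat}.
Local Notation mu := (@lebesgue_rV R N).
Local Notation leb := (@lebesgue_measure R).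
Context (p C : R) (F : nat -> R -> R) (p1 : 1 < p) (cF : cutoff p^-1 F C).
Context (a0 alpha beta : R) (a0_ge0 : 0 <= a0) (alpha0 : alpha <= 0) (beta0 : 0 <= beta).

Local Notation E := (@error_const R N C a0 alpha).
Local Notation W := (time_weight F beta).
Local Notation chi rho := (@radial R N F (rho ^- 2) 0).

Let r0 : 0 < p^-1. Proof. by rewrite invr_gt0 (lt_trans ltr01). Qed.
Let r1 : p^-1 < 1. Proof. by rewrite invf_lt1// (lt_trans ltr01). Qed.

Definition young_const (lam rho : R) : R :=
  lam `^ (- (p - 1)^-1) * (E * rho ^- 2) `^ (p / (p - 1)).

Lemma error_const_ge0 : 0 <= E.
Proof.
have C0 := ltW (cutoff_const_gt0 cF).
by rewrite /error_const !addr_ge0// !mulr_ge0// ?powR_ge0// addr_ge0// mulr_ge0.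
Qed.

Let F0 s : 0 <= F 0 s <= 1. Proof. exact: cutoff_01 cF s. Qed.

Lemma time_weight0 T t : W T 0 t = (1 + beta * t) * F 0 (T^-1 * t).
Proof. by rewrite /time_weight mul0r mul0r addr0 /dilate expr0 mul1r. Qed.

Lemma sqnorm_lt_box (rho : R) (x : 'rV[R]_N) : 0 < rho ->
  rho ^- 2 * sqnorm x < 2 -> box (2 * rho) x.
Proof.
move=> rho0 h1 i; have h2 := sqr_coord_le x i.
have h3 : sqnorm x < 2 * rho ^+ 2 by rewrite -ltr_pdivrMr ?exprn_gt0// mulrC.
rewrite leNgt; apply/negP => h4.
have : (2 * rho) ^+ 2 < x ord0 i ^+ 2.
  by rewrite -(real_normK (num_real (x ord0 i))) ltrXn2r// mulr_ge0// ltW.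
have : 0 <= rho ^+ 2 by exact: sqr_ge0.
rewrite exprMn; lra.
Qed.

(** The reason for comparing two scales.  Near a point where both cutoffs at
    scale [rho] are 1 the error vanishes, and the mass density at scale
    [rho / 2] is at most the one at scale [rho].  At any other point the density
    at scale [rho / 2] is zero, so all of the mass at scale [rho] is available
    to absorb the error. *)
Lemma energy_pointwise (rho T T' t lam y : R) (x : 'rV[R]_N) :
  1 <= rho -> rho <= T -> 0 < T' -> 2 * T' <= T -> 0 <= t -> 0 < lam ->
  (T <= t -> T^-1 * rho `^ (- alpha) <= (1 + beta * t) * rho ^- 2) ->
  `|y * test_error F a0 alpha beta rho T t x| + lam * (W T' 0 t * (`|y| `^ p * chi (rho / 2) x)) <=
  lam * (W T 0 t * (`|y| `^ p * chi rho x)) +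
    (1 + beta * t) * young_const lam rho * \1_(box (2 * rho)) x.
Proof.
move=> rho1 rhoT T'0 TT' t0 lam0 rate.
have rho0 : 0 < rho by exact: lt_le_trans rho1.
have T0 : 0 < T by exact: lt_le_trans rhoT.
have bt0 : 0 <= 1 + beta * t by rewrite addr_ge0// mulr_ge0.
have q0 : 0 <= rho ^- 2 * sqnorm x by rewrite mulr_ge0 ?sqnorm_ge0// invr_ge0 exprn_ge0// ltW.
have s0 : 0 <= T^-1 * t by rewrite mulr_ge0// invr_ge0 ltW.
have Y0 : 0 <= young_const lam rho by rewrite mulr_ge0// powR_ge0.
have yp : 0 <= `|y| `^ p by exact: powR_ge0.
have ind0 : 0 <= \1_(box (2 * rho)) x :> R by rewrite indicE; case: (_ \in _).
have extra0 : 0 <= (1 + beta * t) * young_const lam rho * \1_(box (2 * rho)) x.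
  exact: mulr_ge0 (mulr_ge0 bt0 Y0) ind0.
rewrite !time_weight0 /radial.
have [/andP[s1 q1]|] := boolP ((T^-1 * t < 1) && (rho ^- 2 * sqnorm x < 1)).
  have -> : test_error F a0 alpha beta rho T t x = 0.
    have Fs n : (0 < n)%N -> F n (T^-1 * t) = 0 by move=> n0; rewrite (cutoff_flat cF)// ger0_norm.
    have Fq n : (0 < n)%N -> F n (rho ^- 2 * sqnorm x) = 0 by move=> n0; rewrite (cutoff_flat cF)// ger0_norm.
    by rewrite /test_error /time_weight /laplace_radial /dilate /radial/= (Fs 1)// (Fs 2)// (Fq 1)// (Fq 2)// !(mulr0, mul0r, addr0, subr0).
  rewrite mulr0 normr0 add0r (cutoff_eq1 cF (s := T^-1 * t)); last by rewrite ger0_norm// ltW.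
  rewrite (cutoff_eq1 cF (s := rho ^- 2 * sqnorm x)); last by rewrite ger0_norm// ltW.
  rewrite !mulr1; apply: ler_wpDr => //; rewrite ler_wpM2l// ?(ltW lam0)//.
  have /andP[a0' a1] := F0 (T'^-1 * t); have /andP[b0' b1] := F0 ((rho / 2) ^- 2 * sqnorm x).
  apply: ler_pM => //; rewrite ?mulr_ge0//.
    by rewrite ler_piMr.
  by rewrite ler_piMr.
rewrite negb_and -!leNgt => H.
have prev0 : F 0 (T'^-1 * t) * F 0 ((rho / 2) ^- 2 * sqnorm x) = 0.
  case/orP: H => [s1|q1].
    rewrite (cutoff_eq0 cF (s := T'^-1 * t)) ?mul0r//.
    have Tt : T <= t by move: s1; rewrite mulrC ler_pdivlMr// mul1r.
    rewrite ger0_norm ?mulr_ge0 ?invr_ge0 ?(ltW T'0)//.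
    by rewrite mulrC ler_pdivlMr// (le_trans TT').
  rewrite (cutoff_eq0 cF (s := (rho / 2) ^- 2 * sqnorm x)) ?mulr0//.
  have -> : (rho / 2) ^- 2 * sqnorm x = 4 * (rho ^- 2 * sqnorm x).
    by field; rewrite gt_eqF.
  apply: le_trans (ler_norm _); apply: (@le_trans _ _ (4 * 1)); last by rewrite ler_wpM2l.
  by rewrite mulr1 ler_nat.
rewrite (_ : lam * ((1 + beta * t) * F 0 (T'^-1 * t) * (`|y| `^ p * F 0 ((rho / 2) ^- 2 * sqnorm x))) =
  lam * ((1 + beta * t) * `|y| `^ p) * (F 0 (T'^-1 * t) * F 0 ((rho / 2) ^- 2 * sqnorm x))); last by ring.
rewrite prev0 mulr0 addr0.
have /andP[A0 A1] := F0 (T^-1 * t); have /andP[B0 B1] := F0 (rho ^- 2 * sqnorm x).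
pose val := F 0 (T^-1 * t) * F 0 (rho ^- 2 * sqnorm x).
have val0 : 0 <= val by rewrite mulr_ge0.
have valE : test_value F rho T t x = val by rewrite /test_value /dilate expr0 mul1r.
have := test_error_bound r0 r1 cF a0_ge0 alpha0 beta0 x rho1 rhoT t0 rate.
rewrite valE => err.
have lhs : `|y * test_error F a0 alpha beta rho T t x| <= (1 + beta * t) * (`|y| * (E * rho ^- 2 * val `^ p^-1)).
  rewrite normrM; apply: (le_trans (ler_wpM2l (normr_ge0 y) err)).
  by rewrite le_eqVlt; apply/orP; left; apply/eqP; ring.
have E0 : 0 <= E * rho ^- 2.
  by rewrite mulr_ge0 ?error_const_ge0// invr_ge0 exprn_ge0// ltW.
have Yg := young_scaled p1 lam0 (normr_ge0 y) val0 E0.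
apply: (le_trans lhs).
rewrite (_ : lam * ((1 + beta * t) * F 0 (T^-1 * t) * (`|y| `^ p * F 0 (rho ^- 2 * sqnorm x))) =
  (1 + beta * t) * (lam * (`|y| `^ p * val))); last by rewrite /val; ring.
rewrite -(mulrA (1 + beta * t)) -mulrDr ler_wpM2l//.
have [xb|xb] := pselect (box (2 * rho) x).
  by rewrite indicE mem_set// mulr1.
have q2 : 2 <= rho ^- 2 * sqnorm x.
  by rewrite leNgt; apply/negP => q2; apply: xb; exact: sqnorm_lt_box.
have v0 : val = 0 by rewrite /val (cutoff_eq0 cF (s := rho ^- 2 * sqnorm x)) ?mulr0// ger0_norm.
rewrite v0 powR0 ?invr_neq0 ?gt_eqF ?(lt_trans ltr01)// !mulr0 add0r.
by rewrite mulr_ge0.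
Qed.

Lemma chi_ge0 (rho : R) x : 0 <= chi rho x.
Proof. by have /andP[] := F0 (rho ^- 2 * sqnorm x). Qed.

Lemma time_weight_ge0 (T t : R) : 0 <= t -> 0 <= W T 0 t.
Proof.
move=> t0; rewrite time_weight0 mulr_ge0//; last by have /andP[] := F0 (T^-1 * t).
by rewrite addr_ge0// mulr_ge0.
Qed.

Definition power_mass (f : 'rV[R]_N -> R) (rho : R) : \bar R :=
  (\int[mu]_x (`|f x| `^ p * chi rho x)%:E)%E.

Lemma power_mass_ge0 f rho : (0 <= power_mass f rho)%E.
Proof. by apply: integral_ge0 => x _; rewrite lee_fin mulr_ge0 ?powR_ge0 ?chi_ge0. Qed.

Lemma test_error_L2 (rho T t : R) : 0 < rho ->
  @test_error R N F a0 alpha beta rho T t \in L2.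
Proof.
move=> rho0; have k0 : 0 < rho ^- 2 by rewrite invr_gt0 exprn_gt0.
have h1 : chi rho \in L2 := L2_radial r0 cF k0.
have h2 : laplace_radial F (rho ^- 2) \in @L2 R N := L2_laplace_radial r0 cF k0.
have h3 : (fun x => a0 * jbracket x `^ (- alpha) * chi rho x) \in L2.
  by apply: (L2_damped_radial r0 cF k0); rewrite oppr_ge0.
have -> : @test_error R N F a0 alpha beta rho T t = (W T 2 t *: chi rho + (- W T 0 t *: laplace_radial F (rho ^- 2) +
      (- dilate F T 1 t *: (fun x => a0 * jbracket x `^ (- alpha) * chi rho x) + 0))).
  by apply/funext => x; rewrite /test_error !fctE addr0 /GRing.scale/= !mulNr addrA.
do 3!apply: L2_linear => //.
have -> : (0 : 'rV[R]_N -> R) = chi rho - chi rho by rewrite subrr.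
exact: L2_sub.
Qed.

Lemma measurable_power_mass (f : 'rV[R]_N -> R) rho : 0 < rho -> measurable_fun setT f ->
  measurable_fun setT (fun x => `|f x| `^ p * chi rho x).
Proof.
move=> rho0 mf; have k0 : 0 < rho ^- 2 by rewrite invr_gt0 exprn_gt0.
apply: measurable_funM; last exact: L2_measurable (L2_radial r0 cF k0).
by apply: (measurableT_comp (measurable_powR _)); exact: measurableT_comp.
Qed.

(** The maximum with 0 keeps both sides nonnegative, so that the inequality can be
    integrated in time without integrability assumptions. *)
Lemma energy_at_time (rho T T' t lam : R) (f : 'rV[R]_N -> R) : f \in L2 ->
  1 <= rho -> rho <= T -> 0 < T' -> 2 * T' <= T -> 0 <= t -> 0 < lam ->
  (T <= t -> T^-1 * rho `^ (- alpha) <= (1 + beta * t) * rho ^- 2) ->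
  ((Num.max (\int[mu]_x (f x * test_error F a0 alpha beta rho T t x)) 0)%R%:E
    + lam%:E * ((W T' 0 t)%:E * power_mass f (rho / 2)) <=
   lam%:E * ((W T 0 t)%:E * power_mass f rho) +
    ((1 + beta * t) * (young_const lam rho * (4 * rho) ^+ N))%R%:E)%E.
Proof.
move=> f2 rho1 rhoT T'0 TT' t0 lam0 rate.
have rho0 : 0 < rho by exact: lt_le_trans rho1.
have rho20 : 0 < rho / 2 by rewrite divr_gt0.
have bt0 : 0 <= 1 + beta * t by rewrite addr_ge0// mulr_ge0.
have Y0 : 0 <= young_const lam rho by exact: mulr_ge0 (powR_ge0 _ _) (powR_ge0 _ _).
have mf := L2_measurable f2.
have fe := L2_mul_integrable f2 (test_error_L2 T t rho0).
have mfe := measurable_int _ fe.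
pose e (x : 'rV[R]_N) : R := `|f x * test_error F a0 alpha beta rho T t x|.
pose g' (x : 'rV[R]_N) : R := lam * (W T' 0 t * (`|f x| `^ p * chi (rho / 2) x)).
pose g (x : 'rV[R]_N) : R := lam * (W T 0 t * (`|f x| `^ p * chi rho x)).
pose D := (1 + beta * t) * young_const lam rho.
pose i (x : 'rV[R]_N) : R := D * \1_(box (2 * rho)) x.
have D0 : 0 <= D by exact: mulr_ge0.
have e0 x : 0 <= e x by exact: normr_ge0.
have g0 x : 0 <= g x.
  by rewrite !mulr_ge0 ?(ltW lam0) ?time_weight_ge0 ?powR_ge0 ?chi_ge0.
have g'0 x : 0 <= g' x.
  by rewrite !mulr_ge0 ?(ltW lam0) ?time_weight_ge0 ?powR_ge0 ?chi_ge0.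
have i0 x : 0 <= i x by rewrite mulr_ge0// indicE; case: (_ \in _).
have me : measurable_fun setT (EFin \o e).
  by apply/measurable_EFinP; apply: measurableT_comp => //; apply/measurable_EFinP.
have mg : measurable_fun setT (EFin \o g).
  by apply/measurable_EFinP; do 2!apply: measurable_funM => //; exact: measurable_power_mass.
have mg' : measurable_fun setT (EFin \o g').
  by apply/measurable_EFinP; do 2!apply: measurable_funM => //; exact: measurable_power_mass.
have mi : measurable_fun setT (EFin \o i).
  by apply/measurable_EFinP; apply: measurable_funM => //; apply: measurable_indic; exact: measurable_box.
have massE (S sg : R) : 0 < sg ->
    (lam%:E * ((W S 0 t)%:E * power_mass f sg) =
     \int[mu]_x (lam * (W S 0 t * (`|f x| `^ p * chi sg x)))%:E)%E.
  move=> sg0; have mm := measurable_power_mass sg0 mf.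
  have w0 : 0 <= W S 0 t by exact: time_weight_ge0.
  have m0 x : 0 <= `|f x| `^ p * chi sg x by rewrite mulr_ge0 ?powR_ge0 ?chi_ge0.
  under [RHS]eq_integral => x _ do rewrite EFinM.
  rewrite ge0_integralZl//; [|by apply/measurable_EFinP; exact: measurable_funM|
    by move=> x _; rewrite lee_fin mulr_ge0|by rewrite lee_fin ltW].
  congr (_ * _)%E; under [RHS]eq_integral => x _ do rewrite EFinM.
  have mm' : measurable_fun setT (EFin \o (fun x => `|f x| `^ p * chi sg x)) by exact/measurable_EFinP.
  rewrite ge0_integralZl// => x _; rewrite lee_fin; exact: m0.
have iE : ((D * (4 * rho) ^+ N)%:E = \int[mu]_x (i x)%:E)%E.
  under eq_integral => x _ do rewrite EFinM.
  rewrite ge0_integralZl//.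
  - rewrite integral_indic ?setIT//; last exact: measurable_box.
    rewrite [X in (_ * X)%E]lebesgue_box; last by rewrite mulr_ge0// ltW.
    by rewrite -EFinM; congr (EFin (_ * _ ^+ _)); ring.
  - by apply/measurable_EFinP; apply: measurable_indic; exact: measurable_box.
have JE : ((Num.max (\int[mu]_x (f x * test_error F a0 alpha beta rho T t x)) 0)%R%:E <= \int[mu]_x (e x)%:E)%E.
  have eI : ((\int[mu]_x e x)%:E = \int[mu]_x (e x)%:E)%E.
    by rewrite /Rintegral fineK//; apply: integrable_fin_num => //; exact: (integrable_norm fe).
  rewrite -eI lee_fin ge_max Rintegral_ge0// andbT.
  apply: (le_trans (ler_norm _)); exact: (le_normr_Rintegral measurableT fe).
rewrite !massE// mulrA -/D iE.
apply: (le_trans (leeD2r _ JE)).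
have pos (q : 'rV[R]_N -> R) : (forall x, 0 <= q x) ->
    forall x, [set: 'rV[R]_N] x -> (0 <= (EFin \o q) x)%E.
  by move=> q0 x _; rewrite lee_fin.
have S1 := @ge0_integralD _ _ _ mu _ measurableT _ _ (pos _ e0) me (pos _ g'0) mg'.
have S2 := @ge0_integralD _ _ _ mu _ measurableT _ _ (pos _ g0) mg (pos _ i0) mi.
rewrite -[X in (X <= _)%E]S1 -[X in (_ <= X)%E]S2.
apply: ge0_le_integral => //.
- by move=> x _; rewrite -EFinD lee_fin addr_ge0.
- exact: emeasurable_funD.
- exact: emeasurable_funD.
- by move=> x _; rewrite -!EFinD lee_fin; exact: energy_pointwise.
Qed.

Context (alpha_lt0 : alpha < 0) (beta01 : beta = 0 \/ beta = 1).

(** The time scale is chosen so that [tau^-1 rho^(-alpha) <= (1 + beta tau) rho^-2],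
    that is, so that the damping and the Laplacian balance. *)
Definition kappa : R := (2 - alpha) / (1 + beta).
Definition tau (rho : R) : R := rho `^ kappa.

Let bp : 0 < 1 + beta. Proof. by rewrite ltr_wpDr. Qed.

Lemma kappa_gt1 : 1 < kappa.
Proof.
rewrite /kappa ltr_pdivlMr// mul1r; case: beta01 => ->; have := alpha_lt0; lra.
Qed.

Let tau_gt0 rho : 0 < rho -> 0 < tau rho. Proof. exact: powR_gt0. Qed.

Lemma le_tau rho : 1 <= rho -> rho <= tau rho.
Proof.
move=> rho1; rewrite -[leLHS]powRr1 ?(le_trans ler01)//.
by rewrite /tau ler_powR// ltW// kappa_gt1.
Qed.

Lemma tau_half rho : 0 < rho -> 2 * tau (rho / 2) <= tau rho.
Proof.
move=> rho0; rewrite /tau -{2}(mulfVK (x := 2) _ rho)//.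
have k2 : 2 <= 2 `^ kappa :> R.
  by rewrite -[leLHS]powRr1// ler_powR ?ler1n// ltW// kappa_gt1.
by rewrite [leRHS]powRM ?divr_ge0 ?(ltW rho0)// mulrC ler_wpM2l// powR_ge0.
Qed.

Lemma tau_pow rho : 0 < rho -> tau rho `^ (1 + beta) = rho `^ (2 - alpha).
Proof. by move=> rho0; rewrite /tau -powRrM; congr (_ `^ _); rewrite /kappa mulfVK// gt_eqF. Qed.

Lemma tau_rate rho t : 1 <= rho -> tau rho <= t ->
  (tau rho)^-1 * rho `^ (- alpha) <= (1 + beta * t) * rho ^- 2.
Proof.
move=> rho1 tt; have rho0 : 0 < rho by exact: lt_le_trans rho1.
have T0 := tau_gt0 rho0.
have h : rho `^ (- alpha) = tau rho `^ (1 + beta) * rho ^- 2.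
  rewrite tau_pow// powRD; last by apply/implyP => _; rewrite gt_eqF.
  by rewrite powR_mulrn ?(ltW rho0)// [X in X / _]mulrC mulfK// expf_neq0// gt_eqF.
rewrite h mulrA ler_wpM2r ?invr_ge0 ?exprn_ge0 ?(ltW rho0)//.
case: beta01 => bE; rewrite bE.
  by rewrite addr0 powRr1 ?(ltW T0)// mulVf ?gt_eqF// mul0r addr0.
rewrite (_ : 1 + 1 = 2%:R)// powR_mulrn ?(ltW T0)// expr2 mulrA mulVf ?gt_eqF// !mul1r.
by rewrite (le_trans tt)// lerDr.
Qed.

(** The integral of [1 + beta t] over the support of the time cutoff is at most
    the left-hand side. *)
Lemma tau_time_mass rho : 1 <= rho ->
  2 * tau rho * (1 + beta * (2 * tau rho)) <= 6 * rho `^ (2 - alpha).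
Proof.
move=> rho1; have rho0 : 0 < rho by exact: lt_le_trans rho1.
have T1 : 1 <= tau rho by exact: le_trans (le_tau rho1).
have T0 := tau_gt0 rho0.
rewrite -tau_pow//; case: beta01 => bE; rewrite bE.
  by rewrite addr0 powRr1 ?(ltW T0)// mul0r addr0 mulr1; lra.
rewrite (_ : 1 + 1 = 2%:R)// powR_mulrn ?(ltW T0)// mul1r expr2; nra.
Qed.

Lemma is_derive_time_weight T n (t : R) : is_derive t 1 (W T n) (W T n.+1 t).
Proof.
have dn := is_derive_dilate (cutoff_derive cF) T.
have d1 : is_derive t 1 (fun t : R => 1 + beta * t) beta.
  have d2 : is_derive t 1 (fun t : R => beta * t) beta.
    by apply: is_derive_eq; rewrite /GRing.scale/= !(mulr1, mulr0, addr0).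
  by apply: (is_derive_eq (is_deriveD (is_derive_cst (1 : R) t (1 : R)) d2)); rewrite add0r.
apply: (is_derive_eq (is_deriveD (is_deriveM d1 (dn n t)) (is_deriveZ (n%:R * beta) (dn n.-1 t)))).
rewrite /time_weight /GRing.scale/=; case: n => [|n]/=.
  by rewrite [dilate F T 0 t * _]mulrC !mul0r addr0 mul1r.
by rewrite -[n.+2%:R]natr1; ring.
Qed.

Definition space_time_mass (u : R -> 'rV[R]_N -> R) (rho : R) : \bar R :=
  (\int[leb]_(t in `]0%R, (2 * tau rho)%R[) ((W (tau rho) 0 t)%:E * power_mass (u t) rho))%E.

(** The boundary terms of [solution_identity] at [t = 0], where the time weight
    has value 1 and derivative [beta]. *)
Definition data_pairing (f g : 'rV[R]_N -> R) (rho : R) : R :=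
  \int[mu]_x (g x * chi rho x) - beta * \int[mu]_x (f x * chi rho x)
  + \int[mu]_x (f x * (a0 * jbracket x `^ (- alpha) * chi rho x)).

Context (T : \bar R) (u v : R -> 'rV[R]_N -> R).
Hypothesis cu : continuous_H1 T u.
Hypothesis cv : continuous_L2 T v.
Hypothesis duv : derivative_L2 T u v.
Hypothesis weq : weak_equation T (damping a0 alpha beta) p u.

Lemma space_time_mass_identity rho : 0 < rho -> ((2 * tau rho)%:E < T)%E ->
  space_time_mass u rho =
  (\int[leb]_(t in `]0, 2 * tau rho[) (\int[mu]_x (u t x * test_error F a0 alpha beta rho (tau rho) t x))
   - data_pairing (u 0) (v 0) rho)%:E.
Proof.
move=> rho0 bT; have T0 := tau_gt0 rho0.
have k0 : 0 < rho ^- 2 by rewrite invr_gt0 exprn_gt0.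
have b0 : 0 < 2 * tau rho by rewrite mulr_gt0.
have Fout n t : (n <= 2)%N -> 2 * tau rho <= t -> dilate F (tau rho) n t = 0.
  move=> n2 bt; rewrite /dilate (cutoff_outside r0 cF)// ?mulr0//.
  rewrite (le_trans _ (ler_norm _))// mulrC ler_pdivlMr//.
have ce' : {within `[0, 2 * tau rho], continuous dilate F (tau rho) 1}.
  exact: within_continuous_derive (is_derive_dilate (cutoff_derive cF) _ 1).
rewrite /space_time_mass /power_mass.
apply: (etrans (solution_identity p1 alpha0 cu cv duv weq r0 cF k0 b0 bT
  (is_derive_time_weight (tau rho)) (is_derive_dilate (cutoff_derive cF) (tau rho) 0) ce' _ _ _ _ _)).
- move=> n t n2 bt; rewrite /time_weight !Fout ?mulr0 ?addr0//.
  by rewrite (leq_trans (leq_pred n)).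
- by move=> t bt; apply: Fout.
- by move=> t bt; apply: Fout.
- by move=> t t0; exact: time_weight_ge0.
- move=> t t1; have t1p : 0 < 1 + t by lra.
  rewrite time_weight0 /dilate expr0 mul1r; case: beta01 => ->.
    by rewrite oppr0 powRr0 mul0r addr0 !mul1r.
  by rewrite powR_inv1 ?(ltW t1p)// mul1r mulrA mulVf ?gt_eqF// mul1r.
congr (EFin (_ - _)).
have F00 : F 0 0 = 1 by rewrite (cutoff_eq1 cF)// normr0.
have F10 : F 1 0 = 0 by rewrite (cutoff_flat cF)// normr0.
rewrite time_weight0 /time_weight /dilate/= !mulr0 addr0 F00 F10 !expr0 !mulr0 !mulr1 add0r !mul1r.
by rewrite /data_pairing.
Qed.

(** The factor [4 ^+ N] is the measure of the box of half-width [2 rho], in units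
    of [rho ^+ N], and 6 comes from [tau_time_mass]. *)
Definition energy_const : R := 6 * 4 ^+ N * E `^ (p / (p - 1)).
Definition critical_gap : R := N%:R - alpha - 2 / (p - 1).

Lemma energy_const_gt0 : 0 < energy_const.
Proof.
have C0 := cutoff_const_gt0 cF.
rewrite /energy_const !mulr_gt0 ?exprn_gt0// powR_gt0//.
rewrite /error_const ltr_wpDr//; first by rewrite !mulr_ge0 ?powR_ge0// ltW.
by rewrite ltr_wpDr ?mulr_gt0// mulr_ge0 ?(ltW C0)// addr_ge0// mulr_ge0.
Qed.

Lemma young_const_mass (lam rho : R) : 1 <= rho ->
  young_const lam rho * (4 * rho) ^+ N * (6 * rho `^ (2 - alpha)) =
  energy_const * lam `^ (- (p - 1)^-1) * rho `^ critical_gap.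
Proof.
move=> rho1; have rho0 : 0 < rho by exact: lt_le_trans rho1.
have p10 : p - 1 != 0 by rewrite subr_eq0 gt_eqF.
rewrite /young_const powRM ?error_const_ge0 ?invr_ge0 ?exprn_ge0 ?(ltW rho0)//.
have -> : (rho ^- 2) `^ (p / (p - 1)) = rho `^ (- 2 * (p / (p - 1))).
  by rewrite [RHS]powRrM powRN powR_mulrn// ltW.
have -> : rho `^ critical_gap = rho `^ (- 2 * (p / (p - 1))) * rho ^+ N * rho `^ (2 - alpha).
  rewrite -powR_mulrn ?(ltW rho0)// -!powRD; try by apply/implyP => _; rewrite gt_eqF.
  by congr (_ `^ _); rewrite /critical_gap; field.
by rewrite /energy_const exprMn; ring.
Qed.

Lemma space_time_mass_half rho : 0 < rho ->
  space_time_mass u (rho / 2) =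
  (\int[leb]_(t in `]0%R, (2 * tau rho)%R[)
     ((W (tau (rho / 2)) 0 t)%:E * power_mass (u t) (rho / 2)))%E.
Proof.
move=> rho0; have rho20 : 0 < rho / 2 by rewrite divr_gt0.
have T0 := tau_gt0 rho0; have T20 := tau_gt0 rho20.
apply/esym; apply: (@integral_restrict R (2 * tau (rho / 2))).
- move=> t /=; rewrite !in_itv/= => /andP[-> /lt_le_trans]; apply.
  by rewrite (le_trans (tau_half rho0))// ler_peMl ?(ltW T0)// ler1n.
- by move=> t /=; rewrite in_itv/= => /andP[].
- move=> t bt; rewrite time_weight0 (cutoff_eq0 cF (s := (tau (rho / 2))^-1 * t)) ?mulr0 ?mul0e//.
  by rewrite (le_trans _ (ler_norm _))// mulrC ler_pdivlMr.
Qed.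

Lemma test_error_pairing_integrable rho b : 0 < rho -> (b%:E < T)%E ->
  leb.-integrable `]0, b[ (EFin \o (fun t =>
    \int[mu]_x (u t x * test_error F a0 alpha beta rho (tau rho) t x))).
Proof.
move=> rho0 bT; have k0 : 0 < rho ^- 2 by rewrite invr_gt0 exprn_gt0.
have cuL := continuous_H1_L2 cu.
have na : 0 <= - alpha by rewrite oppr_ge0.
have l1 := L2_radial (N := N) r0 cF k0.
have l2 := L2_laplace_radial (N := N) r0 cF k0.
have l3 := L2_damped_radial (N := N) r0 cF k0 a0 na.
pose G t := W (tau rho) 2 t * \int[mu]_x (u t x * chi rho x)
  - W (tau rho) 0 t * \int[mu]_x (u t x * laplace_radial F (rho ^- 2) x)
  - dilate F (tau rho) 1 t * \int[mu]_x (u t x * (a0 * jbracket x `^ (- alpha) * chi rho x)).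
have iG : leb.-integrable `]0, b[ (EFin \o G).
  have cc := L2_continuous_pairing bT cuL.
  have cW n : {within `[0, b], continuous (W (tau rho) n)}.
    exact: within_continuous_derive (is_derive_time_weight (tau rho) n).
  have cD : {within `[0, b], continuous (dilate F (tau rho) 1)}.
    exact: within_continuous_derive (is_derive_dilate (cutoff_derive cF) _ 1).
  apply: within_integrable.
  exact (within_continuousB (within_continuousB (within_continuousM (cW 2) (cc _ l1))
    (within_continuousM (cW 0) (cc _ l2))) (within_continuousM cD (cc _ l3))).
apply: eq_integrable iG => // t; rewrite inE /= in_itv/= => /andP[t0 tb].
have tT : time T t by apply: (itv_time bT); rewrite in_itv/= !ltW.
have [ut2 _] := cuL t tT.
by congr EFin; rewrite /G -L2_pairing_linear.
Qed.

Lemma time_weight_integral (D : R) rho : 0 <= D -> 1 <= rho ->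
  (\int[leb]_(t in `]0%R, (2 * tau rho)%R[) ((1 + beta * t) * D)%:E <=
   (D * (6 * rho `^ (2 - alpha)))%:E)%E.
Proof.
move=> D0 rho1; have rho0 : 0 < rho by exact: lt_le_trans rho1.
have T0 := tau_gt0 rho0.
have b0 : 0 < 2 * tau rho by rewrite mulr_gt0.
have M0 : 0 <= (1 + beta * (2 * tau rho)) * D by rewrite mulr_ge0// addr_ge0// mulr_ge0// ltW.
apply: (@le_trans _ _ (\int[leb]_(t in `]0%R, (2 * tau rho)%R[)
    (cst ((1 + beta * (2 * tau rho)) * D)%:E t))%E).
  apply: ge0_le_integral => //.
  - move=> t /=; rewrite in_itv/= => /andP[t0 _]; rewrite lee_fin mulr_ge0// addr_ge0// mulr_ge0//.
    exact: ltW.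
  - apply/measurable_EFinP; apply: measurable_funM => //; exact: measurable_funD.
  - move=> t /=; rewrite in_itv/= => /andP[t0 tb]; rewrite lee_fin ler_wpM2r// lerD2l ler_wpM2l//.
    exact: ltW.
rewrite integral_cst//= lebesgue_measure_itv/= lte_fin b0 sube0 -EFinM lee_fin.
have := tau_time_mass rho1; have := D0; set x := rho `^ _; nra.
Qed.

(** Integration in time of [energy_at_time].  The parameter [lam] is kept free:
    its choice is what separates the subcritical and the critical case. *)
Lemma energy_inequality (lam rho : R) : 1 <= rho -> ((2 * tau rho)%:E < T)%E -> 0 < lam ->
  fine (space_time_mass u rho) + data_pairing (u 0) (v 0) rho
    + lam * fine (space_time_mass u (rho / 2)) <=
  lam * fine (space_time_mass u rho)
    + energy_const * lam `^ (- (p - 1)^-1) * rho `^ critical_gap.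
Proof.
move=> rho1 bT lam0; have rho0 : 0 < rho by exact: lt_le_trans rho1.
have rho20 : 0 < rho / 2 by rewrite divr_gt0.
have T0 := tau_gt0 rho0; have T20 := tau_gt0 rho20.
pose b := 2 * tau rho; have b0 : 0 < b by rewrite mulr_gt0.
have b2T : ((2 * tau (rho / 2))%:E < T)%E.
  apply: le_lt_trans bT; rewrite lee_fin (le_trans (tau_half rho0))//.
  by rewrite ler_peMl ?(ltW T0)// ler1n.
have cuL := continuous_H1_L2 cu.
have timeT (t : R) : 0 < t -> t < b -> time T t.
  by move=> t0 tb; apply: (itv_time bT); rewrite in_itv/= !ltW.
have k0 (s : R) : 0 < s -> 0 < s ^- 2 by move=> s0; rewrite invr_gt0 exprn_gt0.
pose J (t : R) := \int[mu]_x (u t x * test_error F a0 alpha beta rho (tau rho) t x).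
pose D : R := young_const lam rho * (4 * rho) ^+ N.
have D0 : 0 <= D.
  apply: mulr_ge0; first exact: mulr_ge0 (powR_ge0 _ _) (powR_ge0 _ _).
  by rewrite exprn_ge0// mulr_ge0// ltW.
have cJ : leb.-integrable `]0, b[ (EFin \o J) by exact: test_error_pairing_integrable.
have mW (S : R) : measurable_fun `]0, b[ (fun t => (W S 0 t)%:E).
  apply: (measurable_int leb); apply: within_integrable.
  exact: within_continuous_derive (is_derive_time_weight S 0).
have mP (s : R) : 0 < s -> measurable_fun `]0, b[ (fun t => power_mass (u t) s).
  move=> s0; apply: (measurable_power_integral p1 bT cuL (L2_radial r0 cF (k0 _ s0))) => x.
  exact: chi_ge0.
pose g (S s t : R) := (lam%:E * ((W S 0 t)%:E * power_mass (u t) s))%E.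
have g0 (S s t : R) : `]0, b[%classic t -> (0 <= g S s t)%E.
  rewrite /= in_itv/= => /andP[t0 _]; rewrite /g mule_ge0 ?lee_fin ?(ltW lam0)//.
  by rewrite mule_ge0 ?power_mass_ge0// lee_fin time_weight_ge0// ltW.
have mg (S s : R) : 0 < s -> measurable_fun `]0, b[ (g S s).
  move=> s0; apply: emeasurable_funM; first exact: measurable_cst.
  by apply: emeasurable_funM; [exact: mW|exact: mP].
pose j (t : R) := (Num.max (J t) 0)%:E.
have j0 (t : R) : `]0, b[%classic t -> (0 <= j t)%E by move=> _; rewrite lee_fin le_max lexx orbT.
have mj : measurable_fun `]0, b[ j.
  apply/measurable_EFinP; apply: measurable_maxr => //.
  by have /measurable_EFinP := measurable_int _ cJ.
pose d (t : R) := ((1 + beta * t) * D)%:E.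
have d0 (t : R) : `]0, b[%classic t -> (0 <= d t)%E.
  rewrite /= in_itv/= => /andP[t0 _]; rewrite lee_fin mulr_ge0// addr_ge0// mulr_ge0//.
  exact: ltW.
have md : measurable_fun `]0, b[ d.
  by apply/measurable_EFinP; apply: measurable_funM => //; exact: measurable_funD.
have key : (\int[leb]_(t in `]0%R, b[) j t + \int[leb]_(t in `]0%R, b[) g (tau (rho / 2)%R) (rho / 2)%R t <=
   \int[leb]_(t in `]0%R, b[) g (tau rho) rho t + \int[leb]_(t in `]0%R, b[) d t)%E.
  have mI : measurable (`]0, b[%classic : set R) by exact: measurable_itv.
  have S1 := @ge0_integralD _ _ _ leb _ mI _ _ j0 mj (g0 _ _) (mg (tau (rho / 2)) _ rho20).
  have S2 := @ge0_integralD _ _ _ leb _ mI _ _ (g0 _ _) (mg (tau rho) _ rho0) d0 md.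
  rewrite -[X in (X <= _)%E]S1 -[X in (_ <= X)%E]S2.
  apply: ge0_le_integral => //.
  - by move=> t tb; rewrite adde_ge0 ?j0 ?g0.
  - by apply: emeasurable_funD => //; exact: mg.
  - by apply: emeasurable_funD => //; exact: mg.
  - move=> t /=; rewrite in_itv/= => /andP[t0 tb].
    have [ut2 _] := cuL t (timeT t t0 tb).
    apply: energy_at_time => //.
    + exact: le_tau.
    + exact: tau_half.
    + exact: ltW.
    + by move=> tt; exact: tau_rate.
have massK (s : R) : 0 < s -> ((2 * tau s)%:E < T)%E -> ((fine (space_time_mass u s))%:E = space_time_mass u s)%E.
  by move=> s0 sT; rewrite fineK// space_time_mass_identity.
have gE (S s : R) : 0 < s -> (\int[leb]_(t in `]0%R, b[) g S s t = lam%:E * \int[leb]_(t in `]0%R, b[) ((W S 0 t)%:E * power_mass (u t) s))%E.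
  move=> s0; rewrite /g ge0_integralZl//.
  - by apply: emeasurable_funM; [exact: mW|exact: mP].
  - move=> t; rewrite /= in_itv/= => /andP[t0 _].
    by rewrite mule_ge0 ?power_mass_ge0// lee_fin time_weight_ge0// ltW.
  - by rewrite lee_fin ltW.
have dE : (\int[leb]_(t in `]0%R, b[) d t <=
    (energy_const * lam `^ (- (p - 1)^-1) * rho `^ critical_gap)%:E)%E.
  rewrite -young_const_mass//; exact: time_weight_integral.
have jE : ((fine (space_time_mass u rho) + data_pairing (u 0) (v 0) rho)%:E <=
    \int[leb]_(t in `]0%R, b[) j t)%E.
  rewrite space_time_mass_identity//= subrK -/b.
  have -> : ((\int[leb]_(t in `]0, b[) J t)%:E = \int[leb]_(t in `]0%R, b[) (EFin \o J) t)%E.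
    by rewrite /Rintegral fineK//; apply: integrable_fin_num.
  rewrite integralE; apply: (@le_trans _ _ (\int[leb]_(t in `]0%R, b[) (EFin \o J)^\+ t)%E).
    by apply: geeDl; rewrite leeNl oppe0; apply: integral_ge0 => t _; exact: funeneg_ge0.
  rewrite le_eqVlt; apply/orP; left; apply/eqP; apply: eq_integral => t _.
  by rewrite funeposE /j /= EFin_max.
have mulE (m : R) (z : \bar R) : (m%:E = z -> lam%:E * z = (lam * m)%:E)%E by move=> <-.
have gE1 : (\int[leb]_(t in `]0%R, b[) g (tau (rho / 2)%R) (rho / 2)%R t =
    (lam * fine (space_time_mass u (rho / 2)))%:E)%E.
  apply: (etrans (gE _ _ rho20)); apply: mulE.
  exact: (etrans (massK _ rho20 b2T) (space_time_mass_half rho0)).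
have gE2 : (\int[leb]_(t in `]0%R, b[) g (tau rho) rho t =
    (lam * fine (space_time_mass u rho))%:E)%E.
  apply: (etrans (gE _ _ rho0)); apply: mulE; exact: massK rho0 bT.
rewrite {}gE1 {}gE2 in key.
move: (le_trans (leeD2r _ jE) (le_trans key (leeD2l _ dE))).
by rewrite -!EFinD lee_fin.
Qed.
End energy.

(** * The initial data *)
Section initial_data.
Context {R : realType} {N : nat}.
Local Notation mu := (@lebesgue_rV R N).

Lemma ae_eq_Rintegral (f g : 'rV[R]_N -> R) : measurable_fun setT f -> measurable_fun setT g ->
  {ae mu, forall x, f x = g x} -> \int[mu]_x f x = \int[mu]_x g x.
Proof.
move=> mf mg fg; rewrite /Rintegral; congr fine; apply: ae_eq_integral => //.
- exact/measurable_EFinP.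
- exact/measurable_EFinP.
- by apply: filterS fg => x -> _.
Qed.

(** The data are supported where the cutoff is equal to 1. *)
Lemma data_pairing_eq (r C : R) (F : nat -> R -> R) (a0 alpha beta R0 rho eps : R)
    (f g u0 u1 : 'rV[R]_N -> R) : 0 < r -> cutoff r F C ->
  alpha <= 0 -> 0 < eps -> 0 < rho -> R0 <= rho ->
  f \in L2 -> g \in L2 -> u0 \in L2 -> u1 \in L2 ->
  {ae mu, forall x, f x = eps * u0 x} -> {ae mu, forall x, g x = eps * u1 x} ->
  {ae mu, forall x, R0 < enorm x -> u0 x = 0} -> {ae mu, forall x, R0 < enorm x -> u1 x = 0} ->
  data_pairing F a0 alpha beta f g rho =
  eps * \int[mu]_x (u1 x + (a0 * jbracket x `^ (- alpha) - beta) * u0 x).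
Proof.
move=> r0 cF alpha0 eps0 rho0 R0rho f2 g2 u02 u12 fE gE s0 s1.
have k0 : 0 < rho ^- 2 by rewrite invr_gt0 exprn_gt0.
have na : 0 <= - alpha by rewrite oppr_ge0.
pose chi : 'rV[R]_N -> R := radial F (rho ^- 2) 0.
pose kap (x : 'rV[R]_N) := a0 * jbracket x `^ (- alpha) * chi x.
have c2 : chi \in L2 := L2_radial r0 cF k0.
have k2 : kap \in L2 := L2_damped_radial r0 cF k0 a0 na.
have I1 := L2_mul_integrable g2 c2.
have I2 := L2_mul_integrable f2 c2.
have I3 := L2_mul_integrable f2 k2.
pose H x := g x * chi x - beta * (f x * chi x) + f x * kap x.
have I2' : mu.-integrable setT (EFin \o (fun x => beta * (f x * chi x))).
  by apply: (integrableZl measurableT beta) I2.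
have I12 : mu.-integrable setT (EFin \o (fun x => g x * chi x - beta * (f x * chi x))).
  exact: (integrableB measurableT I1 I2').
have IH : mu.-integrable setT (EFin \o H) by exact: (integrableD measurableT I12 I3).
have HE : \int[mu]_x H x = data_pairing F a0 alpha beta f g rho.
  by rewrite RintegralD// RintegralB// RintegralZl.
have mjb : measurable_fun setT (fun x : 'rV[R]_N => jbracket x `^ (- alpha)).
  under eq_fun do rewrite jbracketE.
  apply: (measurableT_comp (measurable_powR _)).
  by apply: measurable_funD => //; exact: measurable_sqnorm.
rewrite (ae_eq_Rintegral (g := fun x => eps^-1 * H x)).
- by rewrite RintegralZl// HE mulVKf ?gt_eqF.
- have mu1 := L2_measurable u12; have mu0 := L2_measurable u02.
  by apply: measurable_funD => //; apply: measurable_funM => //;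
    apply: measurable_funB => //; exact: measurable_funM.
- apply: measurable_funM => //; apply/measurable_EFinP; exact: measurable_int IH.
apply: filterS2 (filterI fE gE) (filterI s0 s1) => x [fx gx] [z0 z1].
rewrite /H /kap /chi /radial.
have [xR|xR] := leP (enorm x) R0; last first.
  by rewrite fx gx z0// z1// !(mulr0, mul0r, addr0, subr0).
have -> : F 0 (rho ^- 2 * sqnorm x) = 1.
  apply: (cutoff_eq1 cF); have s_ge0 := sqnorm_ge0 x.
  rewrite ger0_norm ?mulr_ge0 ?(ltW k0)// mulrC ler_pdivrMr ?exprn_gt0// mul1r -enormE.
  by rewrite lerXn2r ?nnegrE ?sqrtr_ge0 ?(ltW rho0)// (le_trans xR).
by rewrite fx gx; field; rewrite gt_eqF.
Qed.
End initial_data.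

(** * Superlinear growth *)
Lemma power_of_one_minus_le {R : realType} (q y : R) : 0 < q -> 0 <= y -> y < 1 ->
  (1 - y) `^ q * (1 + q * y) <= 1.
Proof.
move=> q0 y0 y1.
have h1 : (1 - y) `^ q <= expR (- (q * y)).
  rewrite -mulrN mulrC expRM; apply: ge0_ler_powR; rewrite ?nnegrE ?(ltW q0) ?expR_ge0//.
  - by rewrite subr_ge0 ltW.
  - exact: expR_ge1Dx.
apply: (@le_trans _ _ (expR (- (q * y)) * expR (q * y))).
  apply: ler_pM => //; first exact: powR_ge0.
    by rewrite addr_ge0// mulr_ge0// ltW.
  exact: expR_ge1Dx.
by rewrite -expRD addNr expR0.
Qed.

(** With [lam = (2 K / z') `^ q] the hypothesis reads [z <= z' (1 - y)] with
    [y = z' `^ q / (2 (2 K) `^ q)].  This is a discrete form of [dz/dj >= c z^(1+q)],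
    whose solutions satisfy [d(z^-q)/dj <= - q c]. *)
Lemma superlinear_growth_step {R : realType} (K q z z' : R) : 0 < K -> 0 < q -> 0 < z -> 0 < z' ->
  (forall lam : R, 0 < lam -> z' + lam * z <= lam * z' + K * lam `^ (- q^-1)) ->
  z' `^ (- q) + q / (2 * (2 * K) `^ q) <= z `^ (- q).
Proof.
move=> K0 q0 z0 z'0 h.
have K20 : 0 < 2 * K by rewrite mulr_gt0.
have lam0 : 0 < (2 * K / z') `^ q by rewrite powR_gt0// divr_gt0.
pose c := (2 * (2 * K) `^ q)^-1; have c0 : 0 < c by rewrite invr_gt0 mulr_gt0// powR_gt0.
have zq : 0 < z' `^ q by rewrite powR_gt0.
pose y := c * z' `^ q; have y0 : 0 < y by rewrite mulr_gt0.
have yE : ((2 * K / z') `^ q)^-1 = 2 * y.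
  rewrite powRM ?(ltW K20) ?invr_ge0 ?(ltW z'0)// -(powR_inv1 (ltW z'0)) -powRrM mulN1r powRN.
  by rewrite /y /c; field; rewrite !gt_eqF// powR_gt0.
have zE : z <= z' * (1 - y).
  have := h _ lam0; rewrite -powRrM mulrN mulfV ?gt_eqF// powR_inv1 ?divr_ge0 ?(ltW K20) ?(ltW z'0)//.
  have -> : K * (2 * K / z')^-1 = z' / 2 by field; rewrite !gt_eqF.
  set L := _ `^ q; have Ly : L * (2 * y) = 1 by rewrite -yE mulfV// gt_eqF.
  rewrite -[in X in _ -> X](ler_pM2l lam0) -/L.
  have -> : L * (z' * (1 - y)) = L * z' - z' / 2 * (L * (2 * y)) by field.
  rewrite Ly; lra.
have y1 : y < 1.
  rewrite ltNge; apply/negP => y1; have : z <= 0.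
    by rewrite (le_trans zE)// mulr_ge0_le0 ?(ltW z'0)// subr_le0.
  by rewrite leNgt z0.
have zq' : z `^ q <= z' `^ q * (1 - y) `^ q.
  rewrite -powRM ?(ltW z'0) ?subr_ge0 ?(ltW y1)//.
  by apply: ge0_ler_powR; rewrite ?nnegrE ?(ltW q0) ?(ltW z0)// mulr_ge0 ?subr_ge0 ?ltW.
have h2 := power_of_one_minus_le q0 (ltW y0) y1.
have zq0 : 0 < z `^ q by rewrite powR_gt0.
rewrite !powRN -[leRHS]mul1r ler_pdivlMr//.
apply: le_trans (_ : (z' `^ q)^-1 * (1 + q * y) * (z' `^ q * (1 - y) `^ q) <= _).
  have -> : (z' `^ q)^-1 + q / (2 * (2 * K) `^ q) = (z' `^ q)^-1 * (1 + q * y).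
    by rewrite mulrDr mulr1 /y -/c mulrCA [c * _]mulrC mulKf ?gt_eqF.
  by rewrite ler_wpM2l// mulr_ge0 ?invr_ge0 ?(ltW zq)// addr_ge0// mulr_ge0// ltW.
by rewrite mulrACA mulVf ?gt_eqF// mul1r mulrC.
Qed.

Lemma superlinear_growth {R : realType} (K q m : R) (z : nat -> R) n :
  0 < K -> 0 < q -> 0 < m -> (forall j, (j <= n)%N -> m <= z j) ->
  (forall j (lam : R), (j < n)%N -> 0 < lam ->
    z j.+1 + lam * z j <= lam * z j.+1 + K * lam `^ (- q^-1)) ->
  n%:R * (q / (2 * (2 * K) `^ q)) <= m `^ (- q).
Proof.
move=> K0 q0 m0 zm hz; set c := q / _.
have z0 j : (j <= n)%N -> 0 < z j by move=> jn; exact: lt_le_trans (zm j jn).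
have H j : (j <= n)%N -> z j `^ (- q) + j%:R * c <= z 0%N `^ (- q).
  elim: j => [|j ih] jn; first by rewrite mul0r addr0.
  apply: le_trans (ih (ltnW jn)).
  rewrite -natr1 mulrDl mul1r [_ * c + c]addrC addrA lerD2r.
  by apply: superlinear_growth_step; rewrite ?z0// ?(ltnW jn)// => lam; exact: hz.
have := H n (leqnn n); have := powR_ge0 (z n) (- q).
have : z 0%N `^ (- q) <= m `^ (- q).
  rewrite !powRN lef_pV2 ?posrE ?powR_gt0 ?z0//.
  by apply: ge0_ler_powR; rewrite ?nnegrE ?(ltW q0) ?(ltW m0) ?(ltW (z0 _ _))// zm.
lra.
Qed.

(** * Bounds on the lifespan *)
Section lifespan_bounds.
Context {R : realType} {N : nat}.
Local Notation mu := (@lebesgue_rV R N).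
Context (p C a0 alpha beta R0 : R) (F : nat -> R -> R) (u0 u1 : 'rV[R]_N -> R).
Hypotheses (p1 : 1 < p) (cF : cutoff p^-1 F C) (a0_ge0 : 0 <= a0).
Hypotheses (alpha_lt0 : alpha < 0) (beta01 : beta = 0 \/ beta = 1).
Hypotheses (u02 : u0 \in L2) (u12 : u1 \in L2).
Hypothesis s0 : {ae mu, forall x, R0 < enorm x -> u0 x = 0}.
Hypothesis s1 : {ae mu, forall x, R0 < enorm x -> u1 x = 0}.

Local Notation K := (@energy_const R N p C a0 alpha).
Local Notation gap := (@critical_gap R N p alpha).
Local Notation rho0 := (Num.max 1 R0).
Local Notation I := (\int[mu]_x (u1 x + (a0 * jbracket x `^ (- alpha) - beta) * u0 x)).

Let beta0 : 0 <= beta. Proof. by case: beta01 => ->. Qed.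
Let alpha0 : alpha <= 0. Proof. exact: ltW. Qed.
Let rho0_ge1 : 1 <= rho0. Proof. by rewrite le_max lexx. Qed.

Section solution.
Context (T : \bar R) (eps : R) (eps0 : 0 < eps) (u : R -> 'rV[R]_N -> R).
Hypothesis su : solution T (damping a0 alpha beta) p
  (fun x => eps * u0 x) (fun x => eps * u1 x) u.
Local Notation mass := (fun rho => fine (space_time_mass p F alpha beta u rho)).

Let mass_ge0 rho : 0 <= mass rho.
Proof.
apply: fine_ge0; apply: integral_ge0 => t; rewrite /= in_itv/= => /andP[t0 _].
apply: mule_ge0; last exact: (power_mass_ge0 cF).
rewrite lee_fin; apply: (time_weight_ge0 cF beta0); exact: ltW.
Qed.

Lemma mass_growth (rho lam : R) : rho0 <= rho -> ((2 * tau alpha beta rho)%:E < T)%E -> 0 < lam ->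
  mass rho + eps * I + lam * mass (rho / 2) <=
  lam * mass rho + K * lam `^ (- (p - 1)^-1) * rho `^ gap.
Proof.
move=> rhoR bT lam0; have [v [cu cv duv weq [u0E v0E]]] := su.
have rho1 : 1 <= rho by exact: le_trans rhoR.
have rhoR0 : R0 <= rho by apply: le_trans rhoR; rewrite le_max lexx orbT.
have rho_gt0 : 0 < rho by exact: lt_le_trans rho1.
have T0 : time T 0.
  split => //; apply: le_lt_trans bT; rewrite lee_fin mulr_ge0// powR_ge0//.
have := energy_inequality p1 cF a0_ge0 alpha0 beta0 alpha_lt0 beta01 cu cv duv weq rho1 bT lam0.
have pV0 : 0 < p^-1 by rewrite invr_gt0 (lt_trans ltr01).
have [ut2 _] := continuous_H1_L2 cu T0; have [vt2 _] := cv _ T0.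
by rewrite (data_pairing_eq a0 beta pV0 cF alpha0 eps0 rho_gt0 rhoR0 ut2 vt2 u02 u12 u0E v0E s0 s1).
Qed.

Lemma subcritical_bound rho : rho0 <= rho -> ((2 * tau alpha beta rho)%:E < T)%E ->
  eps * I <= K * rho `^ gap.
Proof.
move=> rhoR bT; have drop (m m' e k l g : R) : 0 <= m' -> l = 1 ->
    m + e + 1 * m' <= 1 * m + k * l * g -> e <= k * g.
  by move=> m'0 ->; rewrite mulr1 !mul1r; lra.
have l1 : (1 : R) `^ (- (p - 1)^-1) = 1 by rewrite powR1.
exact (drop _ _ _ _ _ _ (mass_ge0 (rho / 2)) l1 (mass_growth rhoR bT (ltr01 : (0 : R) < 1))).
Qed.

(** The inequality is iterated along [rho = 2 ^+ j * rho0]. *)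
Lemma critical_bound n : gap = 0 -> 0 < eps * I ->
  ((2 * tau alpha beta (2 ^+ n * rho0))%:E < T)%E ->
  n%:R * ((p - 1) / (2 * (2 * K) `^ (p - 1))) <= (eps * I) `^ (- (p - 1)).
Proof.
move=> gap0 I0 bT; have p10 : 0 < p - 1 by rewrite subr_gt0.
apply: (@superlinear_growth _ _ _ _ (fun j => mass (2 ^+ j * rho0) + eps * I)) => //.
- exact: (energy_const_gt0 cF).
- by move=> j _; rewrite lerDr mass_ge0.
- move=> j lam jn lam0; have rho0_gt0 : 0 < rho0 by exact: lt_le_trans rho0_ge1.
  have rhoR : rho0 <= 2 ^+ j.+1 * rho0.
    by rewrite ler_peMl ?(ltW rho0_gt0)// exprn_ege1// ler1n.
  have bT' : ((2 * tau alpha beta (2 ^+ j.+1 * rho0))%:E < T)%E.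
    apply: le_lt_trans bT; rewrite lee_fin ler_wpM2l//.
    have k1 := kappa_gt1 beta0 alpha_lt0 beta01.
    have p2 m : 2 ^+ m * rho0 \is Num.nneg.
      by rewrite nnegrE mulr_ge0 ?exprn_ge0 ?(ltW rho0_gt0).
    apply: ge0_ler_powR => //.
      exact: le_trans (ltW k1).
    by rewrite ler_wpM2r ?(ltW rho0_gt0)// ler_weXn2l// ler1n.
  have add (m m' e k l g : R) : g = 1 ->
      m + e + lam * m' <= lam * m + k * l * g ->
      m + e + lam * (m' + e) <= lam * (m + e) + k * l.
    by move=> ->; rewrite mulr1 !mulrDr; lra.
  have halfE : 2 ^+ j.+1 * rho0 / 2 = 2 ^+ j * rho0.
    by rewrite exprS; move: (2 ^+ j) rho0 => a b; field.
  have g1 : (2 ^+ j.+1 * rho0) `^ gap = 1 by rewrite gap0 powRr0.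
  have := mass_growth rhoR bT' lam0; rewrite halfE; exact: add g1.
Qed.
End solution.
Hypothesis I0 : 0 < I.

Let K0 : 0 < K. Proof. exact: (energy_const_gt0 cF). Qed.
Let rho0_gt0 : 0 < rho0. Proof. exact: lt_le_trans rho0_ge1. Qed.
Let kappa0 : 0 < kappa alpha beta.
Proof. exact: lt_trans ltr01 (kappa_gt1 beta0 alpha_lt0 beta01). Qed.

Lemma lifespan_le (c : R -> 'rV[R]_N -> R) (f g : 'rV[R]_N -> R) (B : R) :
  (forall T u, solution T c p f g u -> (B%:E < T)%E -> False) ->
  (lifespan c p f g <= B%:E)%E.
Proof.
move=> h; apply: ge_ereal_sup => T [_ [u su _]].
by rewrite leNgt; apply/negP => /(h T u su).
Qed.

(** At [rho `^ gap = eps I / (2 K)] the inequality [eps I <= K rho `^ gap] fails.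
    This [rho] is at least [max(1, R0)] once [eps] is small. *)
Lemma subcritical_lifespan : gap < 0 ->
  exists eps1 B : R, [/\ 0 < eps1, 0 < B & forall eps : R, 0 < eps <= eps1 ->
    (lifespan (damping a0 alpha beta) p (fun x => eps * u0 x)%R (fun x => eps * u1 x)%R
      <= (B * eps `^ (- (kappa alpha beta / - gap)))%:E)%E].
Proof.
set g := gap => g_lt0; have ng : 0 < - g by rewrite oppr_gt0.
have ng0 : - g != 0 by rewrite gt_eqF.
pose K' := 2 * K / I; have K'0 : 0 < K' by rewrite divr_gt0// mulr_gt0.
exists (K' * rho0 `^ g), (2 * K' `^ (kappa alpha beta / - g)); split.
- by rewrite mulr_gt0// powR_gt0.
- by rewrite mulr_gt0// powR_gt0.
move=> eps /andP[eps0 eps1]; apply: lifespan_le => T u su BT.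
have Ke0 : 0 < K' / eps by rewrite divr_gt0.
pose rho := (K' / eps) `^ (- g)^-1.
have rhoR : rho0 <= rho.
  have -> : rho0 = (rho0 `^ (- g)) `^ (- g)^-1.
    by rewrite -powRrM mulfV// powRr1// ltW.
  apply: ge0_ler_powR; rewrite ?nnegrE ?powR_ge0 ?invr_ge0 ?(ltW ng) ?(ltW Ke0)//.
  by rewrite powRN ler_pdivlMr// mulrC ler_pdivrMr ?powR_gt0.
have tauE : 2 * tau alpha beta rho = 2 * K' `^ (kappa alpha beta / - g) * eps `^ (- (kappa alpha beta / - g)).
  rewrite /tau /rho -powRrM -mulrA; congr (_ * _).
  rewrite [_^-1 * _]mulrC powRM ?(ltW K'0) ?invr_ge0 ?(ltW eps0)//; congr (_ * _).
  by rewrite -(powR_inv1 (ltW eps0)) -powRrM mulN1r.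
rewrite -tauE in BT.
have rhog : rho `^ g = eps / K'.
  rewrite /rho -powRrM invrN mulNr mulVf ?lt_eqF// powR_inv1 ?(ltW Ke0)//.
  by rewrite invfM invrK mulrC.
have absurd (k i : R) : 0 < k -> 0 < i -> eps * i <= k * (eps / (2 * k / i)) -> False.
  move=> k_gt0 i_gt0; have -> : k * (eps / (2 * k / i)) = eps * i / 2 by field; rewrite !gt_eqF.
  have : 0 < eps * i by rewrite mulr_gt0.
  lra.
by apply: (absurd _ _ K0 I0); have := subcritical_bound eps0 su rhoR BT; rewrite rhog.
Qed.

(** Take one doubling more than [critical_bound] allows. *)
Lemma critical_lifespan : gap = 0 ->
  exists B : R, 0 < B /\ forall eps : R, 0 < eps <= 1 ->
    (lifespan (damping a0 alpha beta) p (fun x => eps * u0 x)%R (fun x => eps * u1 x)%R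
      <= (expR (B * eps `^ (- (p - 1))))%:E)%E.
Proof.
move=> gap0; set q := p - 1; have q0 : 0 < q by rewrite subr_gt0.
pose d := q / (2 * (2 * K) `^ q).
have d0 : 0 < d by rewrite divr_gt0// mulr_gt0// powR_gt0// mulr_gt0.
pose A := I `^ (- q) / d; have A0 : 0 < A by rewrite divr_gt0// powR_gt0.
pose L := ln (2 * rho0 `^ kappa alpha beta).
pose k2 := kappa alpha beta * ln 2.
have k20 : 0 < k2 by rewrite mulr_gt0// ln_gt0// ltr1n.
have R1 : 1 <= rho0 `^ kappa alpha beta.
  have := rho0_ge1; move: rho0 => s sge1; rewrite -[leLHS](powRr0 s) ler_powR// ltW//.
have L0 : 0 <= L.
  rewrite ln_ge0//; lra.
exists (L + k2 * (A + 1)); split.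
  by rewrite ltr_wpDl// mulr_gt0// addr_gt0.
move=> eps /andP[eps0 eps1]; apply: lifespan_le => T u su BT.
set e := eps `^ (- q) in BT *.
have e1 : 1 <= e.
  rewrite /e powRN invf_ge1 ?powR_gt0//.
  rewrite -(powRr0 eps); apply: ger_powR; rewrite ?eps0//; exact: ltW.
have Ae0 : 0 <= A * e by rewrite mulr_ge0// ?(ltW A0)// (le_trans _ e1).
pose n := (Num.truncn (A * e)).+1.
have nA : A * e < n%:R by rewrite truncnS_gt.
have nA1 : n%:R <= A * e + 1 by rewrite -natr1 lerD2r truncn_le.
have bT : ((2 * tau alpha beta (2 ^+ n * rho0))%:E < T)%E.
  apply: le_lt_trans BT; rewrite lee_fin /tau powRM ?exprn_ge0 ?(ltW rho0_gt0)//.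
  have -> : (2 ^+ n) `^ kappa alpha beta = expR (n%:R * k2) :> R.
    rewrite -powR_mulrn// -powRrM /powR (gt_eqF (ltr0n _ 2)); congr expR.
    by rewrite /k2; ring.
  rewrite mulrCA -(lnK (x := 2 * rho0 `^ kappa alpha beta)); last first.
    by rewrite posrE mulr_gt0// (lt_le_trans ltr01).
  rewrite -/L -expRD ler_expR; nra.
have := critical_bound eps0 su gap0 (mulr_gt0 eps0 I0) bT.
rewrite -/q -/d powRM ?(ltW eps0) ?(ltW I0)// -/e.
have -> : e * I `^ (- q) = A * e * d by rewrite /A; field; rewrite gt_eqF.
by rewrite leNgt ltr_pM2r// nA.
Qed.
End lifespan_bounds.

Theorem theorem1p4 (R : realType) (N : nat) (p a0 alpha beta R0 : R)
    (u0 u1 : 'rV[R]_N -> R)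
    (hN : (1 <= N)%N)
    (ha0 : 0 < a0)
    (hab : (alpha < 0 /\ beta = 0) \/ (alpha < 0 /\ beta = 1))
    (hp : 1 < p <= 1 + 2 / (N%:R - alpha))
    (hR0 : 0 < R0)
    (hu0 : H1 u0)
    (hu1 : u1 \in L2)
    (supp_u0 : {ae lebesgue_rV N, forall x, R0 < enorm x -> u0 x = 0})
    (supp_u1 : {ae lebesgue_rV N, forall x, R0 < enorm x -> u1 x = 0})
    (hpos : 0 < \int[lebesgue_rV N]_x
      (u1 x + (a0 * jbracket x `^ (- alpha) - beta) * u0 x)) :
  exists eps1 C : R, [/\ 0 < eps1, 0 < C &
    forall eps : R, 0 < eps <= eps1 ->
      let T := lifespan (damping a0 alpha beta) p
                 (fun x => eps * u0 x) (fun x => eps * u1 x) in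
      (p < 1 + 2 / (N%:R - alpha) ->
        (T <= (C * eps `^ (- ((2 - alpha) / (2 * (1 + beta)) *
                 ((p - 1)^-1 - (N%:R - alpha) / 2)^-1)))%:E)%E) /\
      (p = 1 + 2 / (N%:R - alpha) ->
        (T <= (expR (C * eps `^ (- (p - 1))))%:E)%E)].
Proof.
have [p1 pc] := andP hp.
have alpha_lt0 : alpha < 0 by case: hab => -[].
have beta01 : beta = 0 \/ beta = 1 by case: hab => -[_ ->]; [left|right].
have Na : 0 < N%:R - alpha by rewrite subr_gt0 (lt_le_trans alpha_lt0).
have p10 : 0 < p - 1 by rewrite subr_gt0.
have [u02 _] := hu0.
have r01 : 0 < p^-1 < 1 by rewrite invr_gt0 invf_lt1 (lt_trans ltr01 p1)/=.
have [F [C cF]] := smooth_cutoff r01.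
have [psub|pcrit] := ltP p (1 + 2 / (N%:R - alpha)).
  have g0 : @critical_gap R N p alpha < 0.
    by rewrite /critical_gap subr_lt0 ltr_pdivlMr// mulrC -ltr_pdivlMr// ltrBlDl.
  have [e1 [B [e10 B0 h]]] := subcritical_lifespan p1 cF (ltW ha0) alpha_lt0 beta01
    u02 hu1 supp_u0 supp_u1 hpos g0.
  exists e1, B; split=> // eps epsP; split=> [_|pE]; last by rewrite pE ltxx in psub.
  suff -> : (2 - alpha) / (2 * (1 + beta)) * ((p - 1)^-1 - (N%:R - alpha) / 2)^-1 =
    kappa alpha beta / - @critical_gap R N p alpha by exact: h.
  have gn0 : (p - 1)^-1 - (N%:R - alpha) / 2 != 0.
    rewrite gt_eqF// subr_gt0 ltr_pdivrMr// mulrC.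
    by have := g0; rewrite /critical_gap subr_lt0.
  have -> : - @critical_gap R N p alpha = 2 * ((p - 1)^-1 - (N%:R - alpha) / 2).
    by rewrite /critical_gap; field; rewrite gt_eqF.
  rewrite /kappa; move: (_ - _ / 2) gn0 => g gn0; field.
  by rewrite gn0/=; case: beta01 => ->; rewrite ?addr0 ?pnatr_eq0 ?oner_eq0//.
have pE : p = 1 + 2 / (N%:R - alpha) by apply/eqP; rewrite eq_le pc pcrit.
have g0 : @critical_gap R N p alpha = 0.
  have pE1 : p - 1 = 2 / (N%:R - alpha) by rewrite [in LHS]pE addrC addKr.
  by rewrite /critical_gap pE1 invf_div mulrCA mulfV// mulr1 subrr.
have [B [B0 h]] := critical_lifespan p1 cF (ltW ha0) alpha_lt0 beta01
  u02 hu1 supp_u0 supp_u1 hpos g0.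
by exists 1, B; split=> // eps epsP; split=> // _; exact: h.
Qed.
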